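(* For any $\mu\in\Sigma(\mathcal B)$ and any completely positive $\mathbb C$-linear map $\alpha:\mathcal B\to\mathcal B$, the distribution $\mu^{\uplus\alpha}$ belongs to $\Sigma(\mathcal B)$. Moreover, if $\mu\in\Sigma^0(\mathcal B)$, then $\mu^{\uplus\alpha}\in\Sigma^0(\mathcal B)$.
   Context: $\mathcal B$ is a fixed unital $C^*$-algebra. Distributions. $\mathcal B\langle \mathcal X\rangle$ is the $*$-algebra of polynomials in a self-adjoint formal variable $\mathcal X$ with coefficients in $\mathcal B$, where $\mathcal X$ and $\mathcal B$ are algebraically independent: as a vector space it is $\bigoplus_{n\ge 0}$ of the spans of the monomials $b_0\mathcal X b_1\cdots \mathcal X b_n$, the $n$-th span being isomorphic to $\mathcal B^{\otimes_{\mathbb C}(n+1)}$. $\Sigma_{alg}(\mathcal B)$ is the set of all $\mathbb C$-linear $\mathcal B$-bimodule maps $\mu:\mathcal B\langle\mathcal X\rangle\to\mathcal B$ with $\mu[b]=b$ for $b\in\mathcal B$. $\Sigma(\mathcal B)$ is the set of those $\mu\in\Sigma_{alg}(\mathcal B)$ that are positive ($\mu[P^*P]\ge 0$ for all $P$; such $\mu$ is automatically completely positive). $\Sigma^0(\mathcal B)\subset\Sigma(\mathcal B)$ is the set of distributions $\mu[b_0\mathcal Xb_1\cdots\mathcal Xb_n]=\mathbb E[b_0Xb_1\cdots Xb_n]$ of self-adjoint elements $X$ of $\mathcal B$-valued $C^*$-probability spaces $(\mathcal M,\mathbb E)$ ($\mathcal M\supseteq\mathcal B$ a $C^*$-algebra,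 $\mathbb E:\mathcal M\to\mathcal B$ a unital positive $\mathcal B$-bimodule map); equivalently, the $\mu \in \Sigma(\mathcal B)$ for which there is $M>0$ with $\|\mu[\mathcal X b_1\mathcal X\cdots b_{n-1}\mathcal X]\|\le M^n\|b_1\|\cdots\|b_{n-1}\|$ for all $n$ and all $b_i\in\mathcal B$. Series. $\mathrm{Ser}(\mathcal B)$ is the set of sequences $F=(F^{[n]})_{n\ge1}$ with $F^{[1]}\in\mathcal B$ and $F^{[n]}:\mathcal B^{n-1}\to\mathcal B$ $\mathbb C$-multilinear. For linear $\alpha:\mathcal B\to\mathcal B$, $(\alpha\circ F)^{[n]}:=\alpha\circ F^{[n]}$. The moment series of $\mu\in\Sigma_{alg}(\mathcal B)$ is $M_\mu^{[1]}=\mu[\mathcal X]$, $M_\mu^{[n]}(b_1,\dots,b_{n-1})=\mu[\mathcal Xb_1\mathcal X\cdots b_{n-1}\mathcal X]$; $\mu\mapsto M_\mu$ is a bijection $\Sigma_{alg}(\mathcal B)\to\mathrm{Ser}(\mathcal B)$. $B$-transform and Boolean convolution power. For $\mu\in\Sigma_{alg}(\mathcal B)$, the $B$-transform $B_\mu\in\mathrm{Ser}(\mathcal B)$ is the unique series such that for all $n\ge1$ and $b_1,\dots,b_{n-1}\in\mathcal B$, $$M_\mu^{[n]}(b_1,\dots,b_{n-1})=\sum_{k=1}^n\ \sum_{0=q_0<q_1<\cdots<q_k=n}B_\mu^{[q_1-q_0]}(b_{q_0+1},\dots,b_{q_1-1})\,b_{q_1}\,B_\mu^{[q_2-q_1]}(b_{q_1+1},\dots,b_{q_2-1})\,b_{q_2}\cdots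 b_{q_{k-1}}B_\mu^{[q_k-q_{k-1}]}(b_{q_{k-1}+1},\dots,b_{q_k-1})$$ (a sum over interval partitions of $\{1,\dots,n\}$). The map $\mu\mapsto B_\mu$ is a bijection $\Sigma_{alg}(\mathcal B)\to\mathrm{Ser}(\mathcal B)$. For linear $\alpha:\mathcal B\to\mathcal B$, $\mu^{\uplus\alpha}\in\Sigma_{alg}(\mathcal B)$ is the distribution determined by $B_{\mu^{\uplus\alpha}}=\alpha\circ B_\mu$. *)

(* Defs.v *)
From HB Require Import structures.
From mathcomp Require Import all_boot all_order all_algebra.
From mathcomp Require Import complex.
From mathcomp Require Import boolp reals.

Set Implicit Arguments.
Unset Strict Implicit.
Unset Printing Implicit Defensive.

Import Order.TTheory GRing.Theory Num.Theory.

Local Open Scope ring_scope.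
Local Open Scope complex_scope.
Local Open Scope quotient_scope.

HB.mixin Record Algebra_isStarAlgebra (R : realType) A
    & GRing.Algebra R[i] A := {
  star : A -> A;
  starK : involutive star;
  starD : {morph star : a b / a + b};
  starZ : forall (c : R[i]) (a : A), star (c *: a) = c^* *: star a;
  starM : forall a b : A, star (a * b) = star b * star a
}.

#[short(type="starAlgType")]
HB.structure Definition StarAlgebra (R : realType) :=
  {A of GRing.Algebra R[i] A & Algebra_isStarAlgebra R A}.

(* The norm is a field of the structure, and completeness is stated with
   Cauchy sequences, because Hierarchy Builder has no join of the normed
   modules of mathcomp-analysis with rings that are not ordered. *)
HB.mixin Record StarAlgebra_isCStarAlgebra (R : realType) A
    & StarAlgebra R A := {
  cnorm : A -> R;
  cnormD : forall a b : A, cnorm (a + b) <= cnorm a + cnorm b;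
  cnormZ : forall (c : R[i]) (a : A),
    (cnorm (c *: a))%:C = `|c| * (cnorm a)%:C;
  cnorm0_eq0 : forall a : A, cnorm a = 0 -> a = 0;
  cnormM : forall a b : A, cnorm (a * b) <= cnorm a * cnorm b;
  cnorm_star : forall a : A, cnorm (star a * a) = cnorm a ^+ 2;
  cnorm_complete : forall u : nat -> A,
    (forall e : R, 0 < e -> exists N : nat, forall m n : nat,
      (N <= m)%N -> (N <= n)%N -> cnorm (u m - u n) < e) ->
    exists l : A, forall e : R, 0 < e -> exists N : nat, forall n : nat,
      (N <= n)%N -> cnorm (u n - l) < e
}.

#[short(type="cstarAlgType")]
HB.structure Definition CStarAlgebra (R : realType) :=
  {A of StarAlgebra R A & StarAlgebra_isCStarAlgebra R A}.

Section Positivity.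
Variables (R : realType) (A : starAlgType R).

Lemma star0 : star (0 : A) = 0.
Proof. by apply: (addrI (star 0)); rewrite -starD !addr0. Qed.

Lemma starN (a : A) : star (- a) = - star a.
Proof. by apply/eqP; rewrite -addr_eq0 -starD addNr star0. Qed.

Lemma star1 : star (1 : A) = 1.
Proof. by rewrite -[LHS]mulr1 -[X in _ * X]starK -starM mulr1 starK. Qed.

(* In a C*-algebra, the elements star c * c are exactly the self-adjoint
   elements with spectrum in [0, +oo[. mx_positive is positivity in the
   C*-algebra of n x n matrices, with the conjugate transpose as star. *)
Definition positive (a : A) := exists c : A, a = star c * c.

Definition mx_positive n (M : 'M[A]_n) :=
  exists C : 'M[A]_n, M = (map_mx star C)^T *m C.

End Positivity.

Definition completely_positive (R : realType) (A : starAlgType R)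
    (alpha : A -> A) :=
  forall n (M : 'M[A]_n), mx_positive M -> mx_positive (map_mx alpha M).

(* A family of multilinear maps [Phi_n : B^n -> V], n >= 0, is encoded as one
   function on lists that is linear in each entry. *)
Definition multilinear (R : realType) (B : lmodType R[i]) (V : lmodType R[i])
    (Phi : seq B -> V) :=
  forall (s t : seq B) (c : R[i]) (a b : B),
    Phi (s ++ (c *: a + b) :: t) = c *: Phi (s ++ a :: t) + Phi (s ++ b :: t).

(* V with the conjugate scalar multiplication. *)
Definition conjmod (R : realType) (V : lmodType R[i]) : Type := V.
HB.instance Definition _ (R : realType) (V : lmodType R[i]) :=
  GRing.Zmodule.on (@conjmod R V).
Section ConjMod.
Variables (R : realType) (V : lmodType R[i]).
Let cscale (c : R[i]) (v : conjmod V) : conjmod V := c^* *: (v : V).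
Fact conjmodA a b v : cscale a (cscale b v) = cscale (a * b) v.
Proof. by rewrite /cscale scalerA rmorphM. Qed.
Fact conjmod1 : left_id 1 cscale.
Proof. by move=> v; rewrite /cscale rmorph1 scale1r. Qed.
Fact conjmodDr : right_distributive cscale +%R.
Proof. by move=> a u v; rewrite /cscale scalerDr. Qed.
Fact conjmodDl v : {morph cscale^~ v : a b / a + b}.
Proof. by move=> a b; rewrite /cscale rmorphD scalerDl. Qed.
HB.instance Definition _ := GRing.Zmodule_isLmodule.Build R[i] (conjmod V)
  conjmodA conjmod1 conjmodDr conjmodDl.
Lemma conjmod_scaleE (c : R[i]) (v : conjmod V) : c *: v = c^* *: (v : V).
Proof. by []. Qed.
End ConjMod.

Section MultilinearTheory.
Variables (R : realType) (B V : lmodType R[i]) (Phi : seq B -> V).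
Hypothesis PhiL : multilinear Phi.

Lemma multilinearD s t a b :
  Phi (s ++ (a + b) :: t) = Phi (s ++ a :: t) + Phi (s ++ b :: t).
Proof. by have := PhiL s t 1 a b; rewrite !scale1r. Qed.

Lemma multilinear0 s t : Phi (s ++ 0 :: t) = 0.
Proof.
by apply: (addrI (Phi (s ++ 0 :: t))); rewrite -multilinearD !addr0.
Qed.

Lemma multilinearZ s t (c : R[i]) a : Phi (s ++ (c *: a) :: t) = c *: Phi (s ++ a :: t).
Proof. by have := PhiL s t c a 0; rewrite addr0 multilinear0 addr0. Qed.

Lemma multilinearN s t a : Phi (s ++ (- a) :: t) = - Phi (s ++ a :: t).
Proof. by rewrite -scaleN1r multilinearZ scaleN1r. Qed.
End MultilinearTheory.

(* The pair (b_0, [:: b_1; ...; b_n]) stands for the monomial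
   b_0 X b_1 ... X b_n, and a list of pairs for a sum of monomials. *)
Section FormalPolynomials.
Variables (R : realType) (B : starAlgType R).

Definition word : Type := (B * seq B)%type.
Definition letters (w : word) : seq B := w.1 :: w.2.
Definition wordof (l : seq B) : word := (head 0 l, behead l).

Definition fpoly : Type := seq word.

Definition feval (V : lmodType R[i]) (Phi : seq B -> V) (P : fpoly) : V :=
  \sum_(w <- P) Phi (letters w).

(* By the universal property of tensor products, two sums of monomials are
   equal in the direct sum of the B^{\otimes(n+1)} iff every family of
   multilinear maps takes the same value on them. *)
Definition fequiv (P Q : fpoly) : bool :=
  `[< forall (V : lmodType R[i]) (Phi : seq B -> V),
        multilinear Phi -> feval Phi P = feval Phi Q >].

Lemma fequivP P Q :
  reflect (forall (V : lmodType R[i]) (Phi : seq B -> V),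
             multilinear Phi -> feval Phi P = feval Phi Q) (fequiv P Q).
Proof. exact: asboolP. Qed.

Fact fequiv_refl : reflexive fequiv.
Proof. by move=> P; apply/fequivP. Qed.
Fact fequiv_sym : symmetric fequiv.
Proof. by move=> P Q; apply/fequivP/fequivP => E V Phi L; rewrite E. Qed.
Fact fequiv_trans : transitive fequiv.
Proof.
by move=> Q P S /fequivP E /fequivP F; apply/fequivP => V Phi L; rewrite E ?F.
Qed.

(* lmul multiplies the last entry of l by the first entry of m:
   (b_0 X ... X b_n)(c_0 X ... X c_m) = b_0 X ... X b_n c_0 X ... X c_m. *)
Definition lmul (l m : seq B) : seq B :=
  belast (head 0 l) (behead l)
    ++ (last 0 l * head 0 m) :: behead m.

Definition wmul (v w : word) : word := wordof (lmul (letters v) (letters w)).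
Definition wscale (c : R[i]) (w : word) : word := (c *: w.1, w.2).
Definition wstar (w : word) : word := wordof (rev (map star (letters w))).

Definition fone : fpoly := [:: (1, [::])].
Definition fadd (P Q : fpoly) : fpoly := P ++ Q.
Definition fscale (c : R[i]) (P : fpoly) : fpoly := map (wscale c) P.
Definition fmul (P Q : fpoly) : fpoly := [seq wmul v w | v <- P, w <- Q].
Definition fstar (P : fpoly) : fpoly := map wstar P.

Lemma lettersK w : wordof (letters w) = w.
Proof. by case: w. Qed.

Lemma letters_wordof l : l != [::] -> letters (wordof l) = l.
Proof. by case: l. Qed.

Lemma lmulE s b c t : lmul (rcons s b) (c :: t) = s ++ (b * c) :: t.
Proof. by rewrite /lmul last_rcons; case: s => //= a s; rewrite belast_rcons. Qed.

Lemma lmul_neq0 l m : lmul l m != [::].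
Proof. by rewrite /lmul; case: (belast _ _). Qed.

Lemma letters_wmul v w : letters (wmul v w) = lmul (letters v) (letters w).
Proof. by rewrite letters_wordof ?lmul_neq0. Qed.

Lemma letters_wscale c w : letters (wscale c w) = (c *: w.1) :: w.2.
Proof. by []. Qed.

Lemma letters_wstar w : letters (wstar w) = rev (map star (letters w)).
Proof. by rewrite letters_wordof //= rev_cons; case: (rev _). Qed.

Lemma letters_rcons w : exists s b, letters w = rcons s b.
Proof.
by case: w => b s; exists (belast b s), (last b s); rewrite /letters lastI.
Qed.

Lemma lmulA l m n : l != [::] -> m != [::] -> n != [::] ->
  lmul l (lmul m n) = lmul (lmul l m) n.
Proof.
case/lastP: l => // s b _; case: m => // c t _; case: n => // d u _.
case/lastP: t => [|t e].
  by rewrite (lmulE [::] c) /= !lmulE cats1 lmulE mulrA.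
rewrite -rcons_cons lmulE /= !lmulE.
by rewrite -rcons_cons -rcons_cat lmulE -catA.
Qed.

Lemma lmul1l l : l != [::] -> lmul [:: 1] l = l.
Proof. by case: l => // b l _; rewrite (lmulE [::]) /= mul1r. Qed.

Lemma lmul1r l : l != [::] -> lmul l [:: 1] = l.
Proof. by case/lastP: l => // s b _; rewrite lmulE mulr1 cats1. Qed.

Lemma multilinear_lmul_l (V : lmodType R[i]) (Phi : seq B -> V) m :
  multilinear Phi -> m != [::] -> multilinear (fun l => Phi (lmul l m)).
Proof.
move=> L; case: m => // d m _ s t c a b.
case/lastP: t => [|t e].
  by rewrite !cats1 !lmulE mulrDl -scalerAl L.
by rewrite -!rcons_cons -!rcons_cat !lmulE -!catA /= L.
Qed.

Lemma multilinear_lmul_r (V : lmodType R[i]) (Phi : seq B -> V) l :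
  multilinear Phi -> l != [::] -> multilinear (fun m => Phi (lmul l m)).
Proof.
move=> L; case/lastP: l => // l d _ s t c a b.
case: s => [|e s]; first by rewrite /= !lmulE mulrDr -scalerAr L.
by rewrite /= !lmulE -!cat_cons !catA L.
Qed.

Lemma multilinear_star (V : lmodType R[i]) (Phi : seq B -> V) :
  multilinear Phi ->
  multilinear (fun l => Phi (rev (map star l)) : conjmod V).
Proof.
move=> L s t c a b; rewrite !map_cat /= !rev_cat !rev_cons !cat_rcons.
by rewrite starD starZ L.
Qed.

Lemma feval_cat (V : lmodType R[i]) (Phi : seq B -> V) P Q :
  feval Phi (P ++ Q) = feval Phi P + feval Phi Q.
Proof. exact: big_cat. Qed.

Lemma feval_scale (V : lmodType R[i]) (Phi : seq B -> V) c P :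
  multilinear Phi -> feval Phi (fscale c P) = c *: feval Phi P.
Proof.
move=> L; rewrite /feval big_map scaler_sumr; apply: eq_bigr => w _.
by rewrite letters_wscale (multilinearZ L [::]).
Qed.

Lemma feval_mul (V : lmodType R[i]) (Phi : seq B -> V) P Q :
  feval Phi (fmul P Q) =
  \sum_(v <- P) \sum_(w <- Q) Phi (lmul (letters v) (letters w)).
Proof.
rewrite /feval big_allpairs_dep; apply: eq_bigr => v _; apply: eq_bigr => w _.
by rewrite letters_wmul.
Qed.

Lemma feval_star (V : lmodType R[i]) (Phi : seq B -> V) P :
  feval Phi (fstar P) = \sum_(w <- P) Phi (rev (map star (letters w))).
Proof.
by rewrite /feval big_map; apply: eq_bigr => w _; rewrite letters_wstar.
Qed.

Canonical fequiv_equiv :=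
  EquivRel fequiv fequiv_refl fequiv_sym fequiv_trans.

Definition ncpoly : Type := {eq_quot fequiv}.
HB.instance Definition _ := Choice.on ncpoly.
HB.instance Definition _ := EqQuotient.on ncpoly.

Definition npi (P : fpoly) : ncpoly := \pi_ncpoly P.

Lemma npiP P Q :
  (forall (V : lmodType R[i]) (Phi : seq B -> V),
     multilinear Phi -> feval Phi P = feval Phi Q) <-> npi P = npi Q.
Proof.
by split=> [E|/eqmodP/fequivP//]; apply/eqmodP/fequivP.
Qed.

Lemma npi_repr (p : ncpoly) : npi (repr p) = p.
Proof. exact: reprK. Qed.

Lemma npiW (T : ncpoly -> Prop) : (forall P, T (npi P)) -> forall p, T p.
Proof. by move=> H p; rewrite -[p]npi_repr. Qed.

Lemma feval_repr (V : lmodType R[i]) (Phi : seq B -> V) P :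
  multilinear Phi -> feval Phi (repr (npi P)) = feval Phi P.
Proof. by move: (V) (Phi); apply/npiP; rewrite npi_repr. Qed.

Definition nadd (p q : ncpoly) := npi (fadd (repr p) (repr q)).
Definition nscale (c : R[i]) (p : ncpoly) := npi (fscale c (repr p)).
Definition nmul (p q : ncpoly) := npi (fmul (repr p) (repr q)).
Definition nstar (p : ncpoly) := npi (fstar (repr p)).

Lemma npiD P Q : nadd (npi P) (npi Q) = npi (fadd P Q).
Proof. by apply/npiP => V Phi L; rewrite !feval_cat !feval_repr. Qed.

Lemma npiZ c P : nscale c (npi P) = npi (fscale c P).
Proof. by apply/npiP => V Phi L; rewrite !feval_scale // feval_repr. Qed.

Lemma npiM P Q : nmul (npi P) (npi Q) = npi (fmul P Q).
Proof.
apply/npiP => V Phi L; rewrite !feval_mul.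
under eq_bigr => v _.
  have /(feval_repr Q) := @multilinear_lmul_r V Phi (letters v) L isT.
  rewrite /feval => ->; over.
rewrite exchange_big [RHS]exchange_big; apply: eq_bigr => w _.
exact: (feval_repr P (@multilinear_lmul_l V Phi (letters w) L isT)).
Qed.

Lemma npi_star P : nstar (npi P) = npi (fstar P).
Proof.
apply/npiP => V Phi L; rewrite !feval_star.
exact: (feval_repr P (multilinear_star L)).
Qed.

Fact naddA : associative nadd.
Proof.
elim/npiW=> P; elim/npiW=> Q; elim/npiW=> S.
by rewrite !npiD /fadd catA.
Qed.
Fact naddC : commutative nadd.
Proof.
elim/npiW=> P; elim/npiW=> Q; rewrite !npiD.
by apply/npiP => V Phi L; rewrite !feval_cat addrC.
Qed.
Fact nadd0 : left_id (npi [::]) nadd.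
Proof. by elim/npiW=> P; rewrite npiD. Qed.
Fact naddN : left_inverse (npi [::]) (nscale (-1)) nadd.
Proof.
elim/npiW=> P; rewrite npiZ npiD; apply/npiP => V Phi L.
by rewrite feval_cat feval_scale // scaleN1r addNr /feval big_nil.
Qed.
HB.instance Definition _ :=
  GRing.isZmodule.Build ncpoly naddA naddC nadd0 naddN.

Fact nmulA : associative nmul.
Proof.
elim/npiW=> P; elim/npiW=> Q; elim/npiW=> S; rewrite !npiM.
apply/npiP => V Phi L; rewrite !feval_mul.
rewrite [RHS]big_allpairs_dep; apply: eq_bigr => u _.
rewrite big_allpairs_dep; apply: eq_bigr => v _; apply: eq_bigr => w _.
by rewrite !letters_wmul lmulA.
Qed.
Fact nmul1l : left_id (npi fone) nmul.
Proof.
elim/npiW=> P; rewrite npiM; apply/npiP => V Phi L.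
by rewrite feval_mul big_seq1; apply: eq_bigr => w _; rewrite lmul1l.
Qed.
Fact nmul1r : right_id (npi fone) nmul.
Proof.
elim/npiW=> P; rewrite npiM; apply/npiP => V Phi L; rewrite feval_mul.
by apply: eq_bigr => w _; rewrite big_seq1 lmul1r.
Qed.
Fact nmulDl : left_distributive nmul +%R.
Proof.
elim/npiW=> P; elim/npiW=> Q; elim/npiW=> S; rewrite /GRing.add /=.
rewrite !(npiM, npiD).
by apply/npiP => V Phi L; rewrite feval_cat !feval_mul big_cat.
Qed.
Fact nmulDr : right_distributive nmul +%R.
Proof.
elim/npiW=> P; elim/npiW=> Q; elim/npiW=> S; rewrite /GRing.add /=.
rewrite !(npiM, npiD).
apply/npiP => V Phi L; rewrite feval_cat !feval_mul -big_split /=.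
by apply: eq_bigr => u _; rewrite big_cat.
Qed.

Let Phi0 (l : seq B) : B := if l is [:: b] then b else 0.
Fact Phi0_multilinear : multilinear Phi0.
Proof.
move=> [|d [|e s]] [|f t] c a b //=; rewrite ?scaler0 ?addr0 //.
Qed.
Fact none_neq0 : npi fone != 0.
Proof.
apply/eqP => /npiP/(_ _ _ Phi0_multilinear).
by rewrite /feval big_seq1 big_nil /= => /eqP; rewrite oner_eq0.
Qed.
HB.instance Definition _ := GRing.Zmodule_isNzRing.Build ncpoly
  nmulA nmul1l nmul1r nmulDl nmulDr none_neq0.

Fact nscaleA a b p : nscale a (nscale b p) = nscale (a * b) p.
Proof.
elim/npiW: p => P; rewrite !npiZ; apply/npiP => V Phi L.
by rewrite !feval_scale // scalerA.
Qed.
Fact nscale1 : left_id 1 nscale.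
Proof.
elim/npiW=> P; rewrite npiZ; apply/npiP => V Phi L.
by rewrite feval_scale // scale1r.
Qed.
Fact nscaleDr : right_distributive nscale +%R.
Proof.
move=> a; elim/npiW=> P; elim/npiW=> Q; rewrite /GRing.add /= !(npiZ, npiD).
by rewrite /fadd /fscale map_cat.
Qed.
Fact nscaleDl p : {morph nscale^~ p : a b / a + b}.
Proof.
move=> a b; elim/npiW: p => P.
rewrite {2}/GRing.add /= !(npiZ, npiD); apply/npiP => V Phi L.
by rewrite feval_cat !feval_scale // scalerDl.
Qed.
HB.instance Definition _ := GRing.Zmodule_isLmodule.Build R[i] ncpoly
  nscaleA nscale1 nscaleDr nscaleDl.

Fact nscaleAl (c : R[i]) (p q : ncpoly) : c *: (p * q) = (c *: p) * q.
Proof.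
elim/npiW: p => P; elim/npiW: q => Q.
rewrite /GRing.scale /GRing.mul /= !(npiM, npiZ); apply/npiP => V Phi L.
rewrite feval_scale // !feval_mul big_map scaler_sumr; apply: eq_bigr => v _.
rewrite scaler_sumr; apply: eq_bigr => w _.
by rewrite letters_wscale (multilinearZ (multilinear_lmul_l L _) [::]).
Qed.
HB.instance Definition _ := GRing.Lmodule_isLalgebra.Build R[i] ncpoly nscaleAl.

Fact nscaleAr (c : R[i]) (p q : ncpoly) : c *: (p * q) = p * (c *: q).
Proof.
elim/npiW: p => P; elim/npiW: q => Q.
rewrite /GRing.scale /GRing.mul /= !(npiM, npiZ); apply/npiP => V Phi L.
rewrite feval_scale // !feval_mul scaler_sumr; apply: eq_bigr => v _.
rewrite big_map scaler_sumr; apply: eq_bigr => w _.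
by rewrite letters_wscale (multilinearZ (multilinear_lmul_r L _) [::]).
Qed.
HB.instance Definition _ := GRing.Lalgebra_isAlgebra.Build R[i] ncpoly nscaleAr.

Fact nstarK : involutive nstar.
Proof.
elim/npiW=> P; rewrite !npi_star; apply/npiP => V Phi L.
rewrite feval_star big_map; apply: eq_bigr => w _.
by rewrite letters_wstar map_rev revK -map_comp (eq_map starK) map_id.
Qed.
Fact nstarD : {morph nstar : p q / p + q}.
Proof.
elim/npiW=> P; elim/npiW=> Q; rewrite /GRing.add /= !(npi_star, npiD).
by rewrite /fadd /fstar map_cat.
Qed.
Fact nstarZ (c : R[i]) (p : ncpoly) : nstar (c *: p) = c^* *: nstar p.
Proof.
elim/npiW: p => P; rewrite /GRing.scale /= !(npi_star, npiZ).
apply/npiP => V Phi L; rewrite feval_scale // !feval_star big_map scaler_sumr.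
apply: eq_bigr => w _.
exact: (multilinearZ (multilinear_star L) [::]).
Qed.

Lemma rev_star_lmul l m : l != [::] -> m != [::] ->
  rev (map star (lmul l m)) = lmul (rev (map star m)) (rev (map star l)).
Proof.
case/lastP: l => // s b _; case: m => // c t _; rewrite lmulE.
rewrite map_cat /= rev_cat rev_cons cat_rcons map_rcons rev_rcons.
by rewrite rev_cons lmulE starM.
Qed.

Fact nstarM (p q : ncpoly) : nstar (p * q) = nstar q * nstar p.
Proof.
elim/npiW: p => P; elim/npiW: q => Q; rewrite /GRing.mul /= !(npi_star, npiM).
apply/npiP => V Phi L; rewrite feval_star feval_mul !big_map.
rewrite big_allpairs_dep exchange_big; apply: eq_bigr => w _.
rewrite big_map; apply: eq_bigr => v _.
by rewrite !letters_wstar letters_wmul rev_star_lmul.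
Qed.
HB.instance Definition _ := Algebra_isStarAlgebra.Build R ncpoly
  nstarK nstarD nstarZ nstarM.

End FormalPolynomials.

Section Generators.
Variables (R : realType) (B : starAlgType R).
Local Notation ncp := (ncpoly B).

Definition ncC (b : B) : ncp := npi [:: (b, [::])].
Definition ncX : ncp := npi [:: (1, [:: 1])].

(* b_0 X b_1 X ... X b_n, where bs = [:: b_1; ...; b_n]. *)
Definition ncmonom (b0 : B) (bs : seq B) : ncp :=
  ncC b0 * \prod_(b <- bs) (ncX * ncC b).

Lemma npi_add P Q : npi P + npi Q = npi (P ++ Q) :> ncp.
Proof. exact: npiD. Qed.
Lemma npi_mul P Q : npi P * npi Q = npi (fmul P Q) :> ncp.
Proof. exact: npiM. Qed.
Lemma npi_scale c P : c *: npi P = npi (fscale c P) :> ncp.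
Proof. exact: npiZ. Qed.
Lemma star_npi P : star (npi P : ncp) = npi (fstar P).
Proof. exact: npi_star. Qed.

Lemma npi_words (P : fpoly B) : npi P = \sum_(w <- P) npi [:: w].
Proof.
elim: P => [|w P IH]; first by rewrite big_nil.
by rewrite big_cons -IH npi_add.
Qed.

Fact ncC_is_linear : linear ncC.
Proof.
move=> c a b; rewrite /ncC npi_scale npi_add; apply/npiP => V Phi L.
rewrite /feval !big_cons !big_nil !addr0.
by rewrite /letters /= (multilinearD L [::]).
Qed.
HB.instance Definition _ := GRing.isLinear.Build R[i] B ncp _ ncC ncC_is_linear.

Fact ncC_is_monoid_morphism : monoid_morphism ncC.
Proof. by split=> [//|a b]; rewrite /ncC npi_mul. Qed.
HB.instance Definition _ :=
  GRing.isMonoidMorphism.Build B ncp ncC ncC_is_monoid_morphism.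

Lemma star_ncC b : star (ncC b) = ncC (star b).
Proof. by rewrite star_npi. Qed.

Lemma star_ncX : star ncX = ncX.
Proof. by rewrite star_npi /= /wstar /= /rev /= star1. Qed.

Lemma ncmonomE b0 bs : ncmonom b0 bs = npi [:: (b0, bs)].
Proof.
rewrite /ncmonom; elim: bs b0 => [|b bs IH] b0; first by rewrite big_nil mulr1.
have XE : ncX * npi [:: (b, bs)] = npi [:: (1, b :: bs)].
  by rewrite (npi_mul [:: _] [:: _]) /fmul /= /wmul /wordof /lmul /= mul1r.
rewrite big_cons -mulrA IH XE (npi_mul [:: _] [:: _]) /fmul /= /wmul /wordof /lmul /=.
by rewrite mulr1.
Qed.

Lemma npi_ncmonom (P : fpoly B) : npi P = \sum_(w <- P) ncmonom w.1 w.2.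
Proof.
by rewrite npi_words; apply: eq_bigr => -[b bs] _; rewrite ncmonomE.
Qed.

Lemma ncmonomM (v w : B * seq B) :
  ncmonom v.1 v.2 * ncmonom w.1 w.2 = ncmonom (wmul v w).1 (wmul v w).2.
Proof. by rewrite !ncmonomE npi_mul -!surjective_pairing. Qed.

(* The universal property of the direct sum of the B^{\otimes(n+1)}. *)
Definition nclift (V : lmodType R[i]) (Phi : seq B -> V) (p : ncp) : V :=
  feval Phi (repr p).

Lemma nclift_npi (V : lmodType R[i]) (Phi : seq B -> V) P :
  multilinear Phi -> nclift Phi (npi P) = feval Phi P.
Proof. exact: feval_repr. Qed.

Lemma nclift_monom (V : lmodType R[i]) (Phi : seq B -> V) b bs :
  multilinear Phi -> nclift Phi (ncmonom b bs) = Phi (b :: bs).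
Proof. by move=> L; rewrite ncmonomE nclift_npi // /feval big_seq1. Qed.

Lemma nclift_linear (V : lmodType R[i]) (Phi : seq B -> V) :
  multilinear Phi -> linear (nclift Phi).
Proof.
move=> L c; elim/npiW=> P; elim/npiW=> Q.
by rewrite npi_scale npi_add !nclift_npi // feval_cat feval_scale.
Qed.

End Generators.

Section Distributions.
Variables (R : realType) (B : starAlgType R).

(* Sigma_alg(B) *)
Record distribution := Distribution {
  dist_fun :> {linear ncpoly B -> B};
  dist_bimod : forall (b b' : B) (P : ncpoly B),
    dist_fun (ncC b * P * ncC b') = b * dist_fun P * b';
  dist_const : forall b : B, dist_fun (ncC b) = b
}.

(* Ser(B): F [:: b_1; ...; b_(n-1)] is F^{[n]}(b_1, ..., b_(n-1)), n >= 1. *)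
Record series := Series {
  series_fun :> seq B -> B;
  series_multilinear : multilinear series_fun
}.

Fact comp_series_multilinear (alpha : {linear B -> B}) (F : series) :
  multilinear (alpha \o F).
Proof. by move=> s t c a b /=; rewrite series_multilinear linearP. Qed.

Definition comp_series (alpha : {linear B -> B}) (F : series) : series :=
  Series (comp_series_multilinear alpha F).

(* mu[X b_1 X ... b_(n-1) X] *)
Definition moment_fun (mu : distribution) (bs : seq B) : B :=
  mu (ncX B * \prod_(b <- bs) (ncC b * ncX B)).

(* For bs = [:: b_1; ...; b_(n-1)], this is the list b_(i+1), ..., b_(j-1). *)
Definition slots (bs : seq B) (i j : nat) : seq B := take (j.-1 - i) (drop i bs).

(* The summand indexed by q = [:: q_0; ...; q_k]; b_(q_j) is the entry of bs
   of index q_j - 1. *)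
Definition interval_term (F : seq B -> B) (bs : seq B) (q : seq nat) : B :=
  F (slots bs (nth 0%N q 0) (nth 0%N q 1)) *
  \prod_(1 <= j < (size q).-1)
    (nth 0 bs (nth 0%N q j).-1 * F (slots bs (nth 0%N q j) (nth 0%N q j.+1))).

(* 0 = q_0 < q_1 < ... < q_k = n *)
Definition cuts (n k : nat) (q : k.+1.-tuple 'I_n.+1) : bool :=
  [&& tnth q ord0 == 0%N :> nat, tnth q ord_max == n :> nat
    & sorted ltn (map val q)].

Definition interval_sum (F : seq B -> B) (bs : seq B) : B :=
  let n := (size bs).+1 in
  \sum_(1 <= k < n.+1) \sum_(q : k.+1.-tuple 'I_n.+1 | cuts q)
    interval_term F bs (map val q).

Definition is_Btransform (mu : distribution) (F : series) :=
  forall bs : seq B, moment_fun mu bs = interval_sum F bs.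

End Distributions.

Section IntervalTheory.
Variables (R : realType) (B : starAlgType R).
Implicit Types (F G : seq B -> B) (bs s t : seq B) (q : seq nat).

Definition is_cuts (n : nat) (q : seq nat) :=
  [/\ (1 < size q)%N, nth 0%N q 0 = 0%N, nth 0%N q (size q).-1 = n
    & sorted ltn q].

Lemma cutsP n k (q : k.+1.-tuple 'I_n.+1) : (0 < k)%N ->
  cuts q -> is_cuts n (map val q).
Proof.
move=> k0 /and3P[/eqP q0 /eqP qk qs]; split => //.
- by rewrite size_map size_tuple.
- by rewrite -[RHS]q0 (tnth_nth ord0) (nth_map ord0) // size_tuple.
- rewrite size_map size_tuple /= -[RHS]qk (tnth_nth ord0) (nth_map ord0) //.
  by rewrite size_tuple.
Qed.

Lemma is_cuts_lt n q i j : is_cuts n q -> (i < j)%N -> (j < size q)%N ->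
  (nth 0%N q i < nth 0%N q j)%N.
Proof.
case=> _ _ _ qs ij jq; apply: (sorted_ltn_nth ltn_trans) => //.
by rewrite inE (ltn_trans ij).
Qed.

Lemma is_cuts_le n q i j : is_cuts n q -> (i <= j)%N -> (j < size q)%N ->
  (nth 0%N q i <= nth 0%N q j)%N.
Proof.
move=> qc; rewrite leq_eqVlt => /orP[/eqP -> //|ij jq].
exact/ltnW/(is_cuts_lt qc).
Qed.

Lemma size_slots bs i j : (size (slots bs i j) <= j.-1 - i)%N.
Proof. by rewrite size_take; case: ltnP. Qed.

Lemma is_cuts_slot bs q j : is_cuts (size bs).+1 q -> (2 < size q)%N ->
  (j.+1 < size q)%N ->
  (size (slots bs (nth 0%N q j) (nth 0%N q j.+1)) < size bs)%N.
Proof.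
move=> qc q2 jq; apply: (leq_ltn_trans (size_slots _ _ _)).
have h1 := is_cuts_lt qc (ltnSn j) jq.
case: (qc) => q1 q0 qn _.
case: j => [|j] in jq h1 *.
  have : (nth 0%N q 1 < (size bs).+1)%N.
    by rewrite -qn; apply: (is_cuts_lt qc); case: (size q) q2 => [|[|[]]].
  by rewrite q0 in h1 *; case: (nth 0%N q 1) h1 => //= m _; rewrite subn0.
have h2 : (0 < nth 0%N q j.+1)%N.
  by rewrite -[X in (X < _)%N]q0; apply: (is_cuts_lt qc) => //; apply: ltnW.
have h3 : (nth 0%N q j.+2 <= (size bs).+1)%N.
  by rewrite -qn; apply: (is_cuts_le qc); case: (size q) jq q1.
case: (nth 0%N q j.+2) h1 h3 => // m; case: (nth 0%N q j.+1) h2 => //= l _ lm mb.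
by rewrite ltn_subLR // (leq_trans mb) // ltnS leq_addl.
Qed.

Lemma interval_term_ext F G bs q : is_cuts (size bs).+1 q -> (2 < size q)%N ->
  (forall l, (size l < size bs)%N -> F l = G l) ->
  interval_term F bs q = interval_term G bs q.
Proof.
move=> qc q2 FG; rewrite /interval_term FG; last first.
  by apply: (is_cuts_slot qc) => //; apply: ltnW.
congr (_ * _); apply: eq_big_nat => j /andP[j0 jq].
by rewrite FG //; apply: (is_cuts_slot qc); rewrite // -ltn_predRL.
Qed.

Definition sep (bs : seq B) (q : seq nat) (j : nat) : B :=
  if j is 0 then 1 else nth 0 bs (nth 0%N q j).-1.

Lemma interval_termE F bs q : (1 < size q)%N ->
  interval_term F bs q =
  \prod_(0 <= j < (size q).-1)
    (sep bs q j * F (slots bs (nth 0%N q j) (nth 0%N q j.+1))).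
Proof.
case: q => [|q0 [|q1 q]] //= _; rewrite /interval_term /= [RHS]big_ltn //= mul1r.
by congr (_ * _); apply: eq_big_nat => -[].
Qed.

Lemma slots_left s t x y i j : (j.-1 <= size s)%N ->
  slots (s ++ x :: t) i j = slots (s ++ y :: t) i j.
Proof.
move=> js; rewrite /slots; have [is_|si] := leqP i (size s); last first.
  have -> : (j.-1 - i = 0)%N by apply/eqP; rewrite subn_eq0 (leq_trans js) // ltnW.
  by rewrite !take0.
rewrite !drop_cat; case: ltngtP is_ => // [is_|->] _.
  by rewrite !takel_cat // size_drop leq_sub2r.
have -> : (j.-1 - size s = 0)%N by apply/eqP; rewrite subn_eq0.
by rewrite !take0.
Qed.

Lemma slots_right s t x y i j : (size s < i)%N ->
  slots (s ++ x :: t) i j = slots (s ++ y :: t) i j.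
Proof.
move=> si; rewrite /slots !drop_cat ltnNge (ltnW si) /=.
by rewrite -(ltn_predK si) subSn //= -ltnS (ltn_predK si).
Qed.

Lemma slots_mid s t i j : (i <= size s)%N -> (size s < j.-1)%N ->
  exists s' t', forall x, slots (s ++ x :: t) i j = s' ++ x :: t'.
Proof.
move=> is_ sj; exists (drop i s), (take (j.-1 - i - (size s - i)).-1 t) => x.
have dE : drop i (s ++ x :: t) = drop i s ++ x :: t.
  rewrite drop_cat; case: ltngtP is_ => // -> _.
  by rewrite subnn drop0 drop_size.
rewrite /slots dE take_cat size_drop ltnNge leq_sub2r ?(ltnW sj) //=.
have : (0 < j.-1 - i - (size s - i))%N by rewrite subn_gt0 ltn_sub2r // (leq_ltn_trans is_).
by case: (j.-1 - i - (size s - i))%N.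
Qed.

Lemma locate (g : nat -> nat) v k : (g 0 <= v)%N -> (v < g k)%N ->
  exists2 j, (j < k)%N & (g j <= v < g j.+1)%N.
Proof.
move=> g0; elim: k => [|k IH] vk; first by rewrite ltnNge g0 in vk.
have [kv|/IH[j jk]] := leqP (g k) v; first by exists k; rewrite ?kv.
by exists j; rewrite // ltnW.
Qed.

Lemma interval_term_linear F s t c a b q :
  multilinear F -> is_cuts (size s + size t).+2 q ->
  interval_term F (s ++ (c *: a + b) :: t) q =
  c *: interval_term F (s ++ a :: t) q + interval_term F (s ++ b :: t) q.
Proof.
move=> FL qc; have [q1 q0 qn _] := qc.
have [j jq /andP[lej ltj]] : exists2 j, (j < (size q).-1)%N &
    (nth 0%N q j <= (size s).+1 < nth 0%N q j.+1)%N.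
  by apply: locate; rewrite ?q0 // qn !ltnS leq_addr.
have jq' : (j.+1 < size q)%N by rewrite -ltn_predRL.
pose f x i := sep (s ++ x :: t) q i *
  F (slots (s ++ x :: t) (nth 0%N q i) (nth 0%N q i.+1)).
have tE x : interval_term F (s ++ x :: t) q =
    (\prod_(0 <= i < j) f x i) * f x j * \prod_(j.+1 <= i < (size q).-1) f x i.
  rewrite interval_termE // (@big_cat_nat _ _ _ j) //=; last exact: ltnW.
  by rewrite [X in _ * X]big_ltn // mulrA.
have sepE x y i : (i < size q)%N -> nth 0%N q i != (size s).+1 ->
    sep (s ++ x :: t) q i = sep (s ++ y :: t) q i.
  case: i => //= i iq ne; rewrite !nth_cat; case: ltngtP => // lt; last first.
    have := is_cuts_lt qc (ltn0Sn i) iq; rewrite q0.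
    by case: (nth 0%N q i.+1) ne lt => //= m; rewrite eqSS => /eqP.
  by case: (_ - _)%N (subn_gt0 (size s) (nth 0%N q i.+1).-1) => //; rewrite lt.
have fL x y i : (i < j)%N -> f x i = f y i.
  move=> ij; have lt : (nth 0%N q i.+1 <= (size s).+1)%N.
    by apply: leq_trans lej; apply: (is_cuts_le qc) => //; apply: ltnW.
  have iq : (i.+1 < size q)%N by apply: leq_ltn_trans (ltnW jq').
  rewrite /f (@sepE x y) ?(@slots_left _ _ x y) ?(ltnW iq) //.
    by case: (nth 0%N q i.+1) lt.
  have h := leq_trans (is_cuts_lt qc (ltnSn i) iq) lt.
  by apply: contraTneq h => ->; rewrite ltnn.
have fR x y i : (j < i < (size q).-1)%N -> f x i = f y i.
  case/andP=> ji iq; have lt : ((size s).+1 < nth 0%N q i)%N.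
    apply: leq_trans ltj _; apply: (is_cuts_le qc) => //.
    by rewrite (leq_trans iq) // leq_pred.
  have iq' : (i < size q)%N by rewrite (leq_trans iq) // leq_pred.
  have ne : nth 0%N q i != (size s).+1 by rewrite neq_ltn lt orbT.
  by rewrite /f (@sepE x y) // (@slots_right _ _ x y) // ltnW.
have fM : f (c *: a + b) j = c *: f a j + f b j.
  rewrite /f; move: lej; rewrite leq_eqVlt => /orP[/eqP qj|lej].
    rewrite !(@slots_right _ _ _ 0 (nth 0%N q j)) ?qj //.
    case: j jq jq' ltj qj {tE fL fR} => [|j] jq jq' ltj qj; first by rewrite q0 in qj.
    by rewrite /sep qj /= !nth_cat ltnn subnn /= mulrDl scalerAl.
  have [|s' [t' E]] := @slots_mid s t (nth 0%N q j) (nth 0%N q j.+1) lej.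
    by rewrite ltn_predRL.
  have ne : nth 0%N q j != (size s).+1 by rewrite neq_ltn lej.
  by rewrite !E FL mulrDr scalerAr !(@sepE _ 0 _ (ltnW jq') ne).
rewrite !tE fM mulrDr mulrDl -scalerAr -scalerAl.
have PL x y : \prod_(0 <= i < j) f x i = \prod_(0 <= i < j) f y i.
  by apply: eq_big_nat => i /andP[_]; apply: fL.
have PR x y : \prod_(j.+1 <= i < (size q).-1) f x i =
              \prod_(j.+1 <= i < (size q).-1) f y i.
  by apply: eq_big_nat => i; apply: fR.
by rewrite (PL _ a) (PR _ a) (PL b a) (PR b a).
Qed.

Lemma interval_sum_multilinear F : multilinear F -> multilinear (interval_sum F).
Proof.
move=> FL s t c a b; rewrite /interval_sum !size_cat /= addnS.
rewrite scaler_sumr -big_split; apply: eq_big_nat => k /andP[k0 _] /=.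
rewrite scaler_sumr -big_split; apply: eq_bigr => q /(cutsP k0) qc.
exact: interval_term_linear.
Qed.

(* The terms with at least two blocks. *)
Definition interval_rest F bs : B :=
  let n := (size bs).+1 in
  \sum_(2 <= k < n.+1) \sum_(q : k.+1.-tuple 'I_n.+1 | cuts q)
    interval_term F bs (map val q).

Lemma interval_sumE F bs : interval_sum F bs = F bs + interval_rest F bs.
Proof.
rewrite /interval_sum big_ltn //; congr (_ + _).
rewrite (big_pred1 [tuple ord0; ord_max]) => [|q].
  by rewrite /interval_term /= big_geq // mulr1 /slots /= subn0 drop0 take_size.
apply/idP/eqP => [/and3P[/eqP q0 /eqP q1 _]|->]; last first.
  by apply/and3P; split; rewrite ?(tnth_nth ord0).
apply: eq_from_tnth => -[[|[|//]] i]; apply: val_inj.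
  by rewrite (_ : Ordinal i = ord0) ?q0 //; apply: val_inj.
by rewrite (_ : Ordinal i = ord_max) ?q1 //; apply: val_inj.
Qed.

Lemma interval_rest_ext F G bs :
  (forall l, (size l < size bs)%N -> F l = G l) ->
  interval_rest F bs = interval_rest G bs.
Proof.
move=> FG; apply: eq_big_nat => k /andP[k1 _]; apply: eq_bigr => q.
move/(cutsP (ltnW k1)) => qc; apply: interval_term_ext => //.
by rewrite size_map size_tuple.
Qed.

Lemma interval_rest_linear F s t c a b :
  (forall s' t' c' a' b', (size s' + size t' < size s + size t)%N ->
     F (s' ++ (c' *: a' + b') :: t') =
     c' *: F (s' ++ a' :: t') + F (s' ++ b' :: t')) ->
  interval_rest F (s ++ (c *: a + b) :: t) =
  c *: interval_rest F (s ++ a :: t) + interval_rest F (s ++ b :: t).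
Proof.
move=> FL; pose N := (size s + size t).+1.
pose F' l := if (size l < N)%N then F l else 0.
have F'L : multilinear F'.
  move=> s' t' c' a' b'; rewrite /F' !size_cat /= addnS ltnS.
  by case: ltnP => [/FL //|]; rewrite scaler0 addr0.
have E x : interval_rest F (s ++ x :: t) = interval_rest F' (s ++ x :: t).
  apply: interval_rest_ext => l; rewrite size_cat /= addnS => ll.
  by rewrite /F' /N ll.
rewrite !E /interval_rest !size_cat /= addnS.
rewrite scaler_sumr -big_split; apply: eq_big_nat => k /andP[k0 _] /=.
rewrite scaler_sumr -big_split; apply: eq_bigr => q /(cutsP (ltnW k0)) qc.
exact: interval_term_linear.
Qed.

(* interval_sum is a bijection of Ser(B). *)
Fixpoint uninterval_rec (M : seq B -> B) (m : nat) (bs : seq B) : B :=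
  if m is m'.+1 then M bs - interval_rest (uninterval_rec M m') bs else 0.
Definition uninterval M bs := uninterval_rec M (size bs).+1 bs.

Lemma uninterval_recE M m bs : (size bs < m)%N ->
  uninterval_rec M m bs = uninterval M bs.
Proof.
have [n] := ubnP (size bs); elim: n m bs => // n IH [|m] bs //= bn bm.
rewrite /uninterval /=; congr (_ - _); apply: interval_rest_ext => l lb.
by rewrite !IH // (leq_trans lb).
Qed.

Lemma uninterval_eq M bs : uninterval M bs = M bs - interval_rest (uninterval M) bs.
Proof.
rewrite {1}/uninterval /=; congr (_ - _); apply: interval_rest_ext => l lb.
exact: uninterval_recE.
Qed.

Lemma unintervalK M bs : interval_sum (uninterval M) bs = M bs.
Proof. by rewrite interval_sumE uninterval_eq addrNK. Qed.

Lemma uninterval_multilinear M : multilinear M -> multilinear (uninterval M).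
Proof.
move=> ML s t; have [n] := ubnP (size s + size t)%N.
elim: n s t => // n IH s t; rewrite ltnS => st c a b.
rewrite !uninterval_eq ML interval_rest_linear; last first.
  by move=> s' t' c' a' b' lt; apply: IH; apply: leq_trans st.
by rewrite scalerBr opprD addrACA.
Qed.

Lemma interval_sum_inj F G : interval_sum F =1 interval_sum G -> F =1 G.
Proof.
move=> FG bs; have [n] := ubnP (size bs); elim: n bs => // n IH bs bn.
have := FG bs; rewrite !interval_sumE (@interval_rest_ext F G) => [/addIr //|l lb].
by apply: IH; rewrite ltnS in bn; apply: leq_trans lb bn.
Qed.

End IntervalTheory.

Section MomentSeries.
Variables (R : realType) (B : starAlgType R).
Implicit Types (mu nu : distribution B) (F : series B).

Lemma ncmonom_cons (b0 b : B) bs :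
  ncmonom b0 (b :: bs) = ncC b0 * ncX B * ncmonom b bs.
Proof. by rewrite /ncmonom big_cons !mulrA. Qed.

Lemma ncmonom_rcons (b0 : B) bs e :
  ncmonom b0 (rcons bs e) =
  ncC b0 * (ncX B * \prod_(b <- bs) (ncC b * ncX B)) * ncC e.
Proof.
elim: bs b0 => [|b bs IH] b0.
  by rewrite /ncmonom big_seq1 big_nil mulr1 mulrA.
by rewrite rcons_cons ncmonom_cons IH big_cons !mulrA.
Qed.

Lemma distribution_monom mu b0 bs e :
  mu (ncmonom b0 (rcons bs e)) = b0 * moment_fun mu bs * e.
Proof. by rewrite ncmonom_rcons dist_bimod. Qed.

Lemma distribution_ext mu nu :
  moment_fun mu =1 moment_fun nu -> mu =1 nu.
Proof.
move=> E; elim/npiW=> P; rewrite npi_ncmonom !linear_sum.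
apply: eq_bigr => -[b0 bs] _ /=; case/lastP: bs => [|bs e].
  by rewrite /ncmonom big_nil mulr1 !dist_const.
by rewrite !distribution_monom E.
Qed.

Lemma moment_fun_multilinear mu : multilinear (moment_fun mu).
Proof.
move=> s t c a b; rewrite /moment_fun !big_cat /= !big_cons (linearP (@ncC R B)).
by rewrite !mulrDl !mulrDr -!scalerAl -!scalerAr linearP.
Qed.

Definition moment_series mu : series B := Series (moment_fun_multilinear mu).

(* The value on b_0 X b_1 ... X b_n of the distribution with moments M. *)
Definition moment_ext (M : seq B -> B) (l : seq B) : B :=
  if l is b0 :: b1 :: bs then b0 * M (belast b1 bs) * last b1 bs
  else head 0 l.

Lemma moment_extE M b0 bs e : moment_ext M (b0 :: rcons bs e) = b0 * M bs * e.
Proof. by case: bs => //= b bs; rewrite belast_rcons last_rcons. Qed.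

Lemma moment_ext_multilinear M : multilinear M -> multilinear (moment_ext M).
Proof.
move=> ML [|d s] t c a b; case/lastP: t => [|t e] //.
- by rewrite !cat0s !moment_extE !mulrDl -!scalerAl.
- by rewrite !cat_cons !cats1 !moment_extE mulrDr scalerAr.
- by rewrite !cat_cons -!rcons_cons -!rcons_cat !moment_extE ML mulrDr mulrDl
    -scalerAr -scalerAl.
Qed.

Section FromMoments.
Variable M : series B.
Let PhiL := moment_ext_multilinear (series_multilinear M).
Let nu_fun := nclift (moment_ext M).
HB.instance Definition _ :=
  GRing.isLinear.Build R[i] (ncpoly B) B _ nu_fun (nclift_linear PhiL).

Fact from_moments_const b : nu_fun (ncC b) = b.
Proof. by rewrite /nu_fun nclift_npi // /feval big_seq1. Qed.

Fact from_moments_bimod (b b' : B) (P : ncpoly B) :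
  nu_fun (ncC b * P * ncC b') = b * nu_fun P * b'.
Proof.
elim/npiW: P => P; rewrite npi_ncmonom mulr_sumr mulr_suml !linear_sum.
rewrite mulr_sumr mulr_suml; apply: eq_bigr => -[b0 bs] _ /=.
case/lastP: bs => [|bs e].
  rewrite /ncmonom big_nil mulr1 -!rmorphM [LHS]from_moments_const.
  by rewrite [nu_fun _]from_moments_const.
rewrite ncmonom_rcons !mulrA -rmorphM -!(mulrA _ (ncC e)) -rmorphM.
rewrite -!(mulrA _ (ncX B)) -!ncmonom_rcons /nu_fun !nclift_monom //.
by rewrite !moment_extE !mulrA.
Qed.

Definition from_moments : distribution B :=
  Distribution from_moments_bimod from_moments_const.

Lemma from_momentsE : moment_fun from_moments =1 M.
Proof.
move=> bs; rewrite -[LHS]mul1r -[LHS]mulr1 -distribution_monom /=.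
by rewrite /nu_fun nclift_monom // moment_extE mul1r mulr1.
Qed.
End FromMoments.

Lemma Btransform_exists mu : exists F : series B, is_Btransform mu F.
Proof.
have L := uninterval_multilinear (moment_fun_multilinear mu).
by exists (Series L) => bs /=; rewrite unintervalK.
Qed.

Lemma is_Btransform_unique mu F G :
  is_Btransform mu F -> is_Btransform mu G -> F =1 G.
Proof. by move=> HF HG; apply: interval_sum_inj => bs; rewrite -HF HG. Qed.

(* Well defined up to pointwise equality by is_Btransform_unique. *)
Definition Btransform mu : series B := sval (cid (Btransform_exists mu)).

Lemma BtransformP mu : is_Btransform mu (Btransform mu).
Proof. by rewrite /Btransform; case: cid. Qed.

Lemma Btransform_inj mu nu : Btransform mu =1 Btransform nu -> mu =1 nu.
Proof.
move=> E; apply: distribution_ext => bs; rewrite !BtransformP /interval_sum.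
apply: eq_bigr => k _; apply: eq_bigr => q _; rewrite /interval_term E.
by congr (_ * _); apply: eq_bigr => j _; rewrite E.
Qed.

Lemma Btransform_surj F : exists nu, Btransform nu =1 F.
Proof.
have L := interval_sum_multilinear (series_multilinear F).
exists (from_moments (Series L)).
apply: (@is_Btransform_unique (from_moments (Series L))); first exact: BtransformP.
by move=> bs; rewrite from_momentsE.
Qed.

End MomentSeries.

Section BooleanPower.
Variables (R : realType) (B : starAlgType R).

(* Well defined up to pointwise equality by Btransform_inj. *)
Definition boolean_power (mu : distribution B) (alpha : {linear B -> B}) :
    distribution B :=
  sval (cid (Btransform_surj (comp_series alpha (Btransform mu)))).

Lemma Btransform_boolean_power mu alpha :
  Btransform (boolean_power mu alpha) =1 comp_series alpha (Btransform mu).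
Proof. by rewrite /boolean_power; case: cid. Qed.

End BooleanPower.

Section PositiveDistributions.
Variables (R : realType) (B : cstarAlgType R).

Definition Sigma (mu : distribution B) :=
  forall P : ncpoly B, positive (mu (star P * P)).

(* A unital C*-algebra M containing B through iota, with a conditional
   expectation E onto B. *)
Definition Cstar_prob_space (M : cstarAlgType R)
    (iota : {lrmorphism B -> M}) (E : {linear M -> B}) :=
  [/\ injective iota,
      forall b, iota (star b) = star (iota b),
      E 1 = 1,
      forall m, positive m -> positive (E m)
    & forall b b' m, E (iota b * m * iota b') = b * E m * b'].

Definition Sigma0 (mu : distribution B) :=
  exists (M : cstarAlgType R) (iota : {lrmorphism B -> M})
    (E : {linear M -> B}) (X : M),
    [/\ Cstar_prob_space iota E, star X = X
      & forall (b0 : B) (bs : seq B),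
          mu (ncmonom b0 bs) = E (iota b0 * \prod_(b <- bs) (X * iota b))].

End PositiveDistributions.

(* Main.v *)
Require Import Defs.
From HB Require Import structures.
From mathcomp Require Import all_boot all_order all_algebra.
From mathcomp Require Import complex boolp classical_sets reals.
From mathcomp Require Import lra ring.
From Stdlib Require Ncring Ncring_tac.

(** Write nu for the Boolean power of mu by alpha.

    Positivity of nu is proved by realizing nu as the vacuum distribution of
    an operator.  Let K be the space of polynomials P with mu[P] = 0, with
    the form mu[P^* Q].  Multiplication by X on the polynomials, seen on the
    sum of B and K, is a block operator: a scalar block mu[X], the two
    off-diagonal blocks given by a = X - mu[X], and the compression T of X
    to K.  The B-transform of mu is read off the blocks:
    B_mu(b_1, ..., b_n) = mu[X b_1 T b_2 ... T b_n a]
    (Btransform_loop_moment).  Composing B_mu with alpha therefore amounts to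
    keeping T and twisting the form of K by alpha: on the sum of B and of
    formal sums of k (x) c, with k in K and c in B, take the form
    <k (x) c, k' (x) c'> = c^* alpha(mu[k^* k']) c'.  The twisted operator is
    symmetric (fock_formX), its vacuum moments are those of nu
    (boolean_power_word), and so nu[P^* P] = <P 1, P 1>.  This is a sum of
    positive elements as soon as the matrix of the mu[k_i^* k_j] is positive
    in the matrix algebra, which is the form in which complete positivity of
    alpha can be used.  Positivity of mu only says that the quadratic form of
    this matrix is positive; adding epsilon makes its Cholesky algorithm run
    (cholesky), and epsilon is then removed because the positive cone is
    closed (completely_positive_form).

    For the second half, realizability in a C*-probability space gives mu
    moments of geometric growth; the relation between moments and
    B-transform and the boundedness of alpha transport the growth to nu
    (boolean_power_growth).  Conversely, a positive distribution with growing
    moments of this kind is realized by the GNS construction: multiplication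
    by X is bounded for the seminorm |nu[Q^* Q]|^(1/2), because
    |X^k Q|^2 is log-convex in k and grows geometrically (gns_bounded_X), the
    operator norm is a C*-seminorm on the polynomials, and the conditional
    expectation is the extension of nu to the completion (growth_Sigma0).

    All of this rests on the order theory of C*-algebras, developed from the
    definition of positivity as star c * c.  The elements a = star a with
    |t - a| <= t for some real t visibly form a closed convex cone (nonneg);
    positiveP identifies them with the elements star c * c. *)

Set Implicit Arguments.
Unset Strict Implicit.
Unset Printing Implicit Defensive.

Import Order.TTheory GRing.Theory Num.Theory.

Local Open Scope ring_scope.
Local Open Scope complex_scope.
Local Open Scope quotient_scope.

(** * Identities in noncommutative rings *)

#[global] Instance ncring_ops (A : pzRingType) :
  @Ncring.Ring_ops A 0 1 +%R *%R (fun x y => x - y) (@GRing.opp A) eq := {}.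

#[global] Instance ncring_ring (A : pzRingType) :
  Ncring.Ring (Ro := ncring_ops A).
Proof.
constructor; try exact _.
all: try by move=> ? ? -> ? ? ->.
all: try by move=> ? ? ->.
- exact: (@add0r A).
- exact: (@addrC A).
- exact: (@addrA A).
- exact: (@mul1r A).
- exact: (@mulr1 A).
- exact: (@mulrA A).
- exact: (@mulrDl A).
- exact: (fun x y z => @mulrDr A z x y).
- by [].
- exact: (@subrr A).
Defined.

(* The carriers of the various structures are matched with the carrier of a
   pzRingType by canonical structure unification, which instance resolution
   would not attempt. *)
#[global] Hint Extern 0 (Ncring.Ring) => refine (@ncring_ring _) : typeclass_instances.

Ltac ncring := intros; Ncring_tac.non_commutative_ring.

(** * Limits of real sequences *)

Section RealSequences.
Variable R : realType.
Implicit Types (f g s : nat -> R) (e l : R).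

Definition vanishes f :=
  forall e, 0 < e -> exists N, forall n, (N <= n)%N -> `|f n| < e.

Lemma vanishes_le f g : vanishes g -> (forall n, `|f n| <= g n) -> vanishes f.
Proof.
move=> g0 fg e /g0[N gN]; exists N => n /gN; apply: le_lt_trans.
by rewrite (le_trans (fg n)) // ler_norm.
Qed.

Lemma vanishes_ext f g : vanishes g -> (forall n, f n = g n) -> vanishes f.
Proof. by move=> g0 fg e /g0[N gN]; exists N => n; rewrite fg; apply: gN. Qed.

Lemma vanishes0 : vanishes (fun=> 0).
Proof. by move=> e e0; exists 0%N => n _; rewrite normr0. Qed.

Lemma vanishesD f g : vanishes f -> vanishes g -> vanishes (fun n => f n + g n).
Proof.
move=> f0 g0 e e0; have e2 : 0 < e / 2 by rewrite divr_gt0.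
have [N fN] := f0 _ e2; have [M gM] := g0 _ e2.
exists (maxn N M) => n; rewrite geq_max => /andP[/fN fn /gM gn].
by rewrite (le_lt_trans (ler_normD _ _)) // [e]splitr ltrD.
Qed.

Lemma vanishesMl c f : vanishes f -> vanishes (fun n => c * f n).
Proof.
move=> f0 e e0; have c0 : 0 < `|c| + 1 by rewrite ltr_wpDl.
have [|N fN] := f0 (e / (`|c| + 1)); first by rewrite divr_gt0.
exists N => n /fN; rewrite normrM ltr_pdivlMr // => h; apply: le_lt_trans h.
by rewrite mulrC ler_wpM2l // lerDl.
Qed.

Lemma vanishesM f g : vanishes f -> vanishes g -> vanishes (fun n => f n * g n).
Proof.
move=> f0 g0 e e0; have [N fN] := f0 _ e0; have [M gM] := g0 _ (@ltr01 R).
exists (maxn N M) => n; rewrite geq_max => /andP[/fN fn /gM gn].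
by rewrite normrM -[e]mulr1 ltr_pM.
Qed.

Lemma vanishes_le_lim f (a b : R) :
  vanishes f -> (forall n, a <= b + f n) -> a <= b.
Proof.
move=> f0 ab; apply/ler_addgt0Pr => e /f0[N fN].
rewrite (le_trans (ab N)) // lerD2l (le_trans (ler_norm _)) // ltW //.
exact: fN.
Qed.

Definition real_cauchy f := forall e, 0 < e ->
  exists N, forall m n, (N <= m)%N -> (N <= n)%N -> `|f m - f n| < e.

(** The limit is the supremum of the eventual lower bounds of the sequence. *)
Lemma real_cauchy_converges f :
  real_cauchy f -> exists l, vanishes (fun n => f n - l).
Proof.
move=> fC; pose S := [set t : R | exists N, forall n, (N <= n)%N -> t <= f n]%classic.
have inS e N : (forall m n, (N <= m)%N -> (N <= n)%N -> `|f m - f n| < e) ->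
    S (f N - e) /\ ubound S (f N + e).
  move=> fN; split.
    exists N => n Nn; have := fN n N Nn (leqnn N).
    by rewrite ltr_norml => /andP[/ltW h _]; rewrite lerBlDl addrC -lerBlDl -opprB lerNl.
  move=> t [M tM]; apply: le_trans (tM (maxn N M) (leq_maxr _ _)) _.
  have := fN (maxn N M) N (leq_maxl _ _) (leqnn N).
  by rewrite ltr_norml => /andP[_ /ltW]; rewrite lerBlDl.
have hS : has_sup S.
  have [N /inS[h1 h2]] := fC _ (@ltr01 R); split; first by exists (f N - 1).
  by exists (f N + 1).
exists (sup S) => e e0; have e2 : 0 < e / 2 by rewrite divr_gt0.
have [N fN] := fC _ e2; have [h1 h2] := inS _ _ fN.
have l1 : f N - e / 2 <= sup S by apply: ub_le_sup => //; case: hS.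
have l2 : sup S <= f N + e / 2 by apply: ge_sup => //; case: hS.
exists N => n Nn; have := fN n N Nn (leqnn N).
rewrite !ltr_norml => /andP[h3 h4]; apply/andP; split; lra.
Qed.

Lemma nondecreasing_bounded_cauchy s (b : R) :
  (forall n, s n <= s n.+1) -> (forall n, s n <= b) -> real_cauchy s.
Proof.
move=> sS sb; have smon : {homo s : m n / (m <= n)%N >-> m <= n}.
  by apply: homo_leq => //; apply: le_trans.
pose S := [set s n | n in setT]%classic.
have hS : has_sup S by split; [exists (s 0%N), 0%N|exists b => _ [n _ <-]].
move=> e e0; have [_ [N _ <-] sN] := sup_adherent e0 hS.
have ub n : s n <= sup S by apply: ub_le_sup; [case: hS|exists n].
exists N => m n /smon Nm /smon Nn; have := ub m; have := ub n.
by rewrite ltr_norml => um un; apply/andP; split; lra.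
Qed.

End RealSequences.

(** * C*-seminorms *)

Section Seminorms.
Variables (R : realType) (A : starAlgType R).

(** The norm of a C*-algebra is one example; the other one is the operator
    seminorm of the GNS construction, whose completion has to be taken. *)
Record cstar_seminorm := CstarSeminorm {
  snorm :> A -> R;
  snormD : forall a b, snorm (a + b) <= snorm a + snorm b;
  snormZ : forall (c : R[i]) a, (snorm (c *: a))%:C = `|c| * (snorm a)%:C;
  snormM : forall a b, snorm (a * b) <= snorm a * snorm b;
  snorm_starM : forall a, snorm (star a * a) = snorm a ^+ 2;
  snorm1_neq0 : snorm 1 != 0
}.

Variable p : cstar_seminorm.
Implicit Types (a b : A) (u v : nat -> A).

Lemma snormZr (r : R) a : p (r%:C *: a) = `|r| * p a.
Proof. by apply: complexI; rewrite snormZ normc_def /= expr0n addr0 sqrtr_sqr rmorphM. Qed.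

(** The modulus of c as an element of R; the norm of R[i] has values in R[i]. *)
Definition cmod (c : R[i]) : R :=
  Num.sqrt (complex.Re c ^+ 2 + complex.Im c ^+ 2).

Lemma cmod_ge0 c : 0 <= cmod c.
Proof. exact: sqrtr_ge0. Qed.

Lemma snorm_scale c a : p (c *: a) = cmod c * p a.
Proof. by apply: complexI; rewrite snormZ normc_def rmorphM. Qed.

Lemma snorm0 : p 0 = 0.
Proof. by rewrite -(scale0r 0) -[0 in X in p X]/(0%:C) snormZr normr0 mul0r. Qed.

Lemma snormN a : p (- a) = p a.
Proof.
rewrite -scaleN1r (_ : -1 = (-1)%:C) ?snormZr ?normrN1 ?mul1r //.
by rewrite rmorphN rmorph1.
Qed.

Lemma snorm_ge0 a : 0 <= p a.
Proof. by have := snormD p a (- a); rewrite subrr snorm0 snormN; lra. Qed.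

Lemma snormB a b : p (a - b) <= p a + p b.
Proof. by rewrite (le_trans (snormD _ _ _)) // snormN. Qed.

Lemma snorm_dist a b : `|p a - p b| <= p (a - b).
Proof.
have h (x y : A) : p x <= p y + p (x - y).
  by rewrite (le_trans _ (snormD _ _ _)) // addrC subrK.
have h1 := h a b; have h2 := h b a; rewrite -(snormN (b - a)) opprB in h2.
by rewrite ler_norml; apply/andP; split; lra.
Qed.

(** |a|^2 = |a^* a| <= |a^*| |a|, and symmetrically. *)
Lemma snorm_star a : p (star a) = p a.
Proof.
have h x : p x <= p (star x).
  have [->|x0] := eqVneq (p x) 0; first exact: snorm_ge0.
  have px : 0 < p x by rewrite lt_def x0 snorm_ge0.
  by rewrite -(ler_pM2r px) -expr2 -snorm_starM snormM.
by apply/eqP; rewrite eq_le h -{2}(starK a) h.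
Qed.

Lemma snorm1 : p 1 = 1.
Proof.
have := snorm_starM p 1; rewrite star1 mulr1 expr2 => /eqP.
by rewrite -subr_eq0 -{1}(mulr1 (p 1)) -mulrBr mulf_eq0 (negPf (snorm1_neq0 p)) /= subr_eq0 => /eqP.
Qed.

Definition sconv u l := vanishes (fun n => p (u n - l)).

Definition scauchy u := forall e : R, 0 < e ->
  exists N, forall m n, (N <= m)%N -> (N <= n)%N -> p (u m - u n) < e.

Lemma sconv_cst a : sconv (fun=> a) a.
Proof. by move=> e e0; exists 0%N => n _; rewrite subrr snorm0 normr0. Qed.

Lemma sconvD u v a b : sconv u a -> sconv v b -> sconv (fun n => u n + v n) (a + b).
Proof.
move=> ua vb; apply: vanishes_le (vanishesD ua vb) _ => n.
by rewrite ger0_norm ?snorm_ge0 // opprD addrACA snormD.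
Qed.

Lemma sconvZ c u a : sconv u a -> sconv (fun n => c *: u n) (c *: a).
Proof.
move=> ua; apply: vanishes_le (vanishesMl (cmod c) ua) _ => n.
by rewrite ger0_norm ?snorm_ge0 // -scalerBr snorm_scale.
Qed.

(** The bound by null sequences comes from
    uv - ab = (u - a)(v - b) + (u - a)b + a(v - b), which spares the
    boundedness of u. *)
Lemma sconvM u v a b : sconv u a -> sconv v b -> sconv (fun n => u n * v n) (a * b).
Proof.
move=> ua vb.
apply: vanishes_le (vanishesD (vanishesD (vanishesM ua vb) (vanishesMl (p b) ua))
  (vanishesMl (p a) vb)) _ => n.
rewrite ger0_norm ?snorm_ge0 //.
have -> : u n * v n - a * b =
    (u n - a) * (v n - b) + (u n - a) * b + a * (v n - b) by ncring.
rewrite (le_trans (snormD _ _ _)) // lerD ?snormM //.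
by rewrite (le_trans (snormD _ _ _)) // lerD ?snormM // mulrC snormM.
Qed.

Lemma sconv_star u a : sconv u a -> sconv (fun n => star (u n)) (star a).
Proof.
move=> ua; apply: vanishes_le ua _ => n.
by rewrite -starN -starD snorm_star ger0_norm ?snorm_ge0.
Qed.

Lemma sconv_shift u a : sconv u a -> sconv (fun n => u n.+1) a.
Proof. by move=> ua e /ua[N uN]; exists N => n Nn; apply/uN/leqW. Qed.

Lemma sconv_unique u a b : sconv u a -> sconv u b -> p (a - b) = 0.
Proof.
move=> ua ub; apply/eqP; rewrite eq_le snorm_ge0 andbT.
apply: (vanishes_le_lim (vanishesD ua ub)) => n; rewrite add0r.
by rewrite -(snormN (u n - a)) opprB (le_trans _ (snormD _ _ _)) // addrA subrK.
Qed.

Lemma sconv_cauchy u a : sconv u a -> scauchy u.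
Proof.
move=> ua e e0; have e2 : 0 < e / 2 by rewrite divr_gt0.
have [N uN] := ua _ e2; exists N => m n /uN um /uN un.
have -> : u m - u n = (u m - a) - (u n - a) by ncring.
rewrite ger0_norm ?snorm_ge0 // in um; rewrite ger0_norm ?snorm_ge0 // in un.
by rewrite (le_lt_trans (snormB _ _)) // [e]splitr ltrD.
Qed.

(** Both fixed-point iterations below, for square roots and for inverses, are
    dominated term by term by the same iteration on a bounded real sequence. *)
Lemma majorized_cauchy u (s : nat -> R) (b : R) :
  (forall n, p (u n.+1 - u n) <= s n.+1 - s n) -> (forall n, s n <= b) ->
  scauchy u.
Proof.
move=> us sb; have sS n : s n <= s n.+1.
  by rewrite -subr_ge0 (le_trans _ (us n)) ?snorm_ge0.
have le m n : (m <= n)%N -> p (u n - u m) <= s n - s m.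
  elim: n => [|n IH]; first by rewrite leqn0 => /eqP ->; rewrite !subrr snorm0.
  rewrite leq_eqVlt => /orP[/eqP <-|/IH h]; first by rewrite !subrr snorm0.
  have -> : u n.+1 - u m = (u n.+1 - u n) + (u n - u m) by ncring.
  rewrite (le_trans (snormD _ _ _)) // (le_trans (lerD (us n) h)) //.
  by rewrite addrA subrK.
move=> e /(nondecreasing_bounded_cauchy sS sb)[N sN]; exists N => m n Nm Nn.
have [mn|/ltnW nm] := leqP m n.
  rewrite -snormN opprB (le_lt_trans (le _ _ mn)) // (le_lt_trans _ (sN n m _ _)) //.
  exact: ler_norm.
rewrite (le_lt_trans (le _ _ nm)) // (le_lt_trans _ (sN m n _ _)) //.
exact: ler_norm.
Qed.

Lemma snorm_sum_le (I : Type) (r : seq I) (F : I -> A) (g : I -> R) :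
  (forall i, p (F i) <= g i) -> p (\sum_(i <- r) F i) <= \sum_(i <- r) g i.
Proof.
move=> Fg; elim: r => [|i r IH]; first by rewrite !big_nil snorm0.
by rewrite !big_cons (le_trans (snormD _ _ _)) // lerD.
Qed.

End Seminorms.

#[global] Arguments snorm : simpl never.

(** * Real and imaginary parts *)

Section RealScalars.
Variables (R : realType) (A : starAlgType R).
Implicit Types (a b : A) (r s t : R).

Local Notation im := (Complex (0 : R) (1 : R)).

Lemma rscaleA r s a : r%:C *: (s%:C *: a) = (r * s)%:C *: a.
Proof. by rewrite scalerA rmorphM. Qed.

Lemma rscale1 a : 1%:C *: a = a.
Proof. by rewrite rmorph1 scale1r. Qed.

Lemma rscale0 a : 0%:C *: a = 0.
Proof. by rewrite rmorph0 scale0r. Qed.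

Lemma rscaleDl r s a : (r + s)%:C *: a = r%:C *: a + s%:C *: a.
Proof. by rewrite rmorphD scalerDl. Qed.

Lemma rscaleBl r s a : (r - s)%:C *: a = r%:C *: a - s%:C *: a.
Proof. by rewrite rmorphB scalerBl. Qed.

Lemma rscaleK r a : r != 0 -> r^-1%:C *: (r%:C *: a) = a.
Proof. by move=> r0; rewrite rscaleA mulVf // rscale1. Qed.

Lemma rscaleVK r a : r != 0 -> r%:C *: (r^-1%:C *: a) = a.
Proof. by move=> r0; rewrite rscaleA mulfV // rscale1. Qed.

Lemma rscale2 a : 2%:C *: a = a + a.
Proof. by rewrite (_ : 2 = 1 + 1) // rscaleDl rscale1. Qed.

Lemma starZc (c : R[i]) a : star (c *: a) = conjc c *: star a.
Proof. exact: starZ. Qed.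

Lemma star_rscale r a : star (r%:C *: a) = r%:C *: star a.
Proof. by rewrite starZc; rewrite conjc_real. Qed.

Lemma starB a b : star (a - b) = star a - star b.
Proof. by rewrite starD starN. Qed.

Lemma star_sum (I : Type) (s : seq I) (F : I -> A) :
  star (\sum_(i <- s) F i) = \sum_(i <- s) star (F i).
Proof. by apply: (big_morph star (@starD R A)); apply: star0. Qed.

Lemma sa_starM a : star (star a * a) = star a * a.
Proof. by rewrite starM starK. Qed.

Definition re_part a := 2^-1%:C *: (a + star a).
Definition im_part a := (- im) *: (2^-1%:C *: (a - star a)).

Lemma star_re_part a : star (re_part a) = re_part a.
Proof. by rewrite star_rscale starD starK addrC. Qed.

Lemma conjN_i : conjc (- im) = im :> R[i].
Proof. by apply/eqP; rewrite eq_complex /= !oppr0 opprK !eqxx. Qed.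

Lemma mul_ii : im * im = -1 :> R[i].
Proof. by rewrite -expr2; exact: sqr_i. Qed.

Lemma star_im_part a : star (im_part a) = im_part a.
Proof.
by rewrite starZc conjN_i star_rscale starB starK -[star a - a]opprB !scalerN -scaleNr.
Qed.

Lemma re_im_part a : a = re_part a + im *: im_part a.
Proof.
rewrite /im_part scalerA mulrN mul_ii opprK scale1r -scalerDr.
have -> : a + star a + (a - star a) = a + a by ncring.
by rewrite -rscale2 rscaleK // pnatr_eq0.
Qed.

(** If one of the two products is a negative element, this identity makes the
    other one positive. *)
Lemma starM_starM a :
  star a * a + a * star a =
  2%:C *: (re_part a * re_part a + im_part a * im_part a).
Proof.
have hr := star_re_part a; have hi := star_im_part a.
move: (re_part a) (im_part a) (re_im_part a) hr hi => x y -> hr hi.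
rewrite !starD !starZc hr hi rscale2.
rewrite (_ : conjc im = - im :> R[i]); last first.
  by apply/eqP; rewrite eq_complex /= oppr0 !eqxx.
rewrite scaleNr; set z := im *: y.
have zz : z * z = - (y * y).
  by rewrite /z -scalerAl -scalerAr scalerA mul_ii scaleN1r.
have -> : (x - z) * (x + z) + (x + z) * (x - z) = (x * x - z * z) + (x * x - z * z) by ncring.
by rewrite zz; ncring.
Qed.

End RealScalars.

(** * The positive cone of a C*-algebra *)

Section CStarAlgebras.
Variables (R : realType) (A : cstarAlgType R).
Implicit Types (a b x y z : A) (r s t : R).

Fact cnorm1_neq0 : cnorm (1 : A) != 0.
Proof. by apply/eqP => /cnorm0_eq0/eqP; rewrite oner_eq0. Qed.

Definition cnorm_seminorm : cstar_seminorm A :=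
  CstarSeminorm (@cnormD R A) (@cnormZ R A) (@cnormM R A) (@cnorm_star R A)
    cnorm1_neq0.

Local Notation p := cnorm_seminorm.
Local Notation im := (Complex (0 : R) (1 : R)).

Lemma snorm_eq0 a : p a = 0 -> a = 0.
Proof. exact: cnorm0_eq0. Qed.

Lemma sconv_eq (u : nat -> A) a b : sconv p u a -> sconv p u b -> a = b.
Proof. by move=> ua ub; apply/subr0_eq/snorm_eq0/(sconv_unique ua ub). Qed.

Lemma scauchy_converges (u : nat -> A) : scauchy p u -> exists l, sconv p u l.
Proof.
move=> /(@cnorm_complete R A)[l ul]; exists l => e /ul[N uN]; exists N => n /uN.
by rewrite ger0_norm ?snorm_ge0.
Qed.

Lemma snorm_sa_sqr a : star a = a -> p (a * a) = p a ^+ 2.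
Proof. by move=> sa; rewrite -{1}sa snorm_starM. Qed.

Lemma sa_sqr_eq0 a : star a = a -> a * a = 0 -> a = 0.
Proof.
move=> /snorm_sa_sqr sa a0; apply: snorm_eq0; apply/eqP.
by rewrite -sqrf_eq0 -sa a0 snorm0.
Qed.

Lemma starM_eq0 a : star a * a = 0 -> a = 0.
Proof.
move=> a0; apply: snorm_eq0; apply/eqP.
by rewrite -sqrf_eq0 -snorm_starM a0 snorm0.
Qed.

Section SquareRoot.
Variable x : A.
Hypotheses (sx : star x = x) (px : p x <= 1).

(** The iteration y |-> (x + y^2) / 2, whose limit satisfies
    (1 - y)^2 = 1 - x.  Its terms are polynomials in x with nonnegative
    coefficients, so their norms are bounded by the values of the same
    iteration with the real number 1 in place of x. *)
Fixpoint sqrt_iter n : A :=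
  if n is n'.+1 then 2^-1%:C *: (x + sqrt_iter n' * sqrt_iter n') else 0.
Fixpoint sqrt_bound n : R :=
  if n is n'.+1 then 2^-1 * (1 + sqrt_bound n' ^+ 2) else 0.

Lemma sqrt_boundP n : 0 <= sqrt_bound n <= 1.
Proof. by elim: n => [|n /andP[h1 h2]] /=; rewrite ?ler01 ?lexx //; apply/andP; split; nra. Qed.

Lemma sqrt_iter_le n : p (sqrt_iter n) <= sqrt_bound n.
Proof.
elim: n => [|n IH] /=; first by rewrite snorm0.
rewrite snormZr ger0_norm ?invr_ge0 ?ler0n // ler_wpM2l ?invr_ge0 ?ler0n //.
rewrite (le_trans (snormD _ _ _)) // lerD // (le_trans (snormM _ _ _)) // expr2.
by rewrite ler_pM ?snorm_ge0.
Qed.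

Lemma sqrt_iter_comm z : x * z = z * x -> forall n, sqrt_iter n * z = z * sqrt_iter n.
Proof.
move=> xz; elim=> [|n IH] /=; first by rewrite mul0r mulr0.
rewrite -scalerAl -scalerAr mulrDl mulrDr xz; congr (_ *: (_ + _)).
by rewrite -mulrA IH mulrA IH mulrA.
Qed.

Lemma star_sqrt_iter n : star (sqrt_iter n) = sqrt_iter n.
Proof. by elim: n => [|n IH] /=; rewrite ?star0 // star_rscale starD starM sx IH. Qed.

Lemma sqrt_iter_step n :
  p (sqrt_iter n.+1 - sqrt_iter n) <= sqrt_bound n.+1 - sqrt_bound n.
Proof.
elim: n => [|n IH].
  rewrite /= mul0r addr0 expr0n addr0 !subr0 mulr1 snormZr ger0_norm ?invr_ge0 ?ler0n //.
  by rewrite -[leRHS]mulr1 ler_wpM2l ?invr_ge0 ?ler0n.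
have cm : sqrt_iter n.+1 * sqrt_iter n = sqrt_iter n * sqrt_iter n.+1.
  by apply: sqrt_iter_comm; rewrite (sqrt_iter_comm erefl).
have hn := sqrt_iter_le n; have hS := sqrt_iter_le n.+1.
have -> : sqrt_iter n.+2 - sqrt_iter n.+1 = 2^-1%:C *:
    ((sqrt_iter n.+1 - sqrt_iter n) * (sqrt_iter n.+1 + sqrt_iter n)).
  rewrite [sqrt_iter n.+2]/= -/(sqrt_iter n.+1) [X in _ - X]/= -scalerBr.
  congr (_ *: _); rewrite mulrBl !mulrDr cm; ncring.
have -> : sqrt_bound n.+2 - sqrt_bound n.+1 = 2^-1 *
    ((sqrt_bound n.+1 - sqrt_bound n) * (sqrt_bound n.+1 + sqrt_bound n)).
  rewrite [sqrt_bound n.+2]/= -/(sqrt_bound n.+1) [X in _ - X]/=.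
  by move: (sqrt_bound n.+1) => b; ring.
rewrite snormZr ger0_norm ?invr_ge0 ?ler0n // ler_wpM2l ?invr_ge0 ?ler0n //.
rewrite (le_trans (snormM _ _ _)) // ler_pM ?snorm_ge0 //.
by rewrite (le_trans (snormD _ _ _)) // lerD.
Qed.

Lemma sqrt_one_minus : exists r : A, [/\ star r = r, r * r = 1 - x, p (1 - r) <= 1 &
  forall z, x * z = z * x -> r * z = z * r].
Proof.
have [y iy] : exists y, sconv p sqrt_iter y.
  apply: scauchy_converges; apply: (majorized_cauchy sqrt_iter_step (b := 1)) => n.
  by case/andP: (sqrt_boundP n).
have sy : star y = y.
  apply: sconv_eq (sconv_star iy) _; apply: vanishes_le iy _ => n.
  by rewrite star_sqrt_iter ger0_norm ?snorm_ge0.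
have ey : y = 2^-1%:C *: (x + y * y).
  apply: sconv_eq (sconv_shift iy) _ => /=.
  by apply/sconvZ/sconvD; [exact: sconv_cst|exact: sconvM].
exists (1 - y); split.
- by rewrite starB star1 sy.
- have -> : (1 - y) * (1 - y) = 1 - (y + y) + y * y by ncring.
  rewrite -rscale2 {1}ey rscaleVK ?pnatr_eq0 //; ncring.
- rewrite opprB addrC subrK.
  apply: (vanishes_le_lim (f := fun n => p (sqrt_iter n - y)) iy) => n.
  rewrite (_ : y = sqrt_iter n - (sqrt_iter n - y)); last by ncring.
  rewrite (le_trans (snormB _ _ _)) // lerD //.
    by rewrite (le_trans (sqrt_iter_le n)) //; case/andP: (sqrt_boundP n).
  by rewrite (_ : sqrt_iter n - (sqrt_iter n - (sqrt_iter n - y)) = sqrt_iter n - y) //; ncring.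
move=> z xz; rewrite mulrBl mulrBr mul1r mulr1; congr (_ - _).
apply: (sconv_eq (u := fun n => sqrt_iter n * z)).
  by apply: sconvM => //; apply: sconv_cst.
apply: vanishes_le (sconvM (sconv_cst p z) iy) _ => n.
by rewrite (sqrt_iter_comm xz) ger0_norm ?snorm_ge0.
Qed.

End SquareRoot.

(** For a self-adjoint a, |t - a| <= t says that the spectrum of a lies in
    [0, 2t].  Stated with the norm alone, the condition is visibly stable
    under sums, which is not the case of the form star c * c. *)
Definition nonneg a := star a = a /\ exists t, p (t%:C *: 1 - a) <= t.

Lemma nonnegD a b : nonneg a -> nonneg b -> nonneg (a + b).
Proof.
move=> [sa [t ta]] [sb [s sb']]; split; first by rewrite starD sa sb.
exists (t + s); rewrite rscaleDl opprD addrACA.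
by rewrite (le_trans (snormD _ _ _)) // lerD.
Qed.

Lemma nonnegZ r a : 0 <= r -> nonneg a -> nonneg (r%:C *: a).
Proof.
move=> r0 [sa [t ta]]; split; first by rewrite star_rscale sa.
exists (r * t); rewrite -rscaleA -scalerBr snormZr ger0_norm //.
by rewrite ler_wpM2l.
Qed.

Lemma nonneg_scalar r : 0 <= r -> nonneg (r%:C *: 1).
Proof.
by move=> r0; split; [rewrite star_rscale star1|exists r; rewrite subrr snorm0].
Qed.

Lemma nonneg0 : nonneg 0.
Proof. by rewrite -(rscale0 1); apply: nonneg_scalar. Qed.

Lemma nonneg_sum (I : Type) (s : seq I) (F : I -> A) :
  (forall i, nonneg (F i)) -> nonneg (\sum_(i <- s) F i).
Proof.
by move=> F0; apply: big_ind => //; [exact: nonneg0|exact: nonnegD].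
Qed.

Lemma scalar_nonneg r : nonneg (r%:C *: 1) -> 0 <= r.
Proof.
case=> _ [t]; rewrite -rscaleBl snormZr snorm1 mulr1 ler_norml => /andP[_ h].
by rewrite -subr_ge0 in h; move: h; rewrite opprB addrCA subrr addr0.
Qed.

Lemma nonneg_bounded_sa a t : star a = a -> p a <= t -> nonneg (t%:C *: 1 - a).
Proof.
move=> sa at'; split; first by rewrite starB star_rscale star1 sa.
by exists t; rewrite opprB addrC subrK.
Qed.

Lemma nonneg_sqrt a : nonneg a -> exists r : A,
  [/\ star r = r, r * r = a, nonneg r & forall z, a * z = z * a -> r * z = z * r].
Proof.
case=> sa [t ta]; have t0 : 0 <= t by rewrite (le_trans _ ta) ?snorm_ge0.
have [t0'|tn0] := eqVneq t 0.
  have /snorm_eq0 : p (t%:C *: 1 - a) = 0.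
    by apply/eqP; rewrite eq_le snorm_ge0 (le_trans ta) ?t0'.
  rewrite t0' rscale0 add0r => /eqP; rewrite oppr_eq0 => /eqP ->.
  exists 0; split; rewrite ?star0 ?mulr0 //; exact: nonneg0.
have tp : 0 < t by rewrite lt_def tn0.
pose x := 1 - t^-1%:C *: a.
have xE : x = t^-1%:C *: (t%:C *: 1 - a) by rewrite scalerBr rscaleK.
have sx : star x = x by rewrite starB star1 star_rscale sa.
have px : p x <= 1.
  by rewrite xE snormZr ger0_norm ?invr_ge0 // mulrC ler_pdivrMr // mul1r.
have [r [sr rr pr cr]] := sqrt_one_minus sx px.
exists ((Num.sqrt t)%:C *: r); split.
- by rewrite star_rscale sr.
- rewrite -scalerAl -scalerAr rscaleA -expr2 sqr_sqrtr // rr /x opprB addrC subrK.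
  by rewrite rscaleVK.
- apply: nonnegZ; first exact: sqrtr_ge0.
  by split=> //; exists 1; rewrite rscale1.
move=> z az; rewrite -scalerAl -scalerAr cr // /x mulrBl mulrBr mul1r mulr1.
by rewrite -scalerAl -scalerAr az.
Qed.

(** h + ik and h - ik are sqrt r times unitaries, and h is their mean. *)
Lemma pythagoras h k r : star h = h -> star k = k -> h * k = k * h -> 0 <= r ->
  h * h + k * k = r%:C *: 1 -> p h ^+ 2 <= r.
Proof.
move=> sh sk hk r0 E.
have i_conj : conjc im = - im :> R[i] by apply/eqP; rewrite eq_complex /= oppr0 !eqxx.
pose z := im *: k.
have zz : z * z = - (k * k) by rewrite /z -scalerAl -scalerAr scalerA mul_ii scaleN1r.
have kk : k * k = - (z * z) by rewrite zz opprK.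
have sz : star z = - z by rewrite /z starZc i_conj sk scaleNr.
have hz : h * z = z * h by rewrite /z -scalerAl -scalerAr hk.
have U w : star (h + w) * (h + w) = r%:C *: 1 -> p (h + w) = Num.sqrt r.
  move=> /(congr1 p); rewrite snorm_starM snormZr snorm1 mulr1 ger0_norm // => <-.
  by rewrite sqrtr_sqr ger0_norm ?snorm_ge0.
have u1 : p (h + z) = Num.sqrt r.
  apply: U; rewrite -E kk starD sh sz.
  have -> : (h - z) * (h + z) = h * h + h * z - z * h - z * z by ncring.
  by rewrite hz addrK.
have u2 : p (h - z) = Num.sqrt r.
  apply: U; rewrite -E kk starD starN sh sz.
  have -> : (h - - z) * (h - z) = h * h - h * z + z * h - z * z by ncring.
  by rewrite hz addrNK.
have h2 : 2 * p h <= 2 * Num.sqrt r.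
  rewrite -{1}(@ger0_norm _ (2 : R)) // -snormZr rscale2.
  have -> : h + h = (h + z) + (h - z) by ncring.
  by rewrite (le_trans (snormD _ _ _)) // u1 u2; lra.
have hs : p h <= Num.sqrt r by lra.
by rewrite -(sqr_sqrtr r0) ler_pXn2r ?nnegrE ?snorm_ge0 ?sqrtr_ge0.
Qed.

(** As |h^2| <= t, the element t - h^2 has a square root k commuting with h,
    and pythagoras bounds k. *)
Lemma sa_sqr_complement h t : star h = h -> p (h * h) <= t ->
  exists k, [/\ star k = k, h * h + k * k = t%:C *: 1, nonneg (k * k),
    p (k * k) <= t & forall z, h * z = z * h -> k * z = z * k].
Proof.
move=> sh ht; have t0 : 0 <= t by rewrite (le_trans _ ht) ?snorm_ge0.
have [k [sk kk _ ck]] : exists r : A, [/\ star r = r, r * r = t%:C *: 1 - h * h, nonneg r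
    & forall z, (t%:C *: 1 - h * h) * z = z * (t%:C *: 1 - h * h) -> r * z = z * r].
  by apply/nonneg_sqrt/nonneg_bounded_sa => //; rewrite starM sh.
have ck' z : h * z = z * h -> k * z = z * k.
  move=> hz; apply: ck; rewrite mulrBl mulrBr -scalerAl -scalerAr mul1r mulr1.
  by rewrite -mulrA hz mulrA hz mulrA.
have E : h * h + k * k = t%:C *: 1 by rewrite kk addrC subrK.
have kt : p (k * k) <= t.
  rewrite snorm_sa_sqr //; apply: (pythagoras (k := h)) => //; first exact: ck'.
  by rewrite addrC.
exists k; split=> //; split; first by rewrite starM sk.
exists t; rewrite -E addrK //.
Qed.

Lemma nonneg_sa_sqr h : star h = h -> nonneg (h * h).
Proof.
move=> sh; have [k [sk E _ kt _]] := sa_sqr_complement sh (lexx _).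
split; first by rewrite starM sh.
by exists (p (h * h)); rewrite -E addrC addKr.
Qed.

(** The condition defining nonneg, known for some t, holds for every t above
    the norm; taking t = |a| makes it a closed condition. *)
Lemma nonneg_bound a t : nonneg a -> p a <= t -> p (t%:C *: 1 - a) <= t.
Proof.
case/nonneg_sqrt=> h [sh <- _ _] ht.
by have [k [sk <- _ kt _]] := sa_sqr_complement sh ht; rewrite addrC addKr.
Qed.

(** The order controls the norm: with square roots h of a and k of t - a,
    which commute, h^2 + k^2 = t and pythagoras applies. *)
Lemma nonneg_le_norm a t : nonneg a -> nonneg (t%:C *: 1 - a) -> p a <= t.
Proof.
move=> a0 ta0; have t0 : 0 <= t.
  by apply: scalar_nonneg; rewrite -[_ *: _](subrK a); apply: nonnegD.
have [h [sh hh _ ch]] := nonneg_sqrt a0; have [k [sk kk _ ck]] := nonneg_sqrt ta0.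
rewrite -hh snorm_sa_sqr //; apply: (pythagoras (k := k)) => //.
  apply: esym; apply: ck; rewrite mulrBl mulrBr -scalerAl -scalerAr mul1r mulr1.
  by rewrite -hh mulrA.
by rewrite hh kk addrC subrK.
Qed.

Lemma nonneg_norm_mono a b : nonneg a -> nonneg (b - a) -> p a <= p b.
Proof.
move=> a0 ba; have b0 : nonneg b by rewrite -(subrK a b); apply: nonnegD.
apply: nonneg_le_norm => //.
rewrite (_ : _ - a = ((p b)%:C *: 1 - b) + (b - a)); last by ncring.
by apply: nonnegD => //; apply: nonneg_bounded_sa => //; case: b0.
Qed.

Lemma nonneg_closed (u : nat -> A) a :
  sconv p u a -> (forall n, nonneg (u n)) -> nonneg a.
Proof.
move=> ua u0; split.
  apply: sconv_eq (sconv_star ua) _; apply: vanishes_le ua _ => n.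
  by case: (u0 n) => -> _; rewrite ger0_norm ?snorm_ge0.
exists (p a).
apply: (vanishes_le_lim (f := fun n => 3 * p (u n - a))).
  exact: vanishesMl.
move=> n; have := nonneg_bound (u0 n) (lexx _); set q := p (u n) => h.
have h1 := snorm_dist p (u n) a; rewrite -/q ler_norml in h1; case/andP: h1 => h1 h2.
have -> : (p a)%:C *: 1 - a = (q%:C *: 1 - u n) + ((u n - a) - (q - p a)%:C *: 1).
  by rewrite rscaleBl; ncring.
rewrite (le_trans (snormD _ _ _)) // (le_trans (lerD h (snormB _ _ _))) //.
rewrite snormZr snorm1 mulr1; have := snorm_dist p (u n) a; rewrite -/q.
by lra.
Qed.

Lemma nonneg_add_eps a b : (forall e, 0 < e -> nonneg (a + e%:C *: b)) -> nonneg a.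
Proof.
move=> h; apply: (nonneg_closed (u := fun n => a + (n.+1%:R^-1)%:C *: b)).
  rewrite -[X in sconv _ _ X]addr0; apply: sconvD; first exact: sconv_cst.
  move=> e e0; have [N /andP[_ hN]] : exists N, true && (p b / e < N%:R).
    exists (Num.bound (p b / e)); rewrite archi_boundP //.
    by rewrite divr_ge0 ?snorm_ge0 ?ltW.
  exists N => n Nn; rewrite subr0 snormZr ger0_norm ?mulr_ge0 ?snorm_ge0 //.
  rewrite ger0_norm ?invr_ge0 // mulrC ltr_pdivrMr ?ltr0n // mulrC -ltr_pdivrMr //.
  by rewrite (lt_le_trans hN) // ler_nat (leq_trans Nn).
by move=> n; apply: h; rewrite invr_gt0 ltr0n.
Qed.

(** The partial sums of the geometric series satisfy u_(n+1) = 1 + v u_n, and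
    commute with v. *)
Lemma neumann v : p v < 1 -> exists z, (1 - v) * z = 1 /\ z * (1 - v) = 1.
Proof.
move=> v1; set q := p v in v1; have q0 : 0 <= q by exact: snorm_ge0.
pose u := fix u n : A := if n is n'.+1 then 1 + v * u n' else 0.
pose s := fix s n : R := if n is n'.+1 then 1 + q * s n' else 0.
have us n : p (u n.+1 - u n) <= s n.+1 - s n.
  elim: n => [|n IH]; first by rewrite /= !mulr0 !addr0 !subr0 snorm1.
  have -> : u n.+2 - u n.+1 = v * (u n.+1 - u n) by rewrite /=; ncring.
  have -> : s n.+2 - s n.+1 = q * (s n.+1 - s n) by rewrite /=; ring.
  by rewrite (le_trans (snormM _ _ _)) // ler_wpM2l.
have sb n : s n <= (1 - q)^-1.
  elim: n => [|n IH]; first by rewrite invr_ge0 subr_ge0 ltW.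
  rewrite /=; have q1 : 1 - q != 0 by rewrite subr_eq0 eq_sym lt_eqF.
  rewrite [leRHS](_ : _ = 1 + q * (1 - q)^-1); last by field.
  by rewrite lerD2l ler_wpM2l.
have [z uz] := scauchy_converges (majorized_cauchy us sb).
have uv n : u n * v = v * u n.
  elim: n => [|n IH] /=; first by rewrite mul0r mulr0.
  by rewrite mulrDl mulrDr mul1r mulr1 -mulrA IH.
have e1 : z = 1 + v * z.
  apply: sconv_eq (sconv_shift uz) _ => /=.
  by apply/sconvD/sconvM => //; apply: sconv_cst.
have e2 : z = 1 + z * v.
  apply: sconv_eq (sconv_shift uz) _ => /=.
  apply: vanishes_le (sconvD (sconv_cst p 1) (sconvM uz (sconv_cst p v))) _ => n.
  by rewrite -uv ger0_norm ?snorm_ge0.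
exists z; split.
  by rewrite mulrBl mul1r {1}e1 addrK.
by rewrite mulrBr mulr1 {1}e2 addrK.
Qed.

Lemma nonneg_shift_invertible a e : 0 < e -> nonneg a ->
  exists z, (e%:C *: 1 + a) * z = 1 /\ z * (e%:C *: 1 + a) = 1.
Proof.
move=> e0 [sa [t ta]]; have t0 : 0 <= t by rewrite (le_trans _ ta) ?snorm_ge0.
have te : 0 < t + e by rewrite ltr_wpDl.
have te0 : t + e != 0 by rewrite gt_eqF.
pose v := (t + e)^-1%:C *: (t%:C *: 1 - a).
have [|z [z1 z2]] := @neumann v.
  rewrite snormZr ger0_norm ?invr_ge0 ?ltW // mulrC ltr_pdivrMr // mul1r.
  by rewrite (le_lt_trans ta) // ltrDl.
have E : e%:C *: 1 + a = (t + e)%:C *: (1 - v).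
  by rewrite scalerBr rscaleVK // rscaleDl; ncring.
exists ((t + e)^-1%:C *: z); rewrite E; split.
  by rewrite -scalerAl -scalerAr rscaleVK.
by rewrite -scalerAl -scalerAr rscaleK.
Qed.

(** d d^* = 2 ((Re d)^2 + (Im d)^2) - d^* d. *)
Lemma nonneg_of_neg_starM (d w : A) : star w = w -> star d * d = - (w * w) ->
  nonneg (d * star d).
Proof.
move=> sw dw; have -> : d * star d =
    2%:C *: (re_part d * re_part d + im_part d * im_part d) + w * w.
  by rewrite -starM_starM dw; ncring.
apply: nonnegD; last exact: nonneg_sa_sqr.
apply: nonnegZ => //; apply: nonnegD; apply: nonneg_sa_sqr.
  exact: star_re_part.
exact: star_im_part.
Qed.

(** Suppose d is nonzero and let m = |w^2|.  As d d^* >= 0, m + d d^* is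
    invertible, hence so is m + d^* d = m - w^2, by the usual formula relating
    the inverses of 1 + xy and 1 + yx.  But if k^2 = m - w^2 has an inverse Z
    of norm less than T, then k^2 >= 1/T, so that w^2 <= m - 1/T, which
    contradicts |w^2| = m. *)
Lemma neg_starM_eq0 (d w : A) : star w = w -> star d * d = - (w * w) -> d = 0.
Proof.
move=> sw dw; have [-> //|d0] := eqVneq d 0; exfalso.
set m := p (w * w).
have m0 : 0 < m.
  rewrite lt_def snorm_ge0 andbT; apply: contra d0 => /eqP/snorm_eq0 ww.
  by apply/eqP/starM_eq0; rewrite dw ww oppr0.
have mn0 : m != 0 by rewrite gt_eqF.
have [z [z1 _]] := nonneg_shift_invertible m0 (nonneg_of_neg_starM sw dw).
have [k [sk wk _ _ _]] := sa_sqr_complement sw (lexx m).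
have kk : k * k = m%:C *: 1 + star d * d by rewrite dw -wk; ncring.
(* The inverse of m + yx from the inverse z of m + xy, where xy = d d^*. *)
pose Z := m^-1%:C *: (1 - star d * z * d).
have kZ : k * k * Z = 1.
  rewrite /Z -scalerAr kk.
  have -> : (m%:C *: 1 + star d * d) * (1 - star d * z * d) =
      m%:C *: 1 + star d * (1 - (m%:C *: 1 + d * star d) * z) * d.
    have cM : m%:C *: 1 * star d = star d * (m%:C *: 1).
      by rewrite -scalerAl -scalerAr mul1r mulr1.
    move: (m%:C *: 1) cM => M cM.
    have -> : (M + star d * d) * (1 - star d * z * d) =
        M + star d * d - (M * star d) * z * d - star d * d * star d * z * d by ncring.
    by rewrite cM; ncring.
  by rewrite z1 subrr mulr0 mul0r addr0 rscaleK.
have sZ : star Z = Z.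
  have Zk : star Z * (k * k) = 1 by have := congr1 star kZ; rewrite !starM sk star1.
  by rewrite -[LHS]mulr1 -kZ mulrA Zk mul1r.
have Zk : Z * (k * k) = 1 by have := congr1 star kZ; rewrite !starM sk sZ star1.
have cZ : Z * k = k * Z.
  rewrite -[LHS]mulr1 -kZ.
  have -> : Z * k * (k * k * Z) = Z * (k * k) * k * Z by ncring.
  by rewrite Zk mul1r.
have hh : (k * Z) * (k * Z) = Z.
  have -> : k * Z * (k * Z) = k * (Z * k) * Z by ncring.
  by rewrite cZ mulrA kZ mul1r.
have shk : star (k * Z) = k * Z by rewrite starM sk sZ.
pose T := p Z + 1; have T0 : 0 < T by rewrite ltr_wpDl ?snorm_ge0.
have [|v [sv ZT _ _ cv]] := @sa_sqr_complement (k * Z) T shk.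
  by rewrite hh lerDl.
have vk : v * k = k * v by apply: cv; rewrite -mulrA cZ.
(* k^2 (T - Z) = T k^2 - 1, and T - Z is a square commuting with k. *)
have pos1 : nonneg (T%:C *: (k * k) - 1).
  have -> : T%:C *: (k * k) - 1 = (k * v) * (k * v).
    have -> : k * v * (k * v) = k * (v * k) * v by ncring.
    have -> : k * (v * k) * v = k * k * (v * v) by rewrite vk; ncring.
    have -> : v * v = T%:C *: 1 - Z by rewrite -ZT hh; ncring.
    by rewrite mulrBr -scalerAr mulr1 kZ.
  by apply: nonneg_sa_sqr; rewrite starM sv sk.
have : p (w * w) <= m - T^-1.
  apply: nonneg_le_norm; first exact: nonneg_sa_sqr.
  have -> : (m - T^-1)%:C *: 1 - w * w = T^-1%:C *: (T%:C *: (k * k) - 1).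
    rewrite scalerBr rscaleK ?gt_eqF // rscaleBl -wk; ncring.
  by apply: nonnegZ => //; rewrite invr_ge0 ltW.
by rewrite -/m lerDl oppr_ge0 invr_le0 leNgt T0.
Qed.

(** With a = c^* c and r = |a| the square root of a^2, the product d = cq,
    q = r - a, satisfies d^* d = - q r q.  By the preceding lemma d = 0, hence
    aq = rq = 0, so q^2 = 0 and a = r. *)
Theorem nonneg_starM c : nonneg (star c * c).
Proof.
have sa := sa_starM c; set a := star c * c in sa *.
have aE : a = star c * c by []; clearbody a.
have [r [sr rr r0 cr]] := nonneg_sqrt (nonneg_sa_sqr sa).
have ra : r * a = a * r by apply: cr; rewrite mulrA.
have [s [ss ssr _ cs]] := nonneg_sqrt r0.
pose q := r - a; have sq : star q = q by rewrite starB sr sa.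
have aq : a * q = - (r * q).
  by rewrite /q !mulrBr rr -ra opprB.
have sq' : s * q = q * s.
  by apply: cs; rewrite /q mulrBr mulrBl ra.
have : c * q = 0.
  apply: (@neg_starM_eq0 _ (s * q)); first by rewrite starM ss sq sq'.
  rewrite starM sq.
  have -> : q * star c * (c * q) = q * (a * q) by rewrite aE; ncring.
  rewrite aq -ssr mulrN; congr (- _).
  have -> : q * (s * s * q) = (q * s) * (s * q) by ncring.
  by rewrite -sq'.
move=> cq; have aq0 : a * q = 0 by rewrite aE -mulrA cq mulr0.
have rq0 : r * q = 0 by apply/eqP; rewrite -oppr_eq0 -aq aq0.
have /subr0_eq <- // : q = 0.
by apply: sa_sqr_eq0 => //; rewrite {1}/q mulrBl aq0 rq0 subrr.
Qed.

Lemma positiveP a : positive a <-> nonneg a.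
Proof.
split=> [[c ->]|/nonneg_sqrt[r [sr <- _ _]]]; first exact: nonneg_starM.
by exists r; rewrite sr.
Qed.

Lemma nonneg_conj a b : nonneg a -> nonneg (star b * a * b).
Proof.
case/nonneg_sqrt=> r [sr <- _ _].
have -> : star b * (r * r) * b = star (r * b) * (r * b) by rewrite starM sr; ncring.
exact: nonneg_starM.
Qed.

Lemma nonneg_norm_conj a b : nonneg a -> nonneg ((p a)%:C *: (star b * b) - star b * a * b).
Proof.
move=> a0; have -> : (p a)%:C *: (star b * b) - star b * a * b =
    star b * ((p a)%:C *: 1 - a) * b.
  by rewrite mulrBr mulrBl -scalerAr mulr1 -scalerAl.
by apply/nonneg_conj/nonneg_bounded_sa => //; case: a0.
Qed.

End CStarAlgebras.

(** * Positive matrices and completely positive maps *)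

Section MatrixPositivity.
Variables (R : realType) (A : cstarAlgType R).

Definition mxadj m n (M : 'M[A]_(m, n)) : 'M[A]_(n, m) := (map_mx star M)^T.

Lemma mxadjE m n (M : 'M[A]_(m, n)) i j : mxadj M i j = star (M j i).
Proof. by rewrite !mxE. Qed.

Lemma addmxE m n (M N : 'M[A]_(m, n)) i j : (M + N) i j = M i j + N i j.
Proof. by rewrite mxE. Qed.

Lemma mxadjK m n (M : 'M[A]_(m, n)) : mxadj (mxadj M) = M.
Proof. by apply/matrixP => i j; rewrite !mxadjE starK. Qed.

Lemma mxadjM m n k (M : 'M[A]_(m, n)) (N : 'M[A]_(n, k)) :
  mxadj (M *m N) = mxadj N *m mxadj M.
Proof.
apply/matrixP => i j; rewrite mxadjE !mxE star_sum.
by apply: eq_bigr => l _; rewrite !mxadjE starM.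
Qed.

Lemma mxadjD m n (M N : 'M[A]_(m, n)) : mxadj (M + N) = mxadj M + mxadj N.
Proof. by apply/matrixP => i j; rewrite !(mxE, mxadjE) starD. Qed.

Lemma mxadjN m n (M : 'M[A]_(m, n)) : mxadj (- M) = - mxadj M.
Proof. by apply/matrixP => i j; rewrite !(mxE, mxadjE) starN. Qed.

Lemma mxadj0 m n : mxadj (0 : 'M[A]_(m, n)) = 0.
Proof. by apply/matrixP => i j; rewrite !(mxE, mxadjE) star0. Qed.

Lemma mxadj_block m1 m2 n1 n2 (M1 : 'M[A]_(m1, n1)) (M2 : 'M[A]_(m1, n2))
    (M3 : 'M[A]_(m2, n1)) (M4 : 'M[A]_(m2, n2)) :
  mxadj (block_mx M1 M2 M3 M4) =
  block_mx (mxadj M1) (mxadj M3) (mxadj M2) (mxadj M4).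
Proof. by rewrite /mxadj map_block_mx tr_block_mx. Qed.

Lemma mxadj_col m1 m2 n (M1 : 'M[A]_(m1, n)) (M2 : 'M[A]_(m2, n)) :
  mxadj (col_mx M1 M2) = row_mx (mxadj M1) (mxadj M2).
Proof. by rewrite /mxadj map_col_mx tr_col_mx. Qed.

Lemma mxadj_gram_nonneg m (v : 'cV[A]_m) : nonneg ((mxadj v *m v) 0 0).
Proof.
by rewrite mxE; apply: nonneg_sum => i; rewrite mxadjE; apply: nonneg_starM.
Qed.

(** The pivots of the Cholesky algorithm. *)
Lemma nonneg_invertible_sqrt (a : A) (e : R) : 0 < e -> nonneg (a - e%:C *: 1) ->
  exists g h : A, [/\ star g = g, star h = h, g * g = a, g * h = 1 & h * g = 1].
Proof.
move=> e0 a0; have [z []] := nonneg_shift_invertible e0 a0.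
rewrite [_ + (a - _)]addrC subrK => az za.
have aN : nonneg a.
  rewrite -(subrK (e%:C *: 1) a); apply: nonnegD => //.
  by apply: nonneg_scalar; apply: ltW.
have [g [sg ga _ cg]] := nonneg_sqrt aN; have [sa _] := aN.
have sz : star z = z.
  have h : star z * a = 1 by have := congr1 star az; rewrite starM star1 sa.
  by rewrite -[LHS]mulr1 -az mulrA h mul1r.
have gz : g * z = z * g by apply: cg; rewrite az za.
exists g, (g * z); split=> //.
- by rewrite starM sg sz gz.
- by rewrite mulrA ga.
- by rewrite gz -mulrA ga.
Qed.

(** Induction on n: if g^2 = a is the top left entry and c the first row
    divided by g, the factor of M has first row (g, c), and the rest of it is
    a factor of the Schur complement D - c^* c.  The lower bound of the
    quadratic form passes to the complement, as one sees on the vectors whose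
    first coordinate makes the first coordinate of M v vanish. *)
Lemma cholesky n (M : 'M[A]_n) (e : R) : 0 < e -> mxadj M = M ->
  (forall v : 'cV_n,
     nonneg ((mxadj v *m M *m v) 0 0 - e%:C *: (mxadj v *m v) 0 0)) ->
  mx_positive M.
Proof.
move=> e0; elim: n M => [|n IH] M sM M0.
  by exists 0; apply/matrixP => -[].
pose a := @ulsubmx A 1 n 1 n M; pose b := @dlsubmx A 1 n 1 n M.
pose D := @drsubmx A 1 n 1 n M.
have ME : M = block_mx a (mxadj b) b D.
  have <- : @ursubmx A 1 n 1 n M = mxadj b.
    by rewrite -{1}sM; apply/matrixP => i j; rewrite !(mxE, mxadjE).
  exact: (esym (@submxK A 1 n 1 n M)).
have M0' (v : 'cV_(1 + n)) : nonneg ((mxadj v *m block_mx a (mxadj b) b D *m v) 0 0 -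
    e%:C *: (mxadj v *m v) 0 0) by rewrite -ME; apply: M0.
have sD : mxadj D = D.
  by rewrite -[RHS]/(@drsubmx A 1 n 1 n M) -sM; apply/matrixP => i j; rewrite !(mxE, mxadjE).
have [g [h [sg sh ga gh hg]]] : exists g h : 'M[A]_1,
    [/\ mxadj g = g, mxadj h = h, g *m g = a, g *m h = 1%:M & h *m g = 1%:M].
  have [|g [h [sg sh ga gh hg]]] := @nonneg_invertible_sqrt (a 0 0) e e0.
    have := M0' (col_mx 1%:M 0).
    rewrite mxadj_col mxadj0 mul_row_block !mul0mx !addr0 !mul_row_col !mulmx0 !addr0.
    have -> : mxadj 1%:M = 1%:M :> 'M[A]_1.
      by apply/matrixP => i j; rewrite mxadjE !mxE !ord1 eqxx star1.
    by rewrite !mul1mx mulmx1 [(1%:M : 'M[A]_1) 0 0]mxE.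
  have E x y : x%:M *m y%:M = (x * y)%:M :> 'M[A]_1.
    by apply/matrixP => i j; rewrite !mxE big_ord1 !mxE !ord1 eqxx.
  have S x : star x = x -> mxadj x%:M = x%:M :> 'M[A]_1.
    by move=> sx; apply/matrixP => i j; rewrite mxadjE !mxE !ord1 eqxx sx.
  exists g%:M, h%:M; rewrite !E gh hg ga !S //; split=> //.
  by rewrite -mx11_scalar.
pose c := h *m mxadj b; have cE : mxadj c = b *m h by rewrite mxadjM mxadjK sh.
have gc : g *m c = mxadj b by rewrite mulmxA gh mul1mx.
have cg : mxadj c *m g = b by rewrite cE -mulmxA hg mulmx1.
clearbody c; clear cE.
have [||C' CE] := IH (D - mxadj c *m c).
- by rewrite mxadjD mxadjN mxadjM mxadjK sD.
(* The first coordinate u makes the first row of M vanish at (u, w). *)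
- move=> w; pose u := - (h *m c *m w).
  have au : a *m u = - (mxadj b *m w).
    by rewrite /u mulmxN -ga !mulmxA -(mulmxA g g h) gh mulmx1 gc.
  have bu : b *m u = - (mxadj c *m c *m w).
    by rewrite /u mulmxN -cg !mulmxA -(mulmxA _ g h) gh mulmx1.
  have := M0' (col_mx u w).
  have -> : mxadj (col_mx u w) *m block_mx a (mxadj b) b D *m col_mx u w =
      mxadj w *m (D - mxadj c *m c) *m w.
    rewrite -!mulmxA mul_block_col au bu addNr mxadj_col mul_row_col mulmx0 add0r.
    by rewrite mulmxBl addrC.
  rewrite mxadj_col mul_row_col => Mw.
  rewrite -[X in nonneg X](subrK (e%:C *: (mxadj u *m u) 0 0)).
  apply: nonnegD; last by apply: nonnegZ; [exact: ltW|exact: mxadj_gram_nonneg].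
  move: Mw; rewrite addmxE scalerDr opprD.
  by rewrite [- _ - _ in X in nonneg X -> _]addrC addrA.
exists (@block_mx A 1 n 1 n g c 0 C'); rewrite ME.
suff : mxadj (block_mx g c 0 C') *m block_mx g c 0 C' = block_mx a (mxadj b) b D.
  by move/esym.
rewrite mxadj_block mulmx_block sg mxadj0 !mulmx0 !mul0mx !addr0 gc cg ga.
by rewrite -[mxadj C' *m C']CE addrC subrK.
Qed.

Lemma mulmx_scale_map m n k (X : 'M[A]_(m, n)) (Z : 'M[A]_(n, k)) (c : R[i]) Y i j :
  (X *m map_mx (fun x : A => c *: x) Y *m Z) i j = c *: (X *m Y *m Z) i j.
Proof.
rewrite !mxE scaler_sumr; apply: eq_bigr => l _; rewrite scalerAl; congr (_ * _).
rewrite !mxE scaler_sumr; apply: eq_bigr => l' _.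
by rewrite !mxE scalerAr.
Qed.

(** M + e is a square C^* C for each e > 0, so that alpha applied to M + e is
    positive; let e tend to 0. *)
Lemma completely_positive_form (alpha : {linear A -> A}) n (M : 'M[A]_n) (c : 'cV[A]_n) :
  completely_positive alpha -> mxadj M = M ->
  (forall v : 'cV_n, nonneg ((mxadj v *m M *m v) 0 0)) ->
  nonneg ((mxadj c *m map_mx alpha M *m c) 0 0).
Proof.
move=> acp sM M0.
apply: (@nonneg_add_eps _ _ _ ((mxadj c *m map_mx alpha 1%:M *m c) 0 0)) => e e0.
pose N := M + map_mx (fun x => e%:C *: x) 1%:M.
have sN : mxadj N = N.
  rewrite mxadjD sM; congr (_ + _); apply/matrixP => i j.
  by rewrite mxadjE !mxE star_rscale eq_sym; case: eqP; rewrite ?star1 ?star0.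
have [|C CE] := acp _ N.
  apply: (cholesky e0 sN) => v.
  rewrite mulmxDr mulmxDl addmxE mulmx_scale_map mulmx1 addrK.
  exact: M0.
have := mxadj_gram_nonneg (C *m c).
rewrite mxadjM mulmxA -(mulmxA (mxadj c)) -[mxadj C *m C]CE map_mxD.
have -> : map_mx alpha (map_mx (fun x : A => e%:C *: x) 1%:M) =
    map_mx (fun x : A => e%:C *: x) (map_mx alpha 1%:M) :> 'M[A]_n.
  by apply/matrixP => i j; rewrite !mxE linearZ.
by rewrite mulmxDr mulmxDl addmxE mulmx_scale_map.
Qed.

End MatrixPositivity.

(** * Interval partitions and their first block *)

Section IntervalRecursion.
Variables (R : realType) (B : starAlgType R).
Implicit Types (F : seq B -> B) (bs : seq B).

(** The sequences 0 = q_0 < ... < q_k = n, built by choosing q_1 = i first and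
    shifting by i a sequence that cuts n - i. *)
Fixpoint cut_seqs (k n : nat) : seq (seq nat) :=
  if k is k'.+1 then
    [seq 0%N :: map (addn i) s | i <- iota 1 n, s <- cut_seqs k' (n - i)]
  else if n is 0 then [:: [:: 0%N]] else [::].

Lemma mem_cut_seqs k n s : (s \in cut_seqs k n) =
  [&& size s == k.+1, head 0%N s == 0%N, last 0%N s == n & sorted ltn s].
Proof.
elim: k n s => [|k IH] n s.
  case: s => [|a [|b s]] /=; rewrite ?andbF //; case: n => [|n] //=.
  - by rewrite inE eqseq_cons eqxx !andbT andbb.
  - by rewrite andbT; case: eqP => // ->.
  - by rewrite inE eqseq_cons /= !andbF.
apply/allpairsPdep/idP => [[i [t [+ + ->]]]|].
  rewrite mem_iota IH add1n ltnS => /andP[i0 iN] /and4P[/eqP st /eqP h0 /eqP tl so].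
  rewrite /= size_map st eqxx /=.
  case: t st h0 tl so => [//|a t] /= _ -> tl so.
  rewrite last_map.
  rewrite tl subnKC // eqxx addn0 i0 /= -{1}(addn0 i).
  rewrite path_map (eq_path (e' := ltn)) // => x y /=.
  by rewrite ltn_add2l.
case: s => [|a [|i s]] //=.
case/and4P => /eqP[ss] /eqP-> /eqP sl /andP[i0 so].
have si : all (leq i) (i :: s).
  by rewrite /= leqnn /=; apply/allP => x /(allP (order_path_min ltn_trans so)) /ltnW.
exists i, (map (subn^~ i) (i :: s)).
have iN : (i <= n)%N.
  by rewrite -sl; apply: (allP si); apply: mem_last.
have E : map (addn i) (map (subn^~ i) (i :: s)) = i :: s.
  rewrite -map_comp -[RHS]map_id; apply/eq_in_map => x /(allP si) ix /=.
  by rewrite subnKC.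
split; [by rewrite mem_iota i0 add1n ltnS| |by rewrite E].
rewrite IH /= (last_map (subn^~ i)) sl subnn size_map ss !eqxx /=.
rewrite -[X in path _ X](subnn i).
apply: (homo_path_in (P := leq i) (f := subn^~ i) _ _ so); last exact: si.
by move=> x y ix iy /= xy; rewrite ltn_sub2r // (leq_ltn_trans ix).
Qed.

Lemma cut_seqs_uniq k n : uniq (cut_seqs k n).
Proof.
elim: k n => [|k IH] n; first by case: n.
apply: allpairs_uniq_dep; [exact: iota_uniq|by move=> i _; apply: IH|].
pose tagd (u : {_ : nat & seq nat}) := tagged u.
move=> [i s] [j t] /allpairsPdep[i' [s' [_ hs e1]]] /allpairsPdep[j' [t' [_ ht e2]]] /=.
have e3 : s = s' := congr1 tagd e1; have e4 : t = t' := congr1 tagd e2.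
rewrite -e3 in hs; rewrite -e4 in ht; clear e1 e2 e3 e4.
move: hs ht; rewrite !mem_cut_seqs.
case: s => // a s /and4P[_ /eqP /= -> _ _]; case: t => // b t /and4P[_ /eqP /= -> _ _].
rewrite /= !addn0 => -[-> st]; rewrite (inj_map _ st) //; exact: addnI.
Qed.

Lemma cut_seqs_oversize k n : (n < k)%N -> cut_seqs k n = [::].
Proof.
elim: k n => // k IH n; rewrite ltnS => nk.
have : all (fun i => cut_seqs k (n - i) == [::]) (iota 1 n).
  apply/allP => i; rewrite mem_iota add1n ltnS => /andP[i0 iN]; rewrite IH //.
  by rewrite (leq_trans _ nk) // ltn_subrL i0 (leq_trans i0).
by rewrite /=; elim: (iota 1 n) => //= i r IHr /andP[/eqP -> /IHr ->].
Qed.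

Lemma cuts_is_cuts n k (q : k.+1.-tuple 'I_n.+1) : (0 < k)%N ->
  cuts q = (map val q \in cut_seqs k n).
Proof.
move=> k0; rewrite mem_cut_seqs size_map size_tuple eqxx /=.
rewrite /cuts !(tnth_nth ord0) /=.
have -> : head 0%N (map val q) = nth ord0 q 0 by case: (val q).
by rewrite (last_nth 0%N) size_map size_tuple /= (nth_map ord0) // size_tuple.
Qed.

Lemma big_cuts k n (g : seq nat -> B) : (0 < k)%N ->
  \sum_(q : k.+1.-tuple 'I_n.+1 | cuts q) g (map val q) =
  \sum_(s <- cut_seqs k n) g s.
Proof.
move=> k0; rewrite -big_filter -(big_map (fun q : k.+1.-tuple _ => map val q) xpredT g).
apply: perm_big; apply: uniq_perm; rewrite ?cut_seqs_uniq //.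
  rewrite map_inj_uniq ?filter_uniq ?index_enum_uniq // => q r /(inj_map val_inj) qr.
  exact: val_inj.
move=> s; apply/mapP/idP => [[q]|hs].
  by rewrite mem_filter cuts_is_cuts // => /andP[h _] ->.
have := hs; rewrite mem_cut_seqs => /and4P[ss h0 hl so].
have sn : all (fun x => x < n.+1)%N s.
  case/lastP: s so hl {hs ss h0} => // s x; rewrite last_rcons => so /eqP <-.
  rewrite all_rcons ltnSn /=; apply/allP => y ys.
  move: so; rewrite (sorted_pairwise ltn_trans) -cats1 pairwise_cat allrel1r.
  by case/andP=> /allP/(_ _ ys)/ltnW.
have st : size (map (@inord n) s) == k.+1 by rewrite size_map.
have sE : map val (Tuple st) = s.
  rewrite -map_comp -[RHS]map_id; apply/eq_in_map => x /(allP sn) xn /=.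
  by rewrite inordK.
by exists (Tuple st); rewrite // mem_filter cuts_is_cuts // sE hs mem_index_enum.
Qed.

Lemma interval_term_cons F bs i k s : (0 < i)%N -> (0 < k)%N ->
  s \in cut_seqs k ((size bs).+1 - i) ->
  interval_term F bs (0%N :: map (addn i) s) =
  F (take i.-1 bs) * nth 0 bs i.-1 * interval_term F (drop i bs) s.
Proof.
case: k => // k i0 _; rewrite mem_cut_seqs => /and4P[/eqP ss /eqP s0 _ so].
have s1 : (1 < size s)%N by rewrite ss.
have sL a c : (a < c)%N -> slots bs (i + a) (i + c) = slots (drop i bs) a c.
  by case: c => // c _; rewrite /slots addnS /= subnDl drop_drop addnC.
have sN j : (j < k.+1)%N -> (nth 0%N s j < nth 0%N s j.+1)%N.
  by move=> jk; apply: (sorted_ltn_nth ltn_trans) => //; rewrite inE ss // ltnW.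
have s00 : nth 0%N s 0 = 0%N by rewrite nth0.
set q := 0%N :: _.
have nE j : (j < k.+2)%N -> nth 0%N q j.+1 = (i + nth 0%N s j)%N.
  by move=> jk; rewrite /= (nth_map 0%N) // ss.
have qs : size q = k.+3 by rewrite /= size_map ss.
have q0 : nth 0%N q 0 = 0%N by [].
clearbody q; rewrite !interval_termE ?qs ?ss //.
rewrite [in LHS]big_nat_recl // [in LHS]big_nat_recl // [in RHS]big_nat_recl //.
rewrite /sep !mul1r !nE // s00 q0 sL; last by rewrite -{1}s00 sN.
rewrite addn0 {1}/slots subn0 drop0 !mulrA; congr (_ * _).
apply: eq_big_nat => j /andP[_ jk]; rewrite !nE ?ltnS // 1?ltnW //.
rewrite sL ?sN //; congr (_ * _); rewrite nth_drop.
by have := sN j (ltnW jk); case: (nth 0%N s j.+1) => // c _; rewrite addnS.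
Qed.

(** Splitting off the first block of an interval partition.  The first block
    is the whole interval, or it ends right before b_(i+1). *)
Lemma interval_sum_recursion F bs :
  interval_sum F bs = F bs +
  \sum_(i < size bs) F (take i bs) * nth 0 bs i * interval_sum F (drop i.+1 bs).
Proof.
have sumE (cs : seq B) m : ((size cs).+1 <= m)%N ->
    interval_sum F cs =
    \sum_(1 <= k < m.+1) \sum_(s <- cut_seqs k (size cs).+1) interval_term F cs s.
  move=> cm; rewrite /interval_sum [RHS](@big_cat_nat _ _ _ (size cs).+2) //=.
  rewrite [X in _ = _ + X]big_nat_cond [X in _ = _ + X]big1 ?addr0; last first.
    by move=> k /andP[/andP[ck _] _]; rewrite cut_seqs_oversize ?big_nil.
  by apply: eq_big_nat => k /andP[k0 _]; rewrite big_cuts.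
set n := (size bs).+1; rewrite (sumE _ n) // big_add1 -[n.+1.-1]/n.
have cutsS k m : cut_seqs k.+1 m =
  [seq 0%N :: map (addn i) s | i <- iota 1 m, s <- cut_seqs k (m - i)] by [].
under eq_bigr => k _ do rewrite cutsS big_allpairs_dep.
rewrite exchange_big -[iota 1 n]/(index_iota 1 n.+1) (big_nat_recr n 1) //.
rewrite [RHS]addrC; congr (_ + _); last first.
  rewrite -/n subnn big_ltn // big_seq1 big_nat_cond big1.
    by rewrite Monoid.mulm1 /interval_term /= addn0 big_geq // mulr1 /slots subn0 drop0 take_size.
  by move=> k /andP[/andP[k0 _] _]; rewrite cut_seqs_oversize ?big_nil.
rewrite big_add1 big_mkord; apply: eq_bigr => i _.
rewrite (sumE _ (size bs)); last by rewrite size_drop -subSn ?subSS ?leq_subr.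
have nE : (n - i.+1 = (size (drop i.+1 bs)).+1)%N.
  by rewrite size_drop /n -[in RHS]subSn.
rewrite /= -/n big_ltn // nE big_nil add0r.
rewrite mulr_sumr; apply: eq_big_nat => k /andP[k0 _].
rewrite mulr_sumr big_seq [RHS]big_seq; apply: eq_bigr => s hs.
by rewrite (interval_term_cons _ _ k0) // -/n nE.
Qed.

End IntervalRecursion.

(** * Positive maps are hermitian *)

Section Hermitian.
Variables (R : realType) (A B : starAlgType R) (f : {linear A -> B}).

Local Notation im := (Complex (0 : R) (1 : R)).

(** Polarization with the elements a + 1 and a + i. *)
Lemma hermitian_of_positive :
  (forall a, star (f (star a * a)) = f (star a * a)) ->
  forall a, f (star a) = star (f a).
Proof.
move=> fp a.
have conj_im : conjc im = - im :> R[i] by apply/eqP; rewrite eq_complex /= oppr0 !eqxx.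
have h1 := fp 1; rewrite star1 mulr1 in h1.
have sum : star (f (star a)) + star (f a) = f (star a) + f a.
  have := fp (a + 1); have -> : star (a + 1) * (a + 1) = star a * a + (star a + a) + 1.
    by rewrite starD star1; ncring.
  by rewrite !linearD !starD fp h1 => /addIr/addrI.
have dif : star (f a) - star (f (star a)) = f (star a) - f a.
  have := fp (a + im *: 1).
  have -> : star (a + im *: 1) * (a + im *: 1) = star a * a + im *: (star a - a) + 1.
    have zz : (im *: 1) * (im *: 1) = -1 :> A.
      by rewrite -scalerAl -scalerAr mulr1 scalerA mul_ii scaleN1r.
    have za x : (im *: 1) * x = im *: x :> A by rewrite -scalerAl mul1r.
    have az x : x * (im *: 1) = im *: x :> A by rewrite -scalerAr mulr1.
    rewrite starD starZc star1 conj_im scaleNr mulrDl mulNr !mulrDr zz za az.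
    by rewrite scalerBr; ncring.
  have fy := linearB f (star a) a; move: (star a - a) fy => y fy.
  rewrite !linearD !starD fp h1 linearZ /= starZc conj_im => /addIr/addrI.
  move/(congr1 (fun x => (- im) *: x)); rewrite !scaleNr !scalerN !scalerA mul_ii.
  by rewrite !scaleN1r !opprK fy starB opprB.
have : 2%:C *: f (star a) = 2%:C *: star (f a).
  rewrite !rscale2.
  have -> : f (star a) + f (star a) = (f (star a) + f a) + (f (star a) - f a) by ncring.
  by rewrite -sum -dif; ncring.
by move/(congr1 (fun x => 2^-1%:C *: x)); rewrite !rscaleK // pnatr_eq0.
Qed.

End Hermitian.

(** * The operator model of the Boolean power *)

Section BooleanFock.
Variables (R : realType) (B : cstarAlgType R).
Variables (mu : distribution B) (alpha : {linear B -> B}).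

Local Notation X := (ncX B).

Implicit Types (P Q : ncpoly B) (b : B) (bs : seq B) (w : word B).

(** The compression to ker mu of the multiplication by X.  Its value at 1 is
    the vector X - mu[X]. *)
Definition centered_mul Q := X * Q - ncC (mu (X * Q)).

(** (d, l) stands for the vector d 1 + sum of the k (x) c, (k, c) in l.  With
    formal sums as lists, no relation has to be quotiented out: the operators
    below satisfy the needed identities on the nose. *)
Definition fock : Type := (B * seq (ncpoly B * B))%type.
Implicit Types (v : fock).

Definition vacuum : fock := (1, [::]).

(** The operator X, twisted by alpha: 1 is sent to alpha(mu[X]) 1 + a (x) 1
    with a = X - mu[X], and k (x) c to <a (x) 1, k (x) c> 1 + Tk (x) c, where
    mu[a^* k] = mu[X k] because mu[k] = 0. *)
Definition fockX v : fock :=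
  (alpha (mu X) * v.1 + \sum_(k <- v.2) alpha (mu (X * k.1)) * k.2,
   (centered_mul 1, v.1) :: [seq (centered_mul k.1, k.2) | k <- v.2]).

Definition fockC b v : fock := (b * v.1, [seq (ncC b * k.1, k.2) | k <- v.2]).

Definition fock_rmul v b : fock := (v.1 * b, [seq (k.1, k.2 * b) | k <- v.2]).

Definition fock_word w v : fock :=
  fockC w.1 (foldr (fun b u => fockX (fockC b u)) v w.2).

(** X b_1 X ... b_n X applied to the vacuum. *)
Definition fock_moment bs : fock :=
  foldr (fun b u => fockX (fockC b u)) (fockX vacuum) bs.

Definition centered v := {in v.2, forall k, mu k.1 = 0}.

Lemma fockC1 v : fockC 1 v = v.
Proof.
case: v => d l; rewrite /fockC mul1r (_ : map _ l = l) //.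
by rewrite -[RHS]map_id; apply: eq_map => -[k c] /=; rewrite rmorph1 mul1r.
Qed.

Lemma fockCM b b' v : fockC b (fockC b' v) = fockC (b * b') v.
Proof.
rewrite /fockC /= mulrA -map_comp; congr (_, _); apply: eq_map => -[k c] /=.
by rewrite rmorphM mulrA.
Qed.

Lemma dist_ncCl b Q : mu (ncC b * Q) = b * mu Q.
Proof. by have := dist_bimod mu b 1 Q; rewrite rmorph1 !mulr1. Qed.

Lemma dist_ncCr b Q : mu (Q * ncC b) = mu Q * b.
Proof. by have := dist_bimod mu 1 b Q; rewrite rmorph1 !mul1r. Qed.

Lemma centered_mulP Q : mu (centered_mul Q) = 0.
Proof. by rewrite linearB /= dist_const subrr. Qed.

Lemma centered_fockX v : centered (fockX v).
Proof.
move=> k; rewrite inE => /orP[/eqP -> |/mapP[k' _ ->]] /=; exact: centered_mulP.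
Qed.

Lemma centered_fockC b v : centered v -> centered (fockC b v).
Proof. by move=> vc k /mapP[k' /vc h ->] /=; rewrite dist_ncCl h mulr0. Qed.

Lemma centered_fock_word w v : centered v -> centered (fock_word w v).
Proof.
move=> vc; case: w => b0 [|b bs] /=; first exact: centered_fockC.
by apply/centered_fockC/centered_fockX.
Qed.

Lemma fock_rmulX v b : fockX (fock_rmul v b) = fock_rmul (fockX v) b.
Proof.
rewrite /fockX /fock_rmul /= big_map mulrDl mulr_suml mulrA -!map_comp.
by congr (_ + _, _); apply: eq_bigr => k _; rewrite mulrA.
Qed.

Lemma fock_rmulC v b b' : fockC b' (fock_rmul v b) = fock_rmul (fockC b' v) b.
Proof. by rewrite /fockC /fock_rmul /= mulrA -!map_comp. Qed.

Lemma fock_word_rcons b0 bs e :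
  fock_word (b0, rcons bs e) vacuum = fock_rmul (fockC b0 (fock_moment bs)) e.
Proof.
rewrite /fock_word /= foldr_rcons -fock_rmulC; congr fockC.
elim: bs => [|b bs IH] /=; last by rewrite IH fock_rmulC fock_rmulX.
rewrite -fock_rmulX; congr fockX.
by rewrite /fockC /fock_rmul /= mul1r mulr1.
Qed.

(** T b_1 T ... T b_n a: the excursions that have not come back to the
    vacuum. *)
Fixpoint loop_vec bs : ncpoly B :=
  if bs is b :: bs' then centered_mul (ncC b * loop_vec bs') else centered_mul 1.

(** The value of the B-transform of mu at bs, see Btransform_loop_moment. *)
Definition loop_moment bs : B :=
  if bs is b :: bs' then mu (X * (ncC b * loop_vec bs')) else mu X.

(** Classification by the last departure from the vacuum. *)
Lemma fock_moment2 bs :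
  (fock_moment bs).2 =
  mkseq (fun i => (loop_vec (take i bs), nth 0 bs i * (fock_moment (drop i.+1 bs)).1))
    (size bs) ++ [:: (loop_vec bs, 1)].
Proof.
elim: bs => [|b bs IH]; first by [].
rewrite /= -map_comp IH map_cat /mkseq /= drop0.
by rewrite (iotaDl 1 0) -!map_comp.
Qed.

(** The vacuum component sums over the returns to the vacuum, that is, over
    interval partitions; each excursion contributes alpha of a loop moment. *)
Lemma fock_moment1 bs : (fock_moment bs).1 = interval_sum (alpha \o loop_moment) bs.
Proof.
have [n] := ubnP (size bs); elim: n bs => // n IH bs; rewrite ltnS => bn.
rewrite interval_sum_recursion; case: bs bn => [|b bs] bn.
  by rewrite /= !big_nil big_ord0 !addr0 mulr1.
rewrite [LHS]/= big_map fock_moment2 big_cat big_seq1 /= mulr1.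
rewrite addrA addrC; congr (_ + _); rewrite big_ord_recl /= drop0 -IH // mulrA.
congr (_ + _); rewrite big_map -{1}(subn0 (size bs)) -/(index_iota 0 (size bs)) big_mkord.
apply: eq_bigr => i _ /=.
rewrite /bump /= add1n mulrA IH // size_drop.
by rewrite (leq_trans _ bn) // ltnS leq_subr.
Qed.

End BooleanFock.

(** * Moments of the Boolean power *)

Section BooleanPowerMoments.
Variables (R : realType) (B : cstarAlgType R).
Variables (mu : distribution B).
Local Notation X := (ncX B).

(** For alpha the identity, the model is the algebra of polynomials acting on
    itself, through this map. *)
Definition fock_poly (v : fock B) : ncpoly B := ncC v.1 + \sum_(k <- v.2) k.1 * ncC k.2.

Lemma fock_polyX v : fock_poly (fockX mu idfun v) = X * fock_poly v.
Proof.
rewrite /fock_poly /fockX /= big_cons big_map linearD linear_sum /= mulrDr.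
have -> : \sum_(k <- v.2) centered_mul mu k.1 * ncC k.2 =
   X * \sum_(k <- v.2) k.1 * ncC k.2 - \sum_(k <- v.2) ncC (mu (X * k.1) * k.2).
  rewrite mulr_sumr -sumrB; apply: eq_bigr => k _.
  by rewrite /centered_mul mulrBl -mulrA rmorphM.
by rewrite /centered_mul mulr1 rmorphM; ncring.
Qed.

Lemma fock_polyC b v : fock_poly (fockC b v) = ncC b * fock_poly v.
Proof.
rewrite /fock_poly /fockC /= big_map rmorphM mulrDr mulr_sumr; congr (_ + _).
by apply: eq_bigr => k _; rewrite mulrA.
Qed.

Lemma dist_fock_poly v : centered mu v -> mu (fock_poly v) = v.1.
Proof.
move=> vc; rewrite linearD linear_sum /= dist_const big_seq big1 ?addr0 // => k /vc h.
by rewrite dist_ncCr h mul0r.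
Qed.

(** For alpha the identity, the vacuum moments of the model are the moments
    of mu, and fock_moment1 exhibits the loop moments as a solution of the
    equations that characterize the B-transform. *)
Lemma Btransform_loop_moment : Btransform mu =1 loop_moment mu.
Proof.
apply: interval_sum_inj => bs; rewrite -BtransformP.
rewrite -[interval_sum (loop_moment mu)]/(interval_sum (idfun \o loop_moment mu)).
rewrite -fock_moment1 -dist_fock_poly; last first.
  by case: bs => [|b bs]; exact: centered_fockX.
rewrite /moment_fun; congr (mu _); elim: bs => [|b bs IH].
  rewrite big_nil mulr1 /= fock_polyX /fock_poly /= big_nil addr0 rmorph1 mulr1 //.
by rewrite big_cons -mulrA IH /= fock_polyX fock_polyC.
Qed.

Lemma boolean_power_moment alpha bs :
  moment_fun (boolean_power mu alpha) bs = (fock_moment mu alpha bs).1.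
Proof.
rewrite BtransformP fock_moment1; congr (interval_sum _ bs); apply/funext => cs.
by rewrite Btransform_boolean_power /= Btransform_loop_moment.
Qed.

Lemma boolean_power_word alpha b0 bs :
  boolean_power mu alpha (ncmonom b0 bs) = (fock_word mu alpha (b0, bs) (vacuum B)).1.
Proof.
case/lastP: bs => [|bs e].
  by rewrite /ncmonom big_nil mulr1 dist_const /= mulr1.
by rewrite distribution_monom boolean_power_moment fock_word_rcons.
Qed.

End BooleanPowerMoments.

(** * Positivity of the Boolean power *)

Section BooleanPowerPositive.
Variables (R : realType) (B : cstarAlgType R).
Variables (mu : distribution B) (alpha : {linear B -> B}).
Hypotheses (mu_pos : Sigma mu) (alpha_cp : completely_positive alpha).
Local Notation X := (ncX B).

Lemma dist_star P : mu (star P) = star (mu P).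
Proof.
apply: hermitian_of_positive => Q; have [c ->] := mu_pos Q; exact: sa_starM.
Qed.

Lemma cp_positive a : positive a -> positive (alpha a).
Proof.
case=> c ->; have [|C CE] := @alpha_cp 1 (star c * c)%:M.
  exists c%:M; apply/matrixP => i j.
  by rewrite !mxE big_ord1 !mxE !ord1 eqxx.
exists (C 0 0); have /matrixP/(_ 0 0) := CE.
by rewrite !mxE big_ord1 !mxE eqxx mulr1n.
Qed.

Lemma cp_star a : alpha (star a) = star (alpha a).
Proof.
apply: hermitian_of_positive => c.
have [|d ->] := @cp_positive (star c * c); first by exists c.
exact: sa_starM.
Qed.

Definition fock_form (v u : fock B) : B :=
  star v.1 * u.1 +
  \sum_(k <- v.2) \sum_(l <- u.2) star k.2 * alpha (mu (star k.1 * l.1)) * l.2.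

(** The diagonal block T is symmetric because mu[(Tk)^* l] = mu[k^* X l] for k
    and l in the kernel of mu; the off-diagonal blocks are adjoint to each
    other by the choice of fockX. *)
Lemma fock_formX v u : centered mu v -> centered mu u ->
  fock_form (fockX mu alpha v) u = fock_form v (fockX mu alpha u).
Proof.
move=> vc uc; rewrite /fock_form /fockX /= big_cons !big_map.
have tl l : mu l = 0 -> mu (star (centered_mul mu 1) * l) = mu (X * l).
  move=> l0; rewrite /centered_mul mulr1 starB star_ncX star_ncC mulrBl linearB /=.
  by rewrite dist_ncCl l0 mulr0 subr0.
have tk k : mu k = 0 -> mu (star k * centered_mul mu 1) = mu (star k * X).
  move=> k0; rewrite /centered_mul mulr1 mulrBr linearB /= dist_ncCr dist_star k0.
  by rewrite star0 mul0r subr0.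
have tkl k l : mu k = 0 -> mu l = 0 ->
    mu (star (centered_mul mu k) * l) = mu (star k * centered_mul mu l).
  move=> k0 l0; rewrite /centered_mul starB starM star_ncX star_ncC mulrBl mulrBr.
  by rewrite !linearB /= dist_ncCl dist_ncCr dist_star k0 l0 star0 mulr0 mul0r !mulrA.
rewrite starD starM -cp_star -dist_star star_ncX star_sum mulrDl mulr_suml mulrDr -!addrA.
rewrite mulrA; congr (_ + _).
have -> : \sum_(k <- v.2) star (alpha (mu (X * k.1)) * k.2) * u.1 =
    \sum_(k <- v.2) star k.2 * alpha (mu (star k.1 * centered_mul mu 1)) * u.1.
  rewrite big_seq [RHS]big_seq; apply: eq_bigr => k /vc k0.
  by rewrite tk // starM -cp_star -dist_star starM star_ncX.
have -> : \sum_(l <- u.2) star v.1 * alpha (mu (star (centered_mul mu 1) * l.1)) * l.2 =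
    star v.1 * \sum_(l <- u.2) alpha (mu (X * l.1)) * l.2.
  rewrite mulr_sumr big_seq [RHS]big_seq; apply: eq_bigr => l /uc l0.
  by rewrite tl // mulrA.
rewrite addrCA; congr (_ + _).
under [in RHS]eq_bigr => k _ do rewrite big_cons big_map.
rewrite big_split /=; congr (_ + _).
rewrite big_seq [RHS]big_seq; apply: eq_bigr => k /vc k0.
rewrite big_seq [RHS]big_seq; apply: eq_bigr => l /uc l0.
by rewrite tkl.
Qed.

Lemma fock_formC b v u : fock_form (fockC b v) u = fock_form v (fockC (star b) u).
Proof.
rewrite /fock_form /fockC /= big_map starM mulrA; congr (_ + _).
apply: eq_bigr => k _; rewrite big_map; apply: eq_bigr => l _ /=.
by rewrite starM star_ncC mulrA.
Qed.

(** The letters of the left word are moved one by one to the right-hand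
    side. *)
Lemma fock_form_word (v w : word B) :
  fock_form (fock_word mu alpha v (vacuum B)) (fock_word mu alpha w (vacuum B)) =
  (fock_word mu alpha (wmul (wstar v) w) (vacuum B)).1.
Proof.
case: v => b0 bs; elim: bs b0 w => [|b bs IH] b0 w.
  rewrite [fock_word _ _ (b0, _) _]/fock_word fock_formC fockCM /fock_form /=.
  by rewrite big_nil addr0 star1 mul1r.
have wc := @centered_fock_word _ _ mu alpha.
rewrite [fock_word _ _ (b0, _) _]/fock_word fock_formC /=.
rewrite -[foldr _ _ bs]/(_) -/(fock_word mu alpha (b, bs) (vacuum B)).
rewrite fock_formX; [|exact: wc|exact/centered_fockC/wc].
rewrite {2}/fock_word fockCM.
have -> : fockX mu alpha (fockC (star b0 * w.1)
      (foldr (fun b1 u => fockX mu alpha (fockC b1 u)) (vacuum B) w.2))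
  = fock_word mu alpha (1, (star b0 * w.1) :: w.2) (vacuum B) by rewrite /fock_word fockC1.
rewrite IH.
suff -> : wmul (wstar (b, bs)) (1, star b0 * w.1 :: w.2) = wmul (wstar (b0, b :: bs)) w by [].
rewrite -[LHS]lettersK -[RHS]lettersK; congr wordof.
rewrite !letters_wmul !letters_wstar /letters /= !rev_cons !lmulE mulr1.
by rewrite cat_rcons.
Qed.

(** The quadratic form of the matrix mu[k_i^* k_j] at a vector (v_i) is
    mu[Q^* Q] for Q the sum of the k_i v_i. *)
Lemma fock_form_nonneg (l : seq (ncpoly B * B)) :
  nonneg (\sum_(k <- l) \sum_(k' <- l) star k.2 * alpha (mu (star k.1 * k'.1)) * k'.2).
Proof.
pose n := size l; pose k (i : 'I_n) := nth (0, 0) l i.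
pose M : 'M[B]_n := \matrix_(i, j) mu (star (k i).1 * (k j).1).
pose c : 'cV[B]_n := \col_i (k i).2.
have -> : \sum_(k <- l) \sum_(k' <- l) star k.2 * alpha (mu (star k.1 * k'.1)) * k'.2 =
    (mxadj c *m map_mx alpha M *m c) 0 0.
  rewrite exchange_big mxE (big_nth (0, 0)) big_mkord; apply: eq_bigr => j _.
  rewrite mxE mulr_suml (big_nth (0, 0)) big_mkord; apply: eq_bigr => i _.
  by rewrite mxadjE !mxE.
apply: completely_positive_form => //.
  by apply/matrixP => i j; rewrite mxadjE !mxE -dist_star starM starK.
move=> v; pose Q := \sum_i (k i).1 * ncC (v i 0).
rewrite (_ : _ 0 0 = mu (star Q * Q)); first by apply/positiveP.
rewrite /Q star_sum mulr_sumr linear_sum mxE /=; apply: eq_bigr => j _.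
rewrite mulr_suml linear_sum mxE mulr_suml /=; apply: eq_bigr => i _.
rewrite mxadjE mxE starM star_ncC.
have -> : ncC (star (v i 0)) * star (k i).1 * ((k j).1 * ncC (v j 0)) =
   ncC (star (v i 0)) * (star (k i).1 * (k j).1) * ncC (v j 0) by ncring.
by rewrite dist_bimod.
Qed.

Theorem boolean_power_Sigma : Sigma (boolean_power mu alpha).
Proof.
elim/npiW => P; apply/positiveP.
pose V w := fock_word mu alpha w (vacuum B).
have -> : boolean_power mu alpha (star (npi P) * npi P) =
    \sum_(v <- P) \sum_(w <- P) fock_form (V v) (V w).
  rewrite star_npi npi_mul npi_ncmonom linear_sum big_allpairs_dep big_map.
  apply: eq_bigr => v _; apply: eq_bigr => w _.
  by rewrite boolean_power_word -surjective_pairing fock_form_word.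
pose d := \sum_(w <- P) (V w).1; pose l := flatten [seq (V w).2 | w <- P].
have -> : \sum_(v <- P) \sum_(w <- P) fock_form (V v) (V w) = star d * d +
    \sum_(k <- l) \sum_(k' <- l) star k.2 * alpha (mu (star k.1 * k'.1)) * k'.2.
  rewrite /d star_sum mulr_suml big_flatten big_map -big_split; apply: eq_bigr => v _ /=.
  rewrite mulr_sumr.
  under [X in _ = _ + X]eq_bigr => k _ do rewrite big_flatten big_map.
  by rewrite [X in _ = _ + X]exchange_big -big_split.
by apply: nonnegD; [exact: nonneg_starM|exact: fock_form_nonneg].
Qed.

End BooleanPowerPositive.

(** * Growth of moments and of the B-transform *)

Section GeometricGrowth.
Variables (R : realType) (B : cstarAlgType R).
Local Notation p := (cnorm_seminorm B).
Implicit Types (F : seq B -> B) (bs : seq B) (C : R).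

Definition norm_prod bs : R := \prod_(b <- bs) p b.

Lemma norm_prod_ge0 bs : 0 <= norm_prod bs.
Proof. by apply: prodr_ge0 => b _; apply: snorm_ge0. Qed.

Lemma norm_prod_split bs i : (i < size bs)%N ->
  norm_prod bs = norm_prod (take i bs) * p (nth 0 bs i) * norm_prod (drop i.+1 bs).
Proof.
move=> ib; rewrite -{1}(cat_take_drop i bs) (drop_nth 0 ib) /norm_prod.
by rewrite big_cat big_cons /= mulrA.
Qed.

Definition geometric_growth C F :=
  forall bs, p (F bs) <= C ^+ (size bs).+1 * norm_prod bs.

Lemma growth_weaken C F : 0 <= C ->
  (forall bs, p (F bs) <= 2 ^+ size bs * (C ^+ (size bs).+1 * norm_prod bs)) ->
  geometric_growth (2 * C) F.
Proof.
move=> C0 FC bs; rewrite (le_trans (FC bs)) // exprMn -mulrA ler_wpM2r //.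
  by rewrite mulr_ge0 ?exprn_ge0 ?norm_prod_ge0.
by rewrite ler_eXn2l // ltr1n.
Qed.

Lemma sum_pow2 m : 1 + \sum_(i < m) 2 ^+ i = 2 ^+ m :> R.
Proof.
elim: m => [|m IH]; first by rewrite big_ord0 addr0.
by rewrite big_ord_recr /= addrA IH exprS mulr_natl.
Qed.

(** The three parts of a word with a block split off contribute exactly
    size bs + 1 factors C. *)
Lemma growth_term C F (G : seq B -> B) bs i c d : 0 <= C -> 0 <= c -> 0 <= d ->
  (i < size bs)%N ->
  p (F (take i bs)) <= c * (C ^+ (size (take i bs)).+1 * norm_prod (take i bs)) ->
  p (G (drop i.+1 bs)) <=
    d * (C ^+ (size (drop i.+1 bs)).+1 * norm_prod (drop i.+1 bs)) ->
  p (F (take i bs) * nth 0 bs i * G (drop i.+1 bs)) <=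
  c * d * (C ^+ (size bs).+1 * norm_prod bs).
Proof.
move=> C0 c0 d0 ib; rewrite size_takel ?(ltnW ib) // size_drop => Fb Gb.
have -> : c * d * (C ^+ (size bs).+1 * norm_prod bs) =
   c * (C ^+ i.+1 * norm_prod (take i bs)) * p (nth 0 bs i) *
   (d * (C ^+ (size bs - i.+1).+1 * norm_prod (drop i.+1 bs))).
  rewrite (norm_prod_split ib) -{1}(subnKC ib) -addnS exprD; ring.
by rewrite (le_trans (snormM _ _ _)) // ler_pM ?snorm_ge0 //
  (le_trans (snormM _ _ _)) // ler_pM ?snorm_ge0.
Qed.

(** There are 2 ^ size bs interval partitions, and each of them contributes at
    most C ^ (size bs + 1) * norm_prod bs. *)
Lemma interval_sum_growth C F : 0 <= C -> geometric_growth C F ->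
  geometric_growth (2 * C) (interval_sum F).
Proof.
move=> C0 FC; apply: growth_weaken => // bs.
have [n] := ubnP (size bs); elim: n bs => // n IH bs; rewrite ltnS => bn.
rewrite interval_sum_recursion -sum_pow2 mulrDl mul1r mulr_suml.
rewrite (le_trans (snormD _ _ _)) // lerD //.
rewrite [leRHS](reindex_inj rev_ord_inj) /=.
have h (i : 'I_(size bs)) : p (F (take i bs) * nth 0 bs i * interval_sum F (drop i.+1 bs)) <=
    2 ^+ (size bs - i.+1) * (C ^+ (size bs).+1 * norm_prod bs).
  rewrite -[2 ^+ _]mul1r; apply: growth_term; rewrite ?exprn_ge0 //.
    by rewrite mul1r; apply: FC.
  rewrite -size_drop; apply: IH; rewrite size_drop.
  by rewrite (leq_trans _ bn) // ltn_subrL (leq_trans _ (ltn_ord i)).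
exact: snorm_sum_le.
Qed.

Lemma interval_sum_growth_inv C F : 0 <= C -> geometric_growth C (interval_sum F) ->
  geometric_growth (2 * C) F.
Proof.
move=> C0 FC; apply: growth_weaken => // bs.
have [n] := ubnP (size bs); elim: n bs => // n IH bs; rewrite ltnS => bn.
have -> : F bs = interval_sum F bs -
    \sum_(i < size bs) F (take i bs) * nth 0 bs i * interval_sum F (drop i.+1 bs).
  by rewrite interval_sum_recursion addrK.
rewrite -sum_pow2 mulrDl mul1r mulr_suml.
rewrite (le_trans (snormB _ _ _)) // lerD //.
have h (i : 'I_(size bs)) : p (F (take i bs) * nth 0 bs i * interval_sum F (drop i.+1 bs)) <=
    2 ^+ i * (C ^+ (size bs).+1 * norm_prod bs).
  rewrite -[2 ^+ i]mulr1; apply: growth_term; rewrite ?exprn_ge0 //.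
    rewrite -{2}(size_takel (ltnW (ltn_ord i))); apply: IH.
    by rewrite size_takel ?(ltnW (ltn_ord i)) // (leq_trans (ltn_ord i)).
  by rewrite mul1r; apply: FC.
exact: snorm_sum_le.
Qed.

End GeometricGrowth.

(** * Boundedness of positive maps and of star morphisms *)

Section PositiveMaps.
Variables (R : realType) (A B : cstarAlgType R).
Local Notation pA := (cnorm_seminorm A).
Local Notation pB := (cnorm_seminorm B).

Local Notation im := (Complex (0 : R) (1 : R)).

Lemma snorm_im (C : starAlgType R) (p : cstar_seminorm C) a : p (im *: a) = p a.
Proof.
apply: complexI; rewrite snormZ normc_def /= expr0n expr1n add0r sqrtr1.
by rewrite mul1r.
Qed.

(** For h = h^* and t = |h|, both t f(1) - f(h) and t f(1) + f(h) are positive,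
    which bounds f(h); a general element has a real and an imaginary part. *)
Lemma positive_map_bounded (f : {linear A -> B}) :
  (forall a, positive a -> positive (f a)) ->
  exists2 K : R, 0 <= K & forall a, pB (f a) <= K * pA a.
Proof.
move=> fp; have fn a : nonneg a -> nonneg (f a) by move=> /positiveP/fp/positiveP.
have fZ (t : R) a : f (t%:C *: a) = t%:C *: f a by rewrite linearZ.
have sa h : star h = h -> pB (f h) <= 3 * pB (f 1) * pA h.
  move=> sh; set t := pA h; have t0 : 0 <= t by exact: snorm_ge0.
  have h1 : nonneg (t%:C *: f 1 - f h).
    by rewrite -fZ -linearB; apply/fn/nonneg_bounded_sa.
  have h2 : nonneg (t%:C *: f 1 + f h).
    rewrite -fZ -linearD -[h]opprK; apply/fn/nonneg_bounded_sa.
      by rewrite starN sh.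
    by rewrite snormN.
  have h3 : pB (t%:C *: f 1 - f h) <= 2 * (t * pB (f 1)).
    rewrite -{2}(ger0_norm t0) -snormZr -[X in X * _](@ger0_norm _ (2 : R)) // -snormZr.
    apply: nonneg_norm_mono => //; rewrite rscale2.
    have -> // : t%:C *: f 1 + t%:C *: f 1 - (t%:C *: f 1 - f h) = t%:C *: f 1 + f h.
    by ncring.
  have -> : f h = t%:C *: f 1 - (t%:C *: f 1 - f h) by ncring.
  rewrite (le_trans (snormB _ _ _)) // snormZr ger0_norm //.
  by apply: (le_trans (lerD (lexx _) h3)); rewrite le_eqVlt; apply/orP; left; apply/eqP; ring.
have half a b : pA a <= pA b -> pA (2^-1%:C *: (b + a)) <= pA b.
  move=> ab; rewrite snormZr ger0_norm ?invr_ge0 // mulrC ler_pdivrMr //.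
  by rewrite (le_trans (snormD _ _ _)) // mulr_natr mulr2n lerD.
exists (6 * pB (f 1)); first by rewrite mulr_ge0 ?snorm_ge0.
move=> a; have -> : f a = f (re_part a) + im *: f (im_part a).
  by rewrite {1}(re_im_part a) linearD (linearZ_LR _ im).
rewrite (le_trans (snormD _ _ _)) // snorm_im.
have -> : 6 * pB (f 1) * pA a = 3 * pB (f 1) * pA a + 3 * pB (f 1) * pA a by ring.
have K0 : 0 <= 3 * pB (f 1) by rewrite mulr_ge0 ?snorm_ge0.
apply: lerD; (apply: le_trans (sa _ _) _; first by [exact: star_re_part|exact: star_im_part]).
  by rewrite ler_wpM2l // half ?snorm_star.
rewrite ler_wpM2l // /im_part scaleNr snormN snorm_im half //.
by rewrite snormN snorm_star.
Qed.

(** The morphism carries a square root of |a^* a| - a^* a to one of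
    |a^* a| - f(a)^* f(a). *)
Lemma star_morphism_contractive (f : {lrmorphism A -> B}) :
  (forall a, f (star a) = star (f a)) -> forall a, pB (f a) <= pA a.
Proof.
move=> fs a; rewrite -(ler_pXn2r (n := 2)) ?nnegrE ?snorm_ge0 // -!snorm_starM.
apply: nonneg_le_norm; first exact: nonneg_starM.
have /nonneg_sqrt[c [sc cE _ _]] : nonneg ((pA (star a * a))%:C *: 1 - star a * a).
  by apply: nonneg_bounded_sa => //; exact: sa_starM.
have -> : (pA (star a * a))%:C *: 1 - star (f a) * f a = f (c * c).
  by rewrite -fs -rmorphM cE linearB (linearZ_LR f) rmorph1.
by rewrite rmorphM; apply: nonneg_sa_sqr; rewrite -fs sc.
Qed.

End PositiveMaps.

(** * Growth of the moments of the Boolean power *)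

Section MomentGrowth.
Variables (R : realType) (B : cstarAlgType R) (mu : distribution B).
Local Notation p := (cnorm_seminorm B).

Lemma Sigma0_growth : Sigma0 mu ->
  exists2 C : R, 0 <= C & geometric_growth C (moment_fun mu).
Proof.
case=> M [iota [E [X [[_ iota_star _ Epos _] _ muE]]]].
have [K K0 EK] := positive_map_bounded Epos.
pose pM := cnorm_seminorm M.
have ic := star_morphism_contractive iota_star.
have X0 : 0 <= pM X by exact: snorm_ge0.
exists ((K + 1) * pM X) => [|bs]; first by rewrite mulr_ge0 // addr_ge0.
have -> : moment_fun mu bs = mu (ncmonom 1 (rcons bs 1)).
  by rewrite distribution_monom mul1r mulr1.
rewrite muE rmorph1 mul1r (le_trans (EK _)) // exprMn -mulrA.
apply: ler_pM => //; first exact: snorm_ge0.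
  rewrite exprS (le_trans (_ : K <= K + 1)) ?lerDl //.
  by rewrite ler_peMr ?addr_ge0 // exprn_ege1 // lerDr.
have -> : (size bs).+1 = size (rcons bs 1) by rewrite size_rcons.
have -> : norm_prod bs = norm_prod (rcons bs 1).
  by rewrite /norm_prod -cats1 big_cat big_seq1 snorm1 /= mulr1.
elim: (rcons bs 1) => [|b cs IH]; first by rewrite /norm_prod !big_nil snorm1 mulr1.
rewrite big_cons /norm_prod big_cons /= exprS.
have -> : pM X * pM X ^+ size cs * (p b * norm_prod cs) =
  pM X * p b * (pM X ^+ size cs * norm_prod cs) by ring.
rewrite (le_trans (snormM _ _ _)) // ler_pM ?snorm_ge0 //.
by rewrite (le_trans (snormM _ _ _)) // ler_pM ?snorm_ge0.
Qed.

Lemma boolean_power_growth (alpha : {linear B -> B}) : completely_positive alpha ->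
  (exists2 C : R, 0 <= C & geometric_growth C (moment_fun mu)) ->
  exists2 C : R, 0 <= C & geometric_growth C (moment_fun (boolean_power mu alpha)).
Proof.
move=> acp [C C0 muC].
have [K K0 aK] := positive_map_bounded (cp_positive acp).
exists (2 * ((K + 1) * (2 * C))); first by rewrite !mulr_ge0 // addr_ge0.
move=> bs; rewrite BtransformP; move: bs; apply: interval_sum_growth.
  by rewrite !mulr_ge0 // addr_ge0.
have BC : geometric_growth (2 * C) (Btransform mu).
  by apply: interval_sum_growth_inv => // bs; rewrite -BtransformP.
move=> bs; rewrite Btransform_boolean_power /= (le_trans (aK _)) // exprMn -mulrA.
apply: ler_pM => //; first exact: snorm_ge0.
rewrite exprS (le_trans (_ : K <= K + 1)) ?lerDl //.
by rewrite ler_peMr ?addr_ge0 // exprn_ege1 // lerDr.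
Qed.

End MomentGrowth.

(** * Completion of a C*-seminorm *)

Section CauchySequences.
Variables (R : realType) (A : starAlgType R) (p : cstar_seminorm A).

Record cauchy_seq := CauchySeq {
  cauchy_val :> nat -> A;
  cauchy_valP : scauchy p cauchy_val
}.

HB.instance Definition _ := gen_eqMixin cauchy_seq.
HB.instance Definition _ := gen_choiceMixin cauchy_seq.

Implicit Types (u v w : cauchy_seq).

Fact cauchy_cst a : scauchy p (fun=> a).
Proof. exact: sconv_cauchy (sconv_cst p a). Qed.

Fact cauchy_add u v : scauchy p (fun n => u n + v n).
Proof.
move=> e e0; have e2 : 0 < e / 2 by rewrite divr_gt0.
have [N uN] := cauchy_valP u e2; have [M vM] := cauchy_valP v e2.
exists (maxn N M) => m n; rewrite !geq_max => /andP[Nm Mm] /andP[Nn Mn].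
by rewrite opprD addrACA (le_lt_trans (snormD _ _ _)) // [e]splitr ltrD ?uN ?vM.
Qed.

Fact cauchy_scale c u : scauchy p (fun n => c *: u n).
Proof.
move=> e e0; have k1 : 0 < cmod c + 1 by rewrite ltr_wpDl ?cmod_ge0.
have [|N uN] := cauchy_valP u (e := e / (cmod c + 1)); first by rewrite divr_gt0.
exists N => m n Nm Nn; have := uN m n Nm Nn.
rewrite -scalerBr snorm_scale ltr_pdivlMr // => h; apply: le_lt_trans h.
by rewrite mulrC ler_wpM2l ?snorm_ge0 // lerDl.
Qed.

Fact cauchy_star u : scauchy p (fun n => star (u n)).
Proof.
move=> e /(cauchy_valP u)[N uN]; exists N => m n Nm Nn.
by rewrite -starB snorm_star uN.
Qed.

Lemma cauchy_bounded u : exists K, forall n, p (u n) <= K.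
Proof.
have [N uN] := cauchy_valP u (ltr01 : 0 < 1 :> R).
exists (\sum_(i < N.+1) p (u i) + 1) => n.
have le (i : 'I_N.+1) : p (u i) <= \sum_(j < N.+1) p (u j).
  by rewrite (bigD1 i) //= lerDl sumr_ge0 // => j _; apply: snorm_ge0.
have [nN|Nn] := ltnP n N.+1.
  by rewrite (le_trans (le (Ordinal nN))) // lerDl.
have -> : u n = u N + (u n - u N) by rewrite addrC subrK.
by rewrite (le_trans (snormD _ _ _)) // lerD ?(le ord_max) // ltW // uN // ltnW.
Qed.

Fact cauchy_mul u v : scauchy p (fun n => u n * v n).
Proof.
have [K uK] := cauchy_bounded u; have [L vL] := cauchy_bounded v.
have K0 : 0 <= K by rewrite (le_trans _ (uK 0%N)) ?snorm_ge0.
have L0 : 0 <= L by rewrite (le_trans _ (vL 0%N)) ?snorm_ge0.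
move=> e e0; pose d := e / (K + L + 1).
have s0 : 0 < K + L + 1 by rewrite ltr_wpDl ?addr_ge0.
have d0 : 0 < d by rewrite divr_gt0.
have [N uN] := cauchy_valP u d0; have [M vM] := cauchy_valP v d0.
exists (maxn N M) => m n; rewrite !geq_max => /andP[Nm Mm] /andP[Nn Mn].
have -> : u m * v m - u n * v n = u m * (v m - v n) + (u m - u n) * v n by ncring.
have -> : e = (K + L + 1) * d by rewrite /d mulrC divfK // gt_eqF.
apply: (@le_lt_trans _ _ (K * d + d * L)); last first.
  by rewrite [d * L]mulrC -mulrDl ltr_pM2r // ltrDl.
rewrite (le_trans (snormD _ _ _)) // lerD //.
  by rewrite (le_trans (snormM _ _ _)) // ler_pM ?snorm_ge0 ?uK // ltW ?vM.
by rewrite (le_trans (snormM _ _ _)) // ler_pM ?snorm_ge0 ?vL // ltW ?uN.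
Qed.

Definition cs_cst a := CauchySeq (cauchy_cst a).
Definition cs_add u v := CauchySeq (cauchy_add u v).
Definition cs_scale c u := CauchySeq (cauchy_scale c u).
Definition cs_star u := CauchySeq (cauchy_star u).
Definition cs_mul u v := CauchySeq (cauchy_mul u v).

Definition cs_equiv u v : bool := `[< vanishes (fun n => p (u n - v n)) >].

Lemma cs_equivP u v : reflect (vanishes (fun n => p (u n - v n))) (cs_equiv u v).
Proof. exact: asboolP. Qed.

Fact cs_equiv_refl : reflexive cs_equiv.
Proof.
move=> u; apply/cs_equivP; apply: vanishes_le (@vanishes0 R) _ => n.
by rewrite subrr snorm0 normr0.
Qed.
Fact cs_equiv_sym : symmetric cs_equiv.
Proof.
have h u v : cs_equiv u v -> cs_equiv v u.
  move=> /cs_equivP uv; apply/cs_equivP; apply: vanishes_le uv _ => n.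
  by rewrite -snormN opprB ger0_norm ?snorm_ge0.
by move=> u v; apply/idP/idP; apply: h.
Qed.
Fact cs_equiv_trans : transitive cs_equiv.
Proof.
move=> v u w /cs_equivP uv /cs_equivP vw; apply/cs_equivP.
apply: vanishes_le (vanishesD uv vw) _ => n; rewrite ger0_norm ?snorm_ge0 //.
by rewrite (le_trans _ (snormD _ _ _)) // addrA subrK.
Qed.

Canonical cs_equiv_rel := EquivRel cs_equiv cs_equiv_refl cs_equiv_sym cs_equiv_trans.

(** Cauchy sequences modulo null sequences; elements of seminorm 0 are
    identified with 0 at the same time. *)
Definition completion : Type := {eq_quot cs_equiv}.
HB.instance Definition _ := Choice.on completion.
HB.instance Definition _ := EqQuotient.on completion.

Implicit Types (x y z : completion).

Definition cpi u : completion := \pi_completion u.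

Lemma cpiP u v : vanishes (fun n => p (u n - v n)) <-> cpi u = cpi v.
Proof. by split=> [E|/eqmodP/cs_equivP//]; apply/eqmodP/cs_equivP. Qed.

Lemma cpi_repr x : cpi (repr x) = x.
Proof. exact: reprK. Qed.

Lemma cpiW (T : completion -> Prop) : (forall u, T (cpi u)) -> forall x, T x.
Proof. by move=> H x; rewrite -[x]cpi_repr. Qed.

Lemma cpi_ext u v : u =1 v -> cpi u = cpi v.
Proof.
move=> uv; apply/cpiP; apply: vanishes_le (@vanishes0 R) _ => n.
by rewrite uv subrr snorm0 normr0.
Qed.

Lemma repr_cpi u : vanishes (fun n => p (repr (cpi u) n - u n)).
Proof. by apply/cpiP; rewrite cpi_repr. Qed.

Definition cadd x y := cpi (cs_add (repr x) (repr y)).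
Definition cscale c x := cpi (cs_scale c (repr x)).
Definition cmul x y := cpi (cs_mul (repr x) (repr y)).
Definition cstar x := cpi (cs_star (repr x)).

Lemma cpiD u v : cadd (cpi u) (cpi v) = cpi (cs_add u v).
Proof.
apply/cpiP; apply: vanishes_le (vanishesD (repr_cpi u) (repr_cpi v)) _ => n.
by rewrite ger0_norm ?snorm_ge0 // opprD addrACA snormD.
Qed.

Lemma cpiZ c u : cscale c (cpi u) = cpi (cs_scale c u).
Proof.
apply/cpiP; apply: vanishes_le (vanishesMl (cmod c) (repr_cpi u)) _ => n.
by rewrite ger0_norm ?snorm_ge0 //= -scalerBr snorm_scale.
Qed.

Lemma cpiM u v : cmul (cpi u) (cpi v) = cpi (cs_mul u v).
Proof.
have [K uK] := cauchy_bounded (repr (cpi u)); have [L vL] := cauchy_bounded v.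
apply/cpiP; apply: vanishes_le
  (vanishesD (vanishesMl K (repr_cpi v)) (vanishesMl L (repr_cpi u))) _ => n.
rewrite ger0_norm ?snorm_ge0 //=; set a := cauchy_val (repr (cpi u)) n.
set b := cauchy_val (repr (cpi v)) n.
have -> : a * b - u n * v n = a * (b - v n) + (a - u n) * v n by ncring.
rewrite (le_trans (snormD _ _ _)) // lerD // (le_trans (snormM _ _ _)) //.
  by rewrite ler_wpM2r ?snorm_ge0 ?uK.
by rewrite mulrC ler_wpM2r ?snorm_ge0 ?vL.
Qed.

Lemma cpi_star u : cstar (cpi u) = cpi (cs_star u).
Proof.
apply/cpiP; apply: vanishes_le (repr_cpi u) _ => n.
by rewrite /= -starB snorm_star ger0_norm ?snorm_ge0.
Qed.

Fact caddA : associative cadd.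
Proof.
elim/cpiW=> u; elim/cpiW=> v; elim/cpiW=> w.
by rewrite !cpiD; apply: cpi_ext => n /=; rewrite addrA.
Qed.
Fact caddC : commutative cadd.
Proof.
by elim/cpiW=> u; elim/cpiW=> v; rewrite !cpiD; apply: cpi_ext => n /=; rewrite addrC.
Qed.
Fact cadd0 : left_id (cpi (cs_cst 0)) cadd.
Proof. by elim/cpiW=> u; rewrite !cpiD; apply: cpi_ext => n /=; rewrite add0r. Qed.
Fact caddN : left_inverse (cpi (cs_cst 0)) (cscale (-1)) cadd.
Proof.
elim/cpiW=> u; rewrite cpiZ !cpiD; apply: cpi_ext => n /=.
by rewrite scaleN1r addNr.
Qed.
HB.instance Definition _ := GRing.isZmodule.Build completion caddA caddC cadd0 caddN.

Lemma cpi_add u v : cpi u + cpi v = cpi (cs_add u v).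
Proof. exact: cpiD. Qed.

Lemma cpi_opp u : - cpi u = cpi (cs_scale (-1) u).
Proof. exact: cpiZ. Qed.

Fact cmulA : associative cmul.
Proof.
elim/cpiW=> u; elim/cpiW=> v; elim/cpiW=> w.
by rewrite !cpiM; apply: cpi_ext => n /=; rewrite mulrA.
Qed.
Fact cmul1l : left_id (cpi (cs_cst 1)) cmul.
Proof. by elim/cpiW=> u; rewrite !cpiM; apply: cpi_ext => n /=; rewrite mul1r. Qed.
Fact cmul1r : right_id (cpi (cs_cst 1)) cmul.
Proof. by elim/cpiW=> u; rewrite !cpiM; apply: cpi_ext => n /=; rewrite mulr1. Qed.
Fact cmulDl : left_distributive cmul +%R.
Proof.
elim/cpiW=> u; elim/cpiW=> v; elim/cpiW=> w.
by rewrite !(cpiM, cpi_add); apply: cpi_ext => n /=; rewrite mulrDl.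
Qed.
Fact cmulDr : right_distributive cmul +%R.
Proof.
elim/cpiW=> u; elim/cpiW=> v; elim/cpiW=> w.
by rewrite !(cpiM, cpi_add); apply: cpi_ext => n /=; rewrite mulrDr.
Qed.
Fact cone_neq0 : cpi (cs_cst 1) != 0.
Proof.
apply/eqP => /cpiP /= h; have := snorm1_neq0 p; apply/negP; rewrite negbK.
rewrite eq_le snorm_ge0 andbT; apply: (vanishes_le_lim h) => n.
by rewrite add0r subr0.
Qed.
HB.instance Definition _ := GRing.Zmodule_isNzRing.Build completion
  cmulA cmul1l cmul1r cmulDl cmulDr cone_neq0.

Lemma cpi_mul u v : cpi u * cpi v = cpi (cs_mul u v).
Proof. exact: cpiM. Qed.

Fact cscaleA a b x : cscale a (cscale b x) = cscale (a * b) x.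
Proof. by elim/cpiW: x => u; rewrite !cpiZ; apply: cpi_ext => n /=; rewrite scalerA. Qed.
Fact cscale1 : left_id 1 cscale.
Proof. by elim/cpiW => u; rewrite !cpiZ; apply: cpi_ext => n /=; rewrite scale1r. Qed.
Fact cscaleDr : right_distributive cscale +%R.
Proof.
move=> a; elim/cpiW => u; elim/cpiW => v.
by rewrite !(cpiZ, cpi_add); apply: cpi_ext => n /=; rewrite scalerDr.
Qed.
Fact cscaleDl x : {morph cscale^~ x : a b / a + b}.
Proof.
move=> a b; elim/cpiW: x => u.
by rewrite !(cpiZ, cpi_add); apply: cpi_ext => n /=; rewrite scalerDl.
Qed.
HB.instance Definition _ := GRing.Zmodule_isLmodule.Build R[i] completion
  cscaleA cscale1 cscaleDr cscaleDl.

Lemma cpi_scale (c : R[i]) u : c *: cpi u = cpi (cs_scale c u).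
Proof. exact: cpiZ. Qed.

Fact cscaleAl (c : R[i]) x y : c *: (x * y) = (c *: x) * y.
Proof.
elim/cpiW: x => u; elim/cpiW: y => v.
by rewrite !(cpi_scale, cpi_mul); apply: cpi_ext => n /=; rewrite scalerAl.
Qed.
HB.instance Definition _ := GRing.Lmodule_isLalgebra.Build R[i] completion cscaleAl.

Fact cscaleAr (c : R[i]) x y : c *: (x * y) = x * (c *: y).
Proof.
elim/cpiW: x => u; elim/cpiW: y => v.
by rewrite !(cpi_scale, cpi_mul); apply: cpi_ext => n /=; rewrite scalerAr.
Qed.
HB.instance Definition _ := GRing.Lalgebra_isAlgebra.Build R[i] completion cscaleAr.

Fact cstarK : involutive cstar.
Proof. by elim/cpiW => u; rewrite !cpi_star; apply: cpi_ext => n /=; rewrite starK. Qed.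
Fact cstarD : {morph cstar : x y / x + y}.
Proof.
elim/cpiW => u; elim/cpiW => v.
by rewrite !(cpi_star, cpi_add); apply: cpi_ext => n /=; rewrite starD.
Qed.
Fact cstarZ (c : R[i]) x : cstar (c *: x) = conjc c *: cstar x.
Proof.
elim/cpiW: x => u.
by rewrite !(cpi_star, cpi_scale); apply: cpi_ext => n /=; rewrite starZc.
Qed.
Fact cstarM x y : cstar (x * y) = cstar y * cstar x.
Proof.
elim/cpiW: x => u; elim/cpiW: y => v.
by rewrite !(cpi_star, cpi_mul); apply: cpi_ext => n /=; rewrite starM.
Qed.
HB.instance Definition _ := Algebra_isStarAlgebra.Build R completion
  cstarK cstarD cstarZ cstarM.

Lemma star_cpi u : star (cpi u) = cpi (cs_star u).
Proof. exact: cpi_star. Qed.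

Lemma cauchy_norm_converges u : exists l, vanishes (fun n => p (u n) - l).
Proof.
apply: real_cauchy_converges => e /(cauchy_valP u)[N uN]; exists N => m n Nm Nn.
by rewrite (le_lt_trans (snorm_dist _ _ _)) // uN.
Qed.

Definition completion_norm x : R := sval (cid (cauchy_norm_converges (repr x))).

Lemma completion_normE u : vanishes (fun n => p (u n) - completion_norm (cpi u)).
Proof.
rewrite /completion_norm; case: cid => l /= lE.
have h : vanishes (fun n => p (u n) - p (repr (cpi u) n)).
  apply: vanishes_le (repr_cpi u) _ => n.
  by rewrite (le_trans (snorm_dist _ _ _)) // -snormN opprB.
by apply: vanishes_ext (vanishesD h lE) _ => n; rewrite addrA subrK.
Qed.

Lemma completion_norm_unique u l :
  vanishes (fun n => p (u n) - l) -> completion_norm (cpi u) = l.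
Proof.
move=> ul; have h := vanishesD ul (vanishesMl (-1) (completion_normE u)).
apply/eqP; rewrite eq_le; apply/andP; split; last first.
  apply: (vanishes_le_lim (vanishesMl (-1) h)) => n.
  by rewrite le_eqVlt; apply/orP; left; apply/eqP; ring.
apply: (vanishes_le_lim h) => n.
by rewrite le_eqVlt; apply/orP; left; apply/eqP; ring.
Qed.

Lemma vanishes_prod_norm u v : vanishes (fun n => p (u n) * p (v n) -
  completion_norm (cpi u) * completion_norm (cpi v)).
Proof.
have hu := completion_normE u; have hv := completion_normE v.
set a := completion_norm (cpi u) in hu *; set b := completion_norm (cpi v) in hv *.
apply: vanishes_ext (vanishesD (vanishesM hu hv)
  (vanishesD (vanishesMl a hv) (vanishesMl b hu))) _ => n; ring.
Qed.

Fact completion_normD x y :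
  completion_norm (x + y) <= completion_norm x + completion_norm y.
Proof.
elim/cpiW: x => u; elim/cpiW: y => v; rewrite cpi_add.
have h := completion_normE (cs_add u v).
apply: (vanishes_le_lim (vanishesD (vanishesMl (-1) h)
  (vanishesD (completion_normE u) (completion_normE v)))) => n /=.
by have := snormD p (u n) (v n); lra.
Qed.

Fact completion_normZ (c : R[i]) x :
  (completion_norm (c *: x))%:C = `|c| * (completion_norm x)%:C.
Proof.
elim/cpiW: x => u; rewrite cpi_scale normc_def -rmorphM; congr (_%:C).
apply: completion_norm_unique.
apply: vanishes_ext (vanishesMl (cmod c) (completion_normE u)) _ => n /=.
by rewrite mulrBr snorm_scale.
Qed.

Fact completion_norm0_eq0 x : completion_norm x = 0 -> x = 0.
Proof.
elim/cpiW: x => u u0; apply/cpiP.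
apply: vanishes_ext (completion_normE u) _ => n; rewrite u0 /=.
by rewrite !subr0.
Qed.

Fact completion_normM x y :
  completion_norm (x * y) <= completion_norm x * completion_norm y.
Proof.
elim/cpiW: x => u; elim/cpiW: y => v; rewrite cpi_mul.
have h := completion_normE (cs_mul u v).
apply: (vanishes_le_lim (vanishesD (vanishesMl (-1) h) (vanishes_prod_norm u v))) => n /=.
by have := snormM p (u n) (v n); lra.
Qed.

Fact completion_norm_star x :
  completion_norm (star x * x) = completion_norm x ^+ 2.
Proof.
elim/cpiW: x => u; rewrite star_cpi cpi_mul; apply: completion_norm_unique.
by apply: vanishes_ext (vanishes_prod_norm u u) _ => n /=; rewrite snorm_starM.
Qed.

Definition embed a : completion := cpi (cs_cst a).

Lemma completion_norm_embed a : completion_norm (embed a) = p a.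
Proof.
apply: completion_norm_unique; apply: vanishes_ext (@vanishes0 R) _ => n /=.
by rewrite subrr.
Qed.

Lemma embed_cpi u (e : R) : 0 < e ->
  exists N, forall n, (N <= n)%N -> completion_norm (cpi u - embed (u n)) <= e.
Proof.
move=> e0; have [N uN] := cauchy_valP u e0; exists N => n Nn.
rewrite /embed cpi_opp cpi_add; set w := cs_add _ _.
have [M wM] : exists M, forall m, (M <= m)%N -> p (w m) <= e.
  exists N => m Nm; rewrite /= scaleN1r ltW //; exact: uN.
apply/ler_addgt0Pr => d d0; have [M' wM'] := completion_normE w d0.
have := wM' (maxn M M') (leq_maxr _ _); have := wM (maxn M M') (leq_maxl _ _).
by rewrite ltr_norml => h /andP[h1 _]; lra.
Qed.

Lemma completion_normN x : completion_norm (- x) = completion_norm x.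
Proof.
apply: complexI; rewrite -scaleN1r completion_normZ normrN1 mul1r //.
Qed.

Lemma completion_distC x y : completion_norm (x - y) = completion_norm (y - x).
Proof. by rewrite -completion_normN opprB. Qed.

Lemma completion_triangle x y z :
  completion_norm (x - z) <= completion_norm (x - y) + completion_norm (y - z).
Proof. by rewrite (le_trans _ (completion_normD _ _)) // addrA subrK. Qed.

Lemma embedB a b : embed (a - b) = embed a - embed b.
Proof.
rewrite /embed cpi_opp cpi_add; apply: cpi_ext => n /=; by rewrite scaleN1r.
Qed.

(** A diagonal argument: replace x_k by an element of A at distance at most
    1 / (k + 1). *)
Fact completion_complete (x : nat -> completion) :
  (forall e : R, 0 < e -> exists N : nat, forall m n : nat,
    (N <= m)%N -> (N <= n)%N -> completion_norm (x m - x n) < e) ->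
  exists l, forall e : R, 0 < e -> exists N : nat, forall n : nat,
    (N <= n)%N -> completion_norm (x n - l) < e.
Proof.
move=> xC.
have dense k : exists a, completion_norm (x k - embed a) <= k.+1%:R^-1.
  elim/cpiW: (x k) => u; have [|N uN] := @embed_cpi u (k.+1%:R^-1).
    by rewrite invr_gt0 ltr0n.
  by exists (u N); apply: uN.
have [a xa] := choice dense.
have small e : 0 < e -> exists N, forall n, (N <= n)%N -> n.+1%:R^-1 < e :> R.
  move=> e0; exists (Num.bound e^-1) => n Nn.
  have h : e^-1 < (Num.bound e^-1)%:R by rewrite archi_boundP // invr_ge0 ltW.
  by rewrite invf_plt ?posrE ?ltr0n // (lt_le_trans h) // ler_nat leqW.
have aC : scauchy p a.
  move=> e e0; have e4 : 0 < e / 4 by rewrite divr_gt0.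
  have [N xN] := xC _ e4; have [M hM] := small _ e4.
  exists (maxn N M) => m n; rewrite !geq_max => /andP[Nm Mm] /andP[Nn Mn].
  rewrite -completion_norm_embed embedB.
  have h1 := completion_triangle (embed (a m)) (x m) (embed (a n)).
  have h2 := completion_triangle (x m) (x n) (embed (a n)).
  have h3 := xa m; have h4 := xa n; rewrite completion_distC in h3.
  have h5 := xN m n Nm Nn; have h6 := hM m Mm; have h7 := hM n Mn.
  move: h3 h4 h6 h7; move: (m.+1%:R^-1) (n.+1%:R^-1) => r t h3 h4 h6 h7.
  rewrite (le_lt_trans h1) //; lra.
exists (cpi (CauchySeq aC)) => e e0; have e4 : 0 < e / 4 by rewrite divr_gt0.
have [N hN] := small _ e4; have [M hM] := embed_cpi (CauchySeq aC) e4.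
exists (maxn N M) => n; rewrite geq_max => /andP[Nn Mn].
have h1 := completion_triangle (x n) (embed (a n)) (cpi (CauchySeq aC)).
have h2 := hM n Mn; rewrite completion_distC /= in h2.
have h3 := xa n; have h4 := hN n Nn.
by move: h3 h4; move: (n.+1%:R^-1) => r h3 h4; lra.
Qed.

HB.instance Definition _ := StarAlgebra_isCStarAlgebra.Build R completion
  completion_normD completion_normZ completion_norm0_eq0 completion_normM
  completion_norm_star completion_complete.

Fact embed_is_linear : linear embed.
Proof.
by move=> c a b; rewrite /embed cpi_scale cpi_add; apply: cpi_ext.
Qed.
HB.instance Definition _ := GRing.isLinear.Build R[i] A completion _ embed embed_is_linear.

Fact embed_is_monoid_morphism : monoid_morphism embed.
Proof. by split=> [//|a b]; rewrite /embed cpi_mul; apply: cpi_ext. Qed.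
HB.instance Definition _ :=
  GRing.isMonoidMorphism.Build A completion embed embed_is_monoid_morphism.

Lemma star_embed a : star (embed a) = embed (star a).
Proof. by rewrite /embed star_cpi; apply: cpi_ext. Qed.

End CauchySequences.

(** * Extension of bounded maps to the completion *)

Section Extension.
Variables (R : realType) (A : starAlgType R) (p : cstar_seminorm A).
Variables (B : cstarAlgType R) (f : {linear A -> B}) (K : R).
Hypothesis fK : forall a, cnorm_seminorm B (f a) <= K * p a.

Local Notation pB := (cnorm_seminorm B).

Lemma extension_converges (u : cauchy_seq p) : exists l, sconv pB (fun n => f (u n)) l.
Proof.
apply: scauchy_converges => e e0; have k1 : 0 < `|K| + 1 by rewrite ltr_wpDl.
have [|N uN] := cauchy_valP u (e := e / (`|K| + 1)); first by rewrite divr_gt0.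
exists N => m n Nm Nn; have := uN m n Nm Nn.
rewrite ltr_pdivlMr // -linearB; apply: le_lt_trans.
rewrite (le_trans (fK _)) // mulrC ler_wpM2l ?snorm_ge0 //.
by rewrite (le_trans (ler_norm _)) // lerDl.
Qed.

Definition extension (x : completion p) : B := sval (cid (extension_converges (repr x))).

Lemma extension_cpi (u : cauchy_seq p) : sconv pB (fun n => f (u n)) (extension (cpi u)).
Proof.
rewrite /extension; case: cid => l /= lE.
have h : sconv pB (fun n => f (u n) - f (repr (cpi u) n)) 0.
  apply: vanishes_le (vanishesMl K (repr_cpi u)) _ => n.
  by rewrite ger0_norm ?snorm_ge0 // subr0 -linearB -snormN -linearN opprB.
rewrite -[X in sconv _ _ X]add0r; apply: vanishes_ext (sconvD h lE) _ => n.
by rewrite subrK.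
Qed.

Lemma extension_unique (u : cauchy_seq p) l :
  sconv pB (fun n => f (u n)) l -> extension (cpi u) = l.
Proof. exact: sconv_eq (extension_cpi u). Qed.

Fact extension_is_linear : linear extension.
Proof.
move=> c; elim/cpiW => u; elim/cpiW => v; rewrite cpi_scale cpi_add.
apply: extension_unique.
apply: vanishes_ext (sconvD (sconvZ c (extension_cpi u)) (extension_cpi v)) _ => n.
by rewrite /= linearP.
Qed.
HB.instance Definition _ :=
  GRing.isLinear.Build R[i] (completion p) B _ extension extension_is_linear.

Lemma extension_embed a : extension (embed p a) = f a.
Proof. by apply: extension_unique; exact: (sconv_cst pB (f a)). Qed.

Lemma extension_nonneg : (forall a, nonneg (f (star a * a))) ->
  forall x, nonneg (extension (star x * x)).
Proof.
move=> f0; elim/cpiW => u; rewrite star_cpi cpi_mul.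
by apply: nonneg_closed (extension_cpi _) _ => n /=; apply: f0.
Qed.

Lemma extension_bimod a b (c d : B) :
  (forall x, f (a * x * b) = c * f x * d) ->
  forall x, extension (embed p a * x * embed p b) = c * extension x * d.
Proof.
move=> fab; elim/cpiW => u; rewrite /embed !cpi_mul; apply: extension_unique.
by apply: vanishes_ext (sconvM (sconvM (sconv_cst pB c) (extension_cpi u))
  (sconv_cst pB d)) _ => n; rewrite /= fab.
Qed.

End Extension.

(** * Log-convex sequences of geometric growth *)

Section LogConvex.
Variable R : realType.
Implicit Types (g : nat -> R).

Lemma bernoulli (x : R) k : 0 <= x -> 1 + x *+ k <= (1 + x) ^+ k.
Proof.
move=> x0; elim: k => [|k IH]; first by rewrite mulr0n addr0 expr0.
have xk : 0 <= x *+ k by rewrite mulrn_wge0.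
rewrite exprS mulrS; apply: le_trans (_ : (1 + x) * (1 + x *+ k) <= _); first by nra.
by rewrite ler_wpM2l // addr_ge0.
Qed.

(** The ratios of consecutive terms of a log-convex sequence increase, so a
    first ratio above C would make the sequence outgrow C ^ k. *)
Lemma log_convex_growth g (C D : R) : 0 < C -> (forall k, 0 <= g k) ->
  (forall k, g k.+1 ^+ 2 <= g k * g k.+2) -> (forall k, g k ^+ 2 <= D * C ^+ (k + k)) ->
  g 1%N <= C * g 0%N.
Proof.
move=> C0 g0 gg gD; rewrite leNgt; apply/negP => lt.
have g1p : 0 < g 1%N by rewrite (le_lt_trans _ lt) // mulr_ge0 // ltW.
have g0p : 0 < g 0%N.
  rewrite lt_def g0 andbT; apply/eqP => z; have := gg 0%N; rewrite z mul0r.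
  by rewrite leNgt exprn_gt0.
have ratio k : 0 < g k /\ g 1%N * g k <= g 0%N * g k.+1.
  elim: k => [|k [gk IH]]; first by split=> //; rewrite mulrC.
  have gS : 0 < g k.+1.
    by rewrite -(pmulr_rgt0 _ g0p) (lt_le_trans _ IH) // mulr_gt0.
  split=> //; rewrite -(ler_pM2r gk) -mulrA [g k.+1 * _]mulrC mulrA.
  rewrite (le_trans (ler_wpM2r (ltW gS) IH)) // -!mulrA ler_wpM2l // [g k.+2 * _]mulrC.
  by rewrite -expr2 gg.
pose rho := g 1%N / g 0%N; have rC : C < rho by rewrite ltr_pdivlMr.
have r0 : 0 < rho by rewrite (lt_trans C0).
have gk k : rho ^+ k * g 0%N <= g k.
  elim: k => [|k IH]; first by rewrite expr0 mul1r.
  have [_ h] := ratio k; rewrite exprS -mulrA.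
  rewrite (le_trans (ler_wpM2l (ltW r0) IH)) // /rho mulrAC ler_pdivrMr // mulrC.
  by rewrite [g k * _]mulrC (le_trans h) // mulrC.
clearbody rho; pose x := (rho / C) ^+ 2 - 1.
have x0 : 0 < x.
  have h : 1 < rho / C by rewrite ltr_pdivlMr // mul1r.
  by rewrite subr_gt0 exprn_egt1.
have bound k : (1 + x *+ k) * g 0%N ^+ 2 <= D.
  have h : (1 + x) ^+ k * g 0%N ^+ 2 <= D.
    have -> : (1 + x) ^+ k * g 0%N ^+ 2 = (rho ^+ k * g 0%N) ^+ 2 / C ^+ (k + k).
      have -> : 1 + x = (rho / C) ^+ 2 by rewrite /x addrC subrK.
      rewrite -exprM mul2n -addnn expr_div_n exprMn -[(rho ^+ k) ^+ 2]exprM.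
      by rewrite muln2 -addnn mulrAC.
    rewrite ler_pdivrMr ?exprn_gt0 // (le_trans _ (gD k)) //.
    by rewrite ler_pXn2r ?nnegrE ?mulr_ge0 ?exprn_ge0 // ltW.
  by rewrite (le_trans _ h) // ler_wpM2r ?sqr_ge0 // bernoulli // ltW.
have c0 : 0 < x * g 0%N ^+ 2 by rewrite mulr_gt0 // exprn_gt0.
have D0 : 0 <= D.
  by rewrite (le_trans _ (bound 0%N)) // mulr0n addr0 mul1r sqr_ge0.
have h := archi_boundP (divr_ge0 D0 (ltW c0)).
have := bound (Num.bound (D / (x * g 0%N ^+ 2))).
move: h; rewrite ltr_pdivrMr // -mulr_natr; set m := _%:R => h1 h2.
have := sqr_ge0 (g 0%N); nra.
Qed.

End LogConvex.

(** * Growth of a distribution on words *)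

Section WordGrowth.
Variables (R : realType) (B : cstarAlgType R) (nu : distribution B) (C : R).
Hypotheses (C0 : 0 <= C) (nuC : geometric_growth C (moment_fun nu)).
Local Notation p := (cnorm_seminorm B).
Local Notation X := (ncX B).
Implicit Types (v w : word B) (Q : ncpoly B).

Lemma dist_word_growth w :
  p (nu (npi [:: w])) <= C ^+ size w.2 * norm_prod (letters w).
Proof.
case: w => b0 bs; rewrite -ncmonomE; case/lastP: bs => [|bs e].
  by rewrite /ncmonom big_nil mulr1 dist_const expr0 mul1r /norm_prod big_seq1.
rewrite distribution_monom /letters size_rcons /norm_prod big_cons -cats1 big_cat big_seq1 /=.
rewrite -/(norm_prod bs).
have -> : C ^+ (size bs).+1 * (p b0 * (norm_prod bs * p e)) =
  p b0 * (C ^+ (size bs).+1 * norm_prod bs) * p e by ring.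
rewrite (le_trans (snormM _ _ _)) // ler_wpM2r ?snorm_ge0 //.
by rewrite (le_trans (snormM _ _ _)) // ler_wpM2l ?snorm_ge0.
Qed.

Lemma size_letters w : size w.2 = (size (letters w)).-1.
Proof. by []. Qed.

Lemma size_wmul v w : size (wmul v w).2 = (size v.2 + size w.2)%N.
Proof.
rewrite !size_letters letters_wmul; have [s [b ->]] := letters_rcons v.
by rewrite lmulE size_cat size_rcons /= addnS.
Qed.

Lemma norm_prod_wmul v w :
  norm_prod (letters (wmul v w)) <= norm_prod (letters v) * norm_prod (letters w).
Proof.
rewrite letters_wmul; have [s [b ->]] := letters_rcons v.
rewrite lmulE /norm_prod !big_cat -cats1 big_cat big_seq1 !big_cons /=.
rewrite -!mulrA ler_wpM2l ?norm_prod_ge0 // mulrA ler_wpM2r ?norm_prod_ge0 //.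
exact: snormM.
Qed.

Lemma size_wstar w : size (wstar w).2 = size w.2.
Proof. by rewrite !size_letters letters_wstar size_rev size_map. Qed.

Lemma norm_prod_wstar w : norm_prod (letters (wstar w)) = norm_prod (letters w).
Proof.
rewrite letters_wstar /norm_prod (perm_big (map star (letters w))) ?perm_rev //.
by rewrite big_map; apply: eq_bigr => b _; rewrite snorm_star.
Qed.

Definition wordX w : word B := (1, letters w).

Lemma npi_wordX k w : X ^+ k * npi [:: w] = npi [:: iter k wordX w].
Proof.
elim: k => [|k IH]; first by rewrite mul1r.
rewrite exprS -mulrA IH /=; case: (iter _ _ _) => b bs.
by rewrite -!ncmonomE ncmonom_cons rmorph1 mul1r.
Qed.

Lemma size_iter_wordX k w : size (iter k wordX w).2 = (k + size w.2)%N.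
Proof. by elim: k => //= k ->. Qed.

Lemma norm_prod_iter_wordX k w :
  norm_prod (letters (iter k wordX w)) = norm_prod (letters w).
Proof.
elim: k => //= k IH; rewrite /norm_prod /letters /= big_cons snorm1 mul1r.
exact: IH.
Qed.

(** Multiplying words by X ^ k adds k letters X and only coefficients 1, which
    have norm 1: the constant D depends on Q alone. *)
Lemma dist_power_growth Q :
  exists D, forall k, p (nu (star Q * (X ^+ k * Q))) <= D * C ^+ k.
Proof.
elim/npiW: Q => P.
exists (\sum_(v <- P) \sum_(w <- P) C ^+ (size v.2 + size w.2) *
  (norm_prod (letters v) * norm_prod (letters w))) => k.
have -> : star (npi P) * (X ^+ k * npi P) =
    \sum_(v <- P) \sum_(w <- P) npi [:: wmul (wstar v) (iter k wordX w)].
  rewrite star_npi (npi_words (fstar P)) big_map mulr_suml; apply: eq_bigr => v _.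
  rewrite (npi_words P) !mulr_sumr; apply: eq_bigr => w _.
  by rewrite npi_wordX npi_mul.
rewrite linear_sum mulr_suml; apply: snorm_sum_le => v.
rewrite linear_sum mulr_suml; apply: snorm_sum_le => w.
rewrite (le_trans (dist_word_growth _)) // size_wmul size_wstar size_iter_wordX.
rewrite mulrAC -exprD -addnA [(size w.2 + k)%N]addnC ler_wpM2l ?exprn_ge0 //.
by rewrite (le_trans (norm_prod_wmul _ _)) // norm_prod_wstar norm_prod_iter_wordX.
Qed.

End WordGrowth.

(** * The GNS construction *)

Section GNS.
Variables (R : realType) (B : cstarAlgType R) (nu : distribution B).
Hypothesis nu_pos : Sigma nu.
Local Notation p := (cnorm_seminorm B).
Local Notation X := (ncX B).
Implicit Types (P Q : ncpoly B) (b : B).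

Lemma dist_nonneg Q : nonneg (nu (star Q * Q)).
Proof. exact/positiveP/nu_pos. Qed.

Definition gns_vnorm Q : R := Num.sqrt (p (nu (star Q * Q))).
Local Notation q := gns_vnorm.

Lemma gns_vnorm_ge0 Q : 0 <= q Q.
Proof. exact: sqrtr_ge0. Qed.

Lemma gns_vnorm_sqr Q : q Q ^+ 2 = p (nu (star Q * Q)).
Proof. by rewrite sqr_sqrtr ?snorm_ge0. Qed.

Lemma gns_vnorm_le Q (c : R) : 0 <= c -> p (nu (star Q * Q)) <= c ^+ 2 -> q Q <= c.
Proof.
by move=> c0; rewrite -gns_vnorm_sqr ler_pXn2r ?nnegrE ?gns_vnorm_ge0.
Qed.

(** With x = nu[Q^* P] and beta just above |nu[Q^* Q]|, the positivity of nu at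
    P - Q x / beta gives x^* x / beta <= nu[P^* P]. *)
Lemma cauchy_schwarz P Q : p (nu (star P * Q)) <= q P * q Q.
Proof.
pose x := nu (star Q * P); have xs : star x = nu (star P * Q).
  by rewrite -(dist_star nu_pos) starM starK.
rewrite -(ler_pXn2r (n := 2)) ?nnegrE ?snorm_ge0 ?mulr_ge0 ?gns_vnorm_ge0 //.
rewrite exprMn !gns_vnorm_sqr -xs snorm_star.
apply/ler_addgt0Pr => e e0.
have [d d0 de] : exists2 d : R, 0 < d & p (nu (star P * P)) * d <= e.
  exists (e / (p (nu (star P * P)) + 1)).
    by rewrite divr_gt0 // ltr_wpDl ?snorm_ge0.
  rewrite mulrA ler_pdivrMr ?ltr_wpDl ?snorm_ge0 // mulrC.
  by rewrite ler_wpM2l ?(ltW e0) // lerDl.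
pose be := p (nu (star Q * Q)) + d.
have be0 : 0 < be by rewrite ltr_wpDl ?snorm_ge0.
have ben : be != 0 by rewrite gt_eqF.
have key : nonneg (nu (star P * P) - be^-1%:C *: (star x * x)).
  pose T := P - be^-1%:C *: (Q * ncC x).
  have TE : nu (star T * T) = nu (star P * P) - be^-1%:C *: (star x * x)
     - be^-1%:C *: (star x * x) + be^-1%:C *: (be^-1%:C *: (star x * nu (star Q * Q) * x)).
    rewrite /T starB star_rscale starM star_ncC mulrBl !mulrBr -!scalerAl -!scalerAr.
    rewrite !linearB /= !(linearZ_LR nu) mulrA dist_ncCr -xs.
    rewrite -!mulrA dist_ncCl -/x [star Q * (Q * _)]mulrA dist_ncCl dist_ncCr.
    ncring.
  have h1 := dist_nonneg T; rewrite TE in h1.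
  (* x^* nu[Q^* Q] x <= beta x^* x, scaled by 1 / beta^2. *)
  have h2 : nonneg (be^-1%:C *: (be^-1%:C *:
      (be%:C *: (star x * x) - star x * nu (star Q * Q) * x))).
    do 2!(apply: nonnegZ; first by rewrite invr_ge0 ltW).
    rewrite (_ : _ - _ = ((p (nu (star Q * Q)))%:C *: (star x * x) - star x * nu (star Q * Q) * x)
      + d%:C *: (star x * x)); last by rewrite rscaleDl; ncring.
    apply: nonnegD; first by apply: nonneg_norm_conj; exact: dist_nonneg.
    by apply: nonnegZ; [exact: ltW|exact: nonneg_starM].
  have := nonnegD h1 h2; rewrite !scalerBr rscaleK //.
  set u := _ *: (_ *: _); set z := _ *: _; set y := nu _.
  by rewrite (_ : y - z - z + u + (z - u) = y - z) //; ncring.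
have : p (be^-1%:C *: (star x * x)) <= p (nu (star P * P)).
  apply: nonneg_norm_mono => //; apply: nonnegZ; last exact: nonneg_starM.
  by rewrite invr_ge0 ltW.
rewrite snormZr ger0_norm ?invr_ge0 ?(ltW be0) // snorm_starM mulrC ler_pdivrMr // => h.
by rewrite (le_trans h) // /be mulrDr lerD2l.
Qed.

Lemma gns_vnormD P Q : q (P + Q) <= q P + q Q.
Proof.
apply: gns_vnorm_le; first by rewrite addr_ge0 ?gns_vnorm_ge0.
have -> : star (P + Q) * (P + Q) = star P * P + star P * Q + (star Q * P + star Q * Q).
  by rewrite starD; ncring.
rewrite !linearD /= (le_trans (snormD _ _ _)) //.
have h1 := snormD p (nu (star P * P)) (nu (star P * Q)).
have h2 := snormD p (nu (star Q * P)) (nu (star Q * Q)).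
have h3 := cauchy_schwarz P Q; have h4 := cauchy_schwarz Q P.
rewrite -!gns_vnorm_sqr in h1 h2; rewrite sqrrD; lra.
Qed.

Lemma gns_vnormZ (c : R[i]) Q : q (c *: Q) = cmod c * q Q.
Proof.
have cmodJ : cmod (conjc c) = cmod c.
  by rewrite /cmod; case: (c) => x y /=; rewrite sqrrN.
apply/eqP; rewrite -(eqrXn2 (n := 2)) ?mulr_ge0 ?cmod_ge0 ?gns_vnorm_ge0 //.
rewrite exprMn !gns_vnorm_sqr starZc -scalerAl -scalerAr !(linearZ_LR nu).
by rewrite !snorm_scale cmodJ mulrA expr2.
Qed.

Definition gns_bounded P := exists2 c : R, 0 <= c & forall Q, q (P * Q) <= c * q Q.

Lemma gns_boundedM P P' : gns_bounded P -> gns_bounded P' -> gns_bounded (P * P').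
Proof.
move=> [c c0 Pc] [d d0 Pd]; exists (c * d); first exact: mulr_ge0.
by move=> Q; rewrite -!mulrA (le_trans (Pc _)) // ler_wpM2l.
Qed.

Lemma gns_boundedD P P' : gns_bounded P -> gns_bounded P' -> gns_bounded (P + P').
Proof.
move=> [c c0 Pc] [d d0 Pd]; exists (c + d); first exact: addr_ge0.
by move=> Q; rewrite !mulrDl (le_trans (gns_vnormD _ _)) // lerD.
Qed.

(** |b|^2 - b^* b is a square c^2, hence
    |b|^2 nu[Q^* Q] - nu[(bQ)^* (bQ)] = nu[(cQ)^* (cQ)]. *)
Lemma gns_bounded_const b : gns_bounded (ncC b).
Proof.
exists (p b) => [|Q]; first exact: snorm_ge0.
apply: gns_vnorm_le; first by rewrite mulr_ge0 ?snorm_ge0 ?gns_vnorm_ge0.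
rewrite exprMn gns_vnorm_sqr -[X in _ <= X * _](@ger0_norm _ (p b ^+ 2)) ?sqr_ge0 //.
rewrite -snormZr; apply: nonneg_norm_mono; first exact: dist_nonneg.
have [c [sc cE _ _]] := nonneg_sqrt (nonneg_bounded_sa (sa_starM b) (lexx (p (star b * b)))).
have -> : (p b ^+ 2)%:C *: nu (star Q * Q) - nu (star (ncC b * Q) * (ncC b * Q)) =
    nu (star (ncC c * Q) * (ncC c * Q)).
  have E a : star (ncC a * Q) * (ncC a * Q) = star Q * ncC (star a * a) * Q.
    by rewrite starM star_ncC rmorphM; ncring.
  rewrite !E sc cE snorm_starM linearB /= (linearZ_LR (ncC (B := B))) rmorph1.
  by rewrite mulrBr mulrBl linearB /= -scalerAr mulr1 -scalerAl (linearZ_LR nu).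
exact: dist_nonneg.
Qed.

Lemma star_ncX_pow k : star (X ^+ k) = X ^+ k.
Proof.
elim: k => [|k IH]; first by rewrite star1.
by rewrite {1}exprSr starM IH star_ncX -exprS.
Qed.

(** k |-> |X^k Q| is log-convex by Cauchy-Schwarz, since X is self-adjoint.
    The constant C + 1 in place of C makes it positive. *)
Lemma gns_bounded_X (C : R) : 0 <= C -> geometric_growth C (moment_fun nu) ->
  gns_bounded X.
Proof.
move=> C0 nuC; exists (C + 1) => [|Q]; first by rewrite addr_ge0.
have [D QD] := dist_power_growth C0 nuC Q.
have XE k : star (X ^+ k * Q) * (X ^+ k * Q) = star Q * (X ^+ (k + k) * Q).
  by rewrite starM star_ncX_pow exprD; ncring.
pose g k := q (X ^+ k * Q).
have : g 1%N <= (C + 1) * g 0%N; last by rewrite /g expr1 expr0 mul1r.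
apply: (@log_convex_growth _ g _ `|D|).
- by rewrite ltr_wpDl.
- by move=> k; apply: gns_vnorm_ge0.
- move=> k; rewrite gns_vnorm_sqr XE.
  have -> : star Q * (X ^+ (k.+1 + k.+1) * Q) = star (X ^+ k * Q) * (X ^+ k.+2 * Q).
    by rewrite starM star_ncX_pow addSnnS exprD; ncring.
  exact: cauchy_schwarz.
move=> k; rewrite gns_vnorm_sqr XE (le_trans (QD _)) //.
rewrite (le_trans (ler_wpM2r _ (ler_norm D))) ?exprn_ge0 // ler_wpM2l //.
by rewrite lerXn2r ?nnegrE ?addr_ge0 // lerDl.
Qed.

Lemma gns_bounded_all : gns_bounded X -> forall P, gns_bounded P.
Proof.
move=> bX; elim/npiW => P; rewrite npi_ncmonom; apply: big_ind.
- by exists 0 => // Q; rewrite !mul0r /gns_vnorm mulr0 linear0 snorm0 sqrtr0.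
- exact: gns_boundedD.
move=> [b0 bs] _ /=; apply: gns_boundedM; first exact: gns_bounded_const.
apply: big_ind; [|exact: gns_boundedM|move=> b _].
  by rewrite -(rmorph1 (ncC (B := B))); apply: gns_bounded_const.
by apply: gns_boundedM => //; apply: gns_bounded_const.
Qed.

Section Seminorm.
Hypothesis bounded : forall P, gns_bounded P.

(** The norm of the left multiplication by P. *)
Definition gns_norm P : R :=
  inf [set c : R | 0 <= c /\ forall Q, q (P * Q) <= c * q Q]%classic.

Lemma gns_norm_le P (c : R) : 0 <= c -> (forall Q, q (P * Q) <= c * q Q) ->
  gns_norm P <= c.
Proof. by move=> c0 Pc; apply: ge_inf => //; exists 0 => d []. Qed.

Lemma gns_norm_ge0 P : 0 <= gns_norm P.
Proof.
apply: lb_le_inf; last by move=> c [].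
by have [c c0 Pc] := bounded P; exists c.
Qed.

Lemma gns_normP P Q : q (P * Q) <= gns_norm P * q Q.
Proof.
have [Q0|Q0] := eqVneq (q Q) 0.
  by have [c _ /(_ Q)] := bounded P; rewrite Q0 !mulr0.
have Qp : 0 < q Q by rewrite lt_def Q0 gns_vnorm_ge0.
rewrite -ler_pdivrMr //; apply: lb_le_inf.
  by have [c c0 Pc] := bounded P; exists c.
by move=> c [_ /(_ Q)]; rewrite ler_pdivrMr.
Qed.

Fact gns_normD P Q : gns_norm (P + Q) <= gns_norm P + gns_norm Q.
Proof.
apply: gns_norm_le => [|S]; first by rewrite addr_ge0 ?gns_norm_ge0.
by rewrite !mulrDl (le_trans (gns_vnormD _ _)) // lerD ?gns_normP.
Qed.

Fact gns_normZ (c : R[i]) P : (gns_norm (c *: P))%:C = `|c| * (gns_norm P)%:C.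
Proof.
rewrite normc_def -rmorphM; congr (_%:C); rewrite -/(cmod c).
set k := cmod c; have k0 : 0 <= k by exact: cmod_ge0.
have le : gns_norm (c *: P) <= k * gns_norm P.
  apply: gns_norm_le => [|Q]; first by rewrite mulr_ge0 ?gns_norm_ge0.
  by rewrite -scalerAl gns_vnormZ -mulrA ler_wpM2l ?gns_normP.
have [kz|kn] := eqVneq k 0.
  by apply/eqP; rewrite eq_le le kz mul0r gns_norm_ge0.
have kp : 0 < k by rewrite lt_def kn.
apply/eqP; rewrite eq_le le /= mulrC -ler_pdivlMr //.
apply: gns_norm_le => [|Q]; first by rewrite divr_ge0 ?gns_norm_ge0.
by rewrite mulrAC ler_pdivlMr // mulrC -gns_vnormZ scalerAl gns_normP.
Qed.

Fact gns_normM P Q : gns_norm (P * Q) <= gns_norm P * gns_norm Q.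
Proof.
apply: gns_norm_le => [|S]; first by rewrite mulr_ge0 ?gns_norm_ge0.
rewrite -!mulrA (le_trans (gns_normP _ _)) // ler_wpM2l ?gns_norm_ge0 //.
exact: gns_normP.
Qed.

(** |P^* Q|^2 = |<Q, P P^* Q>| <= |Q| |P| |P^* Q|. *)
Lemma gns_norm_star_le P : gns_norm (star P) <= gns_norm P.
Proof.
apply: gns_norm_le => [|Q]; first exact: gns_norm_ge0.
have [z|n] := eqVneq (q (star P * Q)) 0.
  by rewrite z mulr_ge0 ?gns_norm_ge0 ?gns_vnorm_ge0.
have np : 0 < q (star P * Q) by rewrite lt_def n gns_vnorm_ge0.
rewrite -(ler_pM2r np) -expr2 gns_vnorm_sqr starM starK -mulrA.
rewrite (le_trans (cauchy_schwarz _ _)) // mulrC mulrAC ler_wpM2r ?gns_vnorm_ge0 //.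
exact: gns_normP.
Qed.

Fact gns_norm_starM P : gns_norm (star P * P) = gns_norm P ^+ 2.
Proof.
apply/eqP; rewrite eq_le; apply/andP; split.
  by rewrite (le_trans (gns_normM _ _)) // expr2 ler_wpM2r ?gns_norm_ge0 ?gns_norm_star_le.
rewrite -(sqr_sqrtr (gns_norm_ge0 (star P * P))) ler_pXn2r ?nnegrE ?gns_norm_ge0 ?sqrtr_ge0 //.
apply: gns_norm_le => [|Q]; first exact: sqrtr_ge0.
apply: gns_vnorm_le; first by rewrite mulr_ge0 ?sqrtr_ge0 ?gns_vnorm_ge0.
rewrite exprMn sqr_sqrtr ?gns_norm_ge0 // starM -mulrA.
rewrite (le_trans (cauchy_schwarz _ _)) // mulrC expr2 mulrA ler_wpM2r ?gns_vnorm_ge0 //.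
by rewrite [star P * _]mulrA gns_normP.
Qed.

Lemma gns_vnorm1 : q 1 = 1.
Proof.
by rewrite /gns_vnorm star1 mulr1 -(rmorph1 (ncC (B := B))) dist_const snorm1 sqrtr1.
Qed.

Fact gns_norm1_neq0 : gns_norm 1 != 0.
Proof.
have := gns_normP 1 1; rewrite mulr1 gns_vnorm1 mulr1 => h.
by rewrite gt_eqF // (lt_le_trans ltr01).
Qed.

Definition gns_seminorm : cstar_seminorm (ncpoly B) :=
  CstarSeminorm gns_normD gns_normZ gns_normM gns_norm_starM gns_norm1_neq0.

Lemma dist_gns_bounded P : p (nu P) <= 1 * gns_seminorm P.
Proof.
have := cauchy_schwarz 1 P; rewrite star1 mul1r gns_vnorm1 !mul1r => h.
rewrite (le_trans h) // -[P in q P]mulr1 (le_trans (gns_normP _ _)) //.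
by rewrite gns_vnorm1 mulr1.
Qed.

(** The C*-algebra is the completion of the polynomials for the operator
    seminorm, X is the class of the formal variable, and the expectation
    extends nu by continuity. *)
Lemma bounded_Sigma0 : Sigma0 nu.
Proof.
pose E := extension dist_gns_bounded; pose j := embed gns_seminorm.
exists (completion gns_seminorm), (j \o ncC (B := B)), E, (j X); split.
- split.
  + move=> a b /(congr1 E); rewrite /E /= !extension_embed !dist_const //.
  + by move=> b; rewrite /= star_embed star_ncC.
  + have -> : 1 = embed gns_seminorm 1 by rewrite rmorph1.
    by rewrite [LHS](extension_embed dist_gns_bounded) -(rmorph1 (ncC (B := B))) dist_const.
  + move=> m [c ->]; apply/positiveP; apply: extension_nonneg; exact: dist_nonneg.
  + by move=> b b' m; apply: extension_bimod => P; apply: dist_bimod.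
- by rewrite star_embed star_ncX.
move=> b0 bs; rewrite -[nu _](extension_embed dist_gns_bounded); congr (E _).
rewrite /ncmonom rmorphM rmorph_prod; congr (_ * _); apply: eq_bigr => b _.
by rewrite rmorphM.
Qed.

End Seminorm.

Theorem growth_Sigma0 (C : R) : 0 <= C -> geometric_growth C (moment_fun nu) ->
  Sigma0 nu.
Proof.
by move=> C0 nuC; apply/bounded_Sigma0/gns_bounded_all/(gns_bounded_X C0 nuC).
Qed.

End GNS.

Theorem theorem7p5 (R : realType) (B : cstarAlgType R) (mu : distribution B)
    (alpha : {linear B -> B}) (mu_Sigma : Sigma mu)
    (alpha_cp : completely_positive alpha) :
  Sigma (boolean_power mu alpha) /\
  (Sigma0 mu -> Sigma0 (boolean_power mu alpha)).
Proof.
have nu_Sigma := boolean_power_Sigma mu_Sigma alpha_cp; split=> // mu0.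
have [C C0 nuC] := boolean_power_growth alpha_cp (Sigma0_growth mu0).
exact: (growth_Sigma0 nu_Sigma C0 nuC).
Qed.
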